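(* Assume the Directed Min-Wt-Cycle Conjecture (MWCC): there is no sub-$mn$ time algorithm for computing the weight of a minimum weight cycle in directed (weighted) graphs. Then none of the following problems on directed graphs has a sub-$mn$ time algorithm: 2-SiSP, 2-SiSC, $s$-$t$ Replacement Paths, ANSC, Radius, Betweenness Centrality, and Eccentricities.
   Context: A function $g(m,n)$ is sub-$mn$ if $g(m,n)=O(m^{\alpha}n^{\beta})$ for constants $\alpha,\beta$ with $\alpha+\beta<2$; here $n$ is the number of vertices and $m$ the number of edges. Problems: 2-SiSP: given $s,t$, compute a second simple shortest $s$-$t$ path (a shortest simple $s$-$t$ path different from a given shortest one). 2-SiSC: given a vertex $x$, compute a second simple shortest cycle through $x$ (a shortest simple cycle through $x$ different from a given shortest one). $s$-$t$ Replacement Paths: for each edge $e$ on the shortest $s$-$t$ path, compute a shortest $s$-$t$ path avoiding $e$. ANSC: for each vertex, the weight of a shortest cycle through it. Radius: $\min_x\max_y d_G(x,y)$. Eccentricities: $\max_y d_G(x,y)$ for every $x$. Betweenness Centrality: assuming unique shortest paths, given $v$, the number of pairs $s,t\neq v$ whose shortest path contains $v$ as an internal vertex. *)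

(* Defs.v *)
From mathcomp Require Import all_boot all_order all_algebra.
From mathcomp Require Import reals exp.

Set Implicit Arguments.
Unset Strict Implicit.
Unset Printing Implicit Defensive.

(* Simple directed graphs (no loops, no parallel edges; antiparallel edges are
   allowed) with nonnegative integer weights.  The edge list, in arbitrary
   order, is also what an algorithm receives. *)
Record digraph := Digraph {
  nv : nat;
  edges : seq ('I_nv * 'I_nv * nat);
  edges_uniq : uniq [seq e.1 | e <- edges];
  edges_loopless : all (fun e => e.1.1 != e.1.2) edges
}.

Definition ne (G : digraph) : nat := size (edges G).

Section Graph.
Variable G : digraph.
Local Notation V := 'I_(nv G).

Definition arc : rel V := fun u v => (u, v) \in [seq e.1 | e <- edges G].

(* At most one summand, as edges are not repeated. *)
Definition wt (u v : V) : nat := \sum_(e <- edges G | e.1 == (u, v)) e.2.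

Definition consecutive (x : V) (p : seq V) : seq (V * V) := zip (x :: p) p.

Definition weight (x : V) (p : seq V) : nat :=
  \sum_(e <- consecutive x p) wt e.1 e.2.

(* The simple path with vertex sequence s :: p. *)
Definition simple_path (s t : V) (p : seq V) : bool :=
  [&& path arc s p, last s p == t & uniq (s :: p)].

(* The simple cycle x -> p_1 -> ... -> p_k -> x. *)
Definition simple_cycle (x : V) (p : seq V) : bool :=
  cycle arc (x :: p) && uniq (x :: p).

Definition cycle_weight (x : V) (p : seq V) : nat := weight x (rcons p x).

End Graph.

(* o is an element of S minimizing f; None exactly when S is empty. *)
Definition optimal (T : Type) (S : T -> Prop) (f : T -> nat) (o : option T) :
    Prop :=
  if o is Some p then S p /\ (forall q, S q -> f p <= f q)
  else forall q, ~ S q.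

(* d is the minimum of f on S, None standing for +oo. *)
Definition min_value (T : Type) (S : T -> Prop) (f : T -> nat)
    (d : option nat) : Prop :=
  exists2 o : option T, optimal S f o & d = omap f o.

Section Quantities.
Variable G : digraph.
Local Notation V := 'I_(nv G).

Definition shortest_path (s t : V) (p : seq V) : Prop :=
  optimal (simple_path s t) (weight s) (Some p).

Definition shortest_cycle (x : V) (p : seq V) : Prop :=
  optimal (simple_cycle x) (cycle_weight x) (Some p).

Definition is_dist (x y : V) (d : option nat) : Prop :=
  min_value (simple_path x y) (weight x) d.

Definition is_ecc (x : V) (r : option nat) : Prop :=
  exists2 d : V -> option nat, (forall y, is_dist x y (d y)) &
    r = if [forall y, d y != None] then Some (\max_y odflt 0 (d y)) else None.

Definition is_radius (r : option nat) : Prop :=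
  min_value (fun k => exists x : V, is_ecc x (Some k)) id r.

Definition is_min_cycle_weight (d : option nat) : Prop :=
  min_value (fun c : V * seq V => simple_cycle c.1 c.2)
            (fun c => cycle_weight c.1 c.2) d.

Definition unique_shortest_paths : Prop :=
  forall (s t : V) (p q : seq V),
    shortest_path s t p -> shortest_path s t q -> p = q.

(* As s, t <> v, any occurrence of v on an s-t path is internal. *)
Definition is_betweenness (v : V) (k : nat) : Prop :=
  exists2 A : {set V * V},
    (forall s t, (s, t) \in A <->
       [/\ s != v, t != v & exists2 p, shortest_path s t p & v \in p]) &
    k = #|A|.

End Quantities.

(* [query] is the part of the input that follows the graph; [answer x l] says
   that the list l is a correct output on the instance x. *)
Record problem := Problem {
  instance : Type;
  graph : instance -> digraph;
  query : instance -> seq nat;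
  valid : instance -> Prop;
  answer : instance -> seq nat -> Prop
}.

Definition code_graph (G : digraph) : seq nat :=
  nv G :: ne G ::
  flatten [seq [:: val e.1.1; val e.1.2; e.2] | e <- edges G].

Definition code_vertices (n : nat) (p : seq 'I_n) : seq nat :=
  size p :: map val p.

(* +oo is written 0 and the integer d is written d + 1. *)
Definition code_value (d : option nat) : nat := if d is Some k then k.+1 else 0.

Definition code_opt_vertices (n : nat) (o : option (seq 'I_n)) : seq nat :=
  if o is Some p then 1 :: code_vertices p else [:: 0].

Definition min_wt_cycle : problem := {|
  instance := digraph;
  graph := id;
  query := fun _ => [::];
  valid := fun _ => True;
  answer := fun G l =>
    exists2 d, is_min_cycle_weight G d & l = [:: code_value d] |}.

Record path_instance := PathInstance {
  pi_graph : digraph;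
  pi_s : 'I_(nv pi_graph);
  pi_t : 'I_(nv pi_graph);
  pi_path : seq 'I_(nv pi_graph)
}.

Definition path_query (x : path_instance) : seq nat :=
  (pi_s x : nat) :: (pi_t x : nat) :: code_vertices (pi_path x).

Definition path_valid (x : path_instance) : Prop :=
  shortest_path (pi_s x) (pi_t x) (pi_path x).

Definition two_sisp : problem := {|
  instance := path_instance;
  graph := pi_graph;
  query := path_query;
  valid := path_valid;
  answer := fun x l =>
    exists2 o, optimal (fun q => simple_path (pi_s x) (pi_t x) q /\
                                 q <> pi_path x) (weight (pi_s x)) o &
               l = code_opt_vertices o |}.

(* For every edge e of the given path, in order, the weight of a shortest s-t
   path avoiding e.  (Listing the replacement paths vertex by vertex may by
   itself require an output of size n^2.) *)
Definition replacement_paths : problem := {|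
  instance := path_instance;
  graph := pi_graph;
  query := path_query;
  valid := path_valid;
  answer := fun x l =>
    exists2 d : 'I_(nv (pi_graph x)) * 'I_(nv (pi_graph x)) -> option nat,
      (forall e, e \in consecutive (pi_s x) (pi_path x) ->
         min_value (fun q => simple_path (pi_s x) (pi_t x) q /\
                             e \notin consecutive (pi_s x) q)
                   (weight (pi_s x)) (d e)) &
      l = [seq code_value (d e) | e <- consecutive (pi_s x) (pi_path x)] |}.

Record cycle_instance := CycleInstance {
  ci_graph : digraph;
  ci_x : 'I_(nv ci_graph);
  ci_cycle : seq 'I_(nv ci_graph)
}.

Definition two_sisc : problem := {|
  instance := cycle_instance;
  graph := ci_graph;
  query := fun x => (ci_x x : nat) :: code_vertices (ci_cycle x);
  valid := fun x => shortest_cycle (ci_x x) (ci_cycle x);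
  answer := fun x l =>
    exists2 o, optimal (fun q => simple_cycle (ci_x x) q /\ q <> ci_cycle x)
                       (cycle_weight (ci_x x)) o &
               l = code_opt_vertices o |}.

Definition ansc : problem := {|
  instance := digraph;
  graph := id;
  query := fun _ => [::];
  valid := fun _ => True;
  answer := fun G l =>
    exists2 d : 'I_(nv G) -> option nat,
      (forall x, min_value (simple_cycle x) (cycle_weight x) (d x)) &
      l = [seq code_value (d x) | x <- enum 'I_(nv G)] |}.

Definition radius : problem := {|
  instance := digraph;
  graph := id;
  query := fun _ => [::];
  valid := fun _ => True;
  answer := fun G l => exists2 r, is_radius G r & l = [:: code_value r] |}.

Definition eccentricities : problem := {|
  instance := digraph;
  graph := id;
  query := fun _ => [::];
  valid := fun _ => True;
  answer := fun G l =>
    exists2 r : 'I_(nv G) -> option nat,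
      (forall x, is_ecc x (r x)) &
      l = [seq code_value (r x) | x <- enum 'I_(nv G)] |}.

Definition betweenness_centrality : problem := {|
  instance := {G : digraph & 'I_(nv G)};
  graph := fun x => projT1 x;
  query := fun x => [:: (projT2 x : nat)];
  valid := fun x => unique_shortest_paths (projT1 x);
  answer := fun x l => exists2 k, is_betweenness (projT2 x) k & l = [:: k] |}.

(* Structured programs over finitely many random-access arrays, named by
   natural numbers, holding natural numbers. *)
Inductive expr :=
  | Const of nat
  | Fetch of nat & expr
  | Add of expr & expr
  | Sub of expr & expr
  | Mul of expr & expr
  | Div of expr & expr
  | Mod of expr & expr.

Inductive cmd :=
  | Skip
  | Store of nat & expr & expr          (* array, index, value *)
  | Flip of nat & expr                  (* store a fair random bit *)
  | Seq of cmd & cmd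
  | If of expr & cmd & cmd
  | While of expr & cmd.

Definition store := nat -> nat -> nat.

Definition upd (s : store) (a i v : nat) : store :=
  fun b j => if (b == a) && (j == i) then v else s b j.

(* A word holds an integer in 0..B; a computation that produces a larger
   number is stuck. *)
Definition word (B v : nat) : option nat := if v <= B then Some v else None.

Fixpoint eval (B : nat) (s : store) (e : expr) : option nat :=
  let op2 f e1 e2 :=
    obind (fun v1 => obind (fun v2 => word B (f v1 v2)) (eval B s e2))
          (eval B s e1) in
  match e with
  | Const k => word B k
  | Fetch a e1 => obind (fun i => word B (s a i)) (eval B s e1)
  | Add e1 e2 => op2 addn e1 e2
  | Sub e1 e2 => op2 subn e1 e2
  | Mul e1 e2 => op2 muln e1 e2
  | Div e1 e2 => op2 divn e1 e2
  | Mod e1 e2 => op2 modn e1 e2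
  end.

(* [exec B c s w t s' w']: started in store s with the sequence w of coin
   tosses still to come, c terminates after t steps in store s', the tosses w'
   being unused.  An expression has a size fixed by the program, so that its
   evaluation is charged a constant. *)
Inductive exec (B : nat) :
    cmd -> store -> seq bool -> nat -> store -> seq bool -> Prop :=
  | exec_skip s w : exec B Skip s w 1 s w
  | exec_store a e1 e2 s w i v :
      eval B s e1 = Some i -> eval B s e2 = Some v ->
      exec B (Store a e1 e2) s w 1 (upd s a i v) w
  | exec_flip a e s b w i :
      eval B s e = Some i ->
      exec B (Flip a e) s (b :: w) 1 (upd s a i (nat_of_bool b)) w
  | exec_seq c1 c2 s w t1 s1 w1 t2 s2 w2 :
      exec B c1 s w t1 s1 w1 -> exec B c2 s1 w1 t2 s2 w2 ->
      exec B (Seq c1 c2) s w (t1 + t2) s2 w2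
  | exec_if e c1 c2 s w v t s' w' :
      eval B s e = Some v ->
      exec B (if v != 0 then c1 else c2) s w t s' w' ->
      exec B (If e c1 c2) s w t.+1 s' w'
  | exec_while_stop e c s w :
      eval B s e = Some 0 -> exec B (While e c) s w 1 s w
  | exec_while_loop e c s w v t1 s1 w1 t2 s2 w2 :
      eval B s e = Some v.+1 ->
      exec B c s w t1 s1 w1 -> exec B (While e c) s1 w1 t2 s2 w2 ->
      exec B (While e c) s w (t1 + t2).+1 s2 w2.

Definition holds (s : store) (a : nat) (l : seq nat) : Prop :=
  forall i, i < size l -> s a i = nth 0 l i.

Definition input_array : nat := 0.
Definition output_array : nat := 1.

(* With words 0..B, for at least a fraction 1 - 1/n of the sequences of T coin
   tosses, P outputs a correct answer on x within T steps.  Outside of the input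
   the initial memory is arbitrary. *)
Definition solves_in (Q : problem) (P : cmd) (B T : nat) (x : instance Q) :
    Prop :=
  forall s : store, (forall a i, s a i <= B) ->
  holds s input_array (code_graph (graph x) ++ query x) ->
  exists2 A : {set T.-tuple bool},
    (forall w, w \in A -> exists t s' w' l,
       [/\ exec B P s w t s' w', t <= T,
           holds s' output_array l & answer x l]) &
    (nv (graph x)).-1 * 2 ^ T <= nv (graph x) * #|A|.

(* g(m, n) = O(m^alpha n^beta) with alpha + beta < 2.  The two parameters range
   over n <= m, the usual convention for sparse graphs; with m constant and n
   growing, m^alpha n^beta could be smaller than the size of the input. *)
Definition sub_mn (R : realType) (g : nat -> nat -> R) : Prop :=
  exists alpha beta C : R, (alpha + beta < 2)%R /\
    forall m n : nat, 0 < n <= m ->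
      (g m n <= C * (m%:R `^ alpha * n%:R `^ beta))%R.

(* For weights bounded by any fixed power n^c of the number of vertices, P uses
   words of k log n = O(log n) bits and has a sub-mn running time. *)
Definition has_sub_mn_algorithm (R : realType) (Q : problem) : Prop :=
  exists P : cmd, forall c : nat,
  exists (g : nat -> nat -> R) (k : nat), sub_mn g /\
    forall x : instance Q, valid x ->
      0 < nv (graph x) <= ne (graph x) ->
      all (fun e => e.2 <= nv (graph x) ^ c) (edges (graph x)) ->
      exists2 T : nat, (T%:R <= g (ne (graph x)) (nv (graph x)))%R &
        forall B : nat, nv (graph x) ^ k <= B -> solves_in P B T x.

Definition MWCC (R : realType) : Prop := ~ has_sub_mn_algorithm R min_wt_cycle.

(* Main.v *)
(* Each of the seven problems is shown to be at least as hard as computing the least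
   cycle weight, by a program that calls the given one as a subroutine on the arrays
   from 20 on.  From G, with n vertices and m edges, it writes a graph with O(n)
   vertices and O(m) edges (up to logarithmic factors) in which every vertex v is
   split, so that a cycle of G through v becomes a path from one copy of v to the
   other.
   - Replacement paths, 2-SiSP, 2-SiSC: along a path of length 0 with n edges, the
     detours around the edge number v go through the two copies of v.
   - Radius, eccentricities: O(n) auxiliary edges bring everything within distance Q of
     the source of v, except the second copy of v, which a cycle of weight k through v
     puts at distance Q + k.
   - Betweenness centrality: a hub offers, for every v, a way of length 2l + 1 between
     the copies of v, so that its betweenness is less than n exactly if some cycle has
     weight at most l, and binary search applies.  Shortest paths are made unique by
     random low-order bits of the weights (isolation lemma); padding the graph keeps
     the error probability below that allowed for G. *)

From Pilot Require Import Defs.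
From mathcomp Require Import all_boot all_order all_algebra.
From mathcomp Require Import boolp reals exp zify ring.
Import Pilot.Defs.

Set Implicit Arguments.
Unset Strict Implicit.
Unset Printing Implicit Defensive.

(** * Program logic *)

(** The quantifiers shape the reductions. One program must serve every [c], so the number Q that
    stands for +oo is computed from the weights at hand and not from n^c; reading [odflt Q d] for
    the least cycle weight then treats the acyclic case like a cycle of weight Q, heavier than any
    simple cycle. Errors have to fit into 1/n. A single call on a graph with at least n vertices
    does. Betweenness is only a count, so it answers one threshold question per call; each of the
    [rounds] calls can fail in two ways, by a tie among shortest paths or by the called program,
    each with probability at most 1/N for a graph with N vertices. Hence the padding to N >= 2 *
    [rounds] * n. The logarithmic factors are harmless because alpha + beta < 2 is an open
    condition: a small spare power of n absorbs them. All lower bounds on distances follow one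
    scheme: a walk from a fixed vertex is followed edge by edge under an invariant that relates the
    current vertex to what must already have been paid. Walks may replace simple paths, since with
    nonnegative weights both have the same least weight. *)

Fixpoint value (s : store) (e : expr) : nat :=
  match e with
  | Const k => k
  | Fetch a e1 => s a (value s e1)
  | Add e1 e2 => value s e1 + value s e2
  | Sub e1 e2 => value s e1 - value s e2
  | Mul e1 e2 => value s e1 * value s e2
  | Div e1 e2 => value s e1 %/ value s e2
  | Mod e1 e2 => value s e1 %% value s e2
  end.

(* The value of a Fetch is not checked: memory cells always hold words. *)
Fixpoint fits (B : nat) (s : store) (e : expr) : bool :=
  match e with
  | Const k => k <= B
  | Fetch a e1 => fits B s e1
  | Add e1 e2 => [&& fits B s e1, fits B s e2 & value s e1 + value s e2 <= B]
  | Mul e1 e2 => [&& fits B s e1, fits B s e2 & value s e1 * value s e2 <= B]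
  | Sub e1 e2 | Div e1 e2 | Mod e1 e2 => fits B s e1 && fits B s e2
  end.

Fixpoint reads (e : expr) : seq nat :=
  match e with
  | Const _ => [::]
  | Fetch a e1 => a :: reads e1
  | Add e1 e2 | Sub e1 e2 | Mul e1 e2 | Div e1 e2 | Mod e1 e2 =>
      reads e1 ++ reads e2
  end.

Definition bounded (B : nat) (s : store) : Prop := forall a i, s a i <= B.

Lemma value_eq s s' e :
  (forall a, a \in reads e -> s a =1 s' a) -> value s e = value s' e.
Proof.
elim: e => //= [a e IH|e1 IH1 e2 IH2|e1 IH1 e2 IH2|e1 IH1 e2 IH2|e1 IH1 e2 IH2
  |e1 IH1 e2 IH2] E.
  rewrite IH => [|b b_e]; last by apply: E; rewrite inE b_e orbT.
  by apply: E; rewrite inE eqxx.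
all: by rewrite IH1 ?IH2 // => a a_e; apply: E; rewrite mem_cat a_e ?orbT.
Qed.

Lemma fits_eq B s s' e :
  (forall a, a \in reads e -> s a =1 s' a) -> fits B s e = fits B s' e.
Proof.
elim: e => //= [a e IH|e1 IH1 e2 IH2|e1 IH1 e2 IH2|e1 IH1 e2 IH2|e1 IH1 e2 IH2
  |e1 IH1 e2 IH2] E.
  by apply: IH => b b_e; apply: E; rewrite inE b_e orbT.
all: have E1 a : a \in reads e1 -> s a =1 s' a
       by move=> a_e; apply: E; rewrite mem_cat a_e.
all: have E2 a : a \in reads e2 -> s a =1 s' a
       by move=> a_e; apply: E; rewrite mem_cat a_e orbT.
all: by rewrite IH1 // IH2 // ?(value_eq E1) ?(value_eq E2).
Qed.

Lemma value_le B s e : bounded B s -> fits B s e -> value s e <= B.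
Proof.
move=> bs; elim: e => //= [e1 IH1 e2 IH2|e1 IH1 e2 IH2|e1 IH1 e2 IH2
  |e1 IH1 e2 IH2|e1 IH1 e2 IH2].
- by case/and3P.
- by case/andP=> /IH1 h _; exact: leq_trans (leq_subr _ _) h.
- by case/and3P.
- by case/andP=> /IH1 h _; exact: leq_trans (leq_div _ _) h.
- by case/andP=> /IH1 h _; exact: leq_trans (leq_mod _ _) h.
Qed.

Lemma eval_value B s e :
  bounded B s -> fits B s e -> eval B s e = Some (value s e).
Proof.
move=> bs; elim: e => //= [k|a e IH|e1 IH1 e2 IH2|e1 IH1 e2 IH2|e1 IH1 e2 IH2
  |e1 IH1 e2 IH2|e1 IH1 e2 IH2].
- by rewrite /word => ->.
- by move/IH => -> /=; rewrite /word bs.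
- by case/and3P=> /IH1-> /IH2-> /=; rewrite /word => ->.
- case/andP=> f1 /IH2->; rewrite IH1 //= /word.
  by rewrite (leq_trans (leq_subr _ _) (value_le bs f1)).
- by case/and3P=> /IH1-> /IH2-> /=; rewrite /word => ->.
- case/andP=> f1 /IH2->; rewrite IH1 //= /word.
  by rewrite (leq_trans (leq_div _ _) (value_le bs f1)).
- case/andP=> f1 /IH2->; rewrite IH1 //= /word.
  by rewrite (leq_trans (leq_mod _ _) (value_le bs f1)).
Qed.

Lemma eval_le B s e v : eval B s e = Some v -> v <= B.
Proof.
have wordP u x : word B u = Some x -> x <= B.
  by rewrite /word; case: ifP => // h [<-].
case: e => /= [k|a e|e1 e2|e1 e2|e1 e2|e1 e2|e1 e2]; first exact: wordP.
  by case: (eval B s e) => //= i; exact: wordP.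
all: by case: (eval B s e1) => //= v1; case: (eval B s e2) => //= v2; exact: wordP.
Qed.

Lemma bounded_upd B s a i v : v <= B -> bounded B s -> bounded B (upd s a i v).
Proof. by move=> vB bs b j; rewrite /upd; case: ifP. Qed.

Lemma exec_bounded B c s w t s' w' :
  0 < B -> exec B c s w t s' w' -> bounded B s -> bounded B s'.
Proof.
move=> B0; elim=> //.
- by move=> a e1 e2 {}s _ i v _ /eval_le vB; exact: bounded_upd.
- by move=> a e {}s [] _ i _; exact: bounded_upd.
- by move=> c1 c2 {}s _ _ s1 _ _ s2 _ _ H1 _ H2 /H1.
- by move=> e c0 {}s _ v _ s1 _ _ s2 _ _ _ H1 _ H2 /H1.
Qed.

(** A run sees only the prefix [u] that it consumes, so whatever follows can be exchanged freely.
    This is the independence on which all counting of successful toss sequences rests. *)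
Lemma exec_coins B c s w t s' w' : exec B c s w t s' w' ->
  exists2 u, w = u ++ w' & forall z, exec B c s (u ++ z) t s' z.
Proof.
elim=> {c s w t s' w'}.
- by move=> s w; exists [::] => // z; exact: exec_skip.
- by move=> a e1 e2 s w i v E1 E2; exists [::] => // z; exact: exec_store.
- by move=> a e s b w i E; exists [:: b] => // z; exact: exec_flip.
- move=> c1 c2 s w t1 s1 w1 t2 s2 w2 _ [u1 -> x1] _ [u2 -> x2].
  by exists (u1 ++ u2); rewrite ?catA // => z; rewrite -catA; exact: exec_seq (x2 z).
- move=> e c1 c2 s w v t s' w' E _ [u -> x].
  by exists u => // z; exact: exec_if E _.
- by move=> e c s w E; exists [::] => // z; exact: exec_while_stop.
- move=> e c s w v t1 s1 w1 t2 s2 w2 E _ [u1 -> x1] _ [u2 -> x2].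
  exists (u1 ++ u2); rewrite ?catA // => z.
  by rewrite -catA; exact: exec_while_loop E (x1 _) (x2 z).
Qed.

(** * Relocating a called program to the arrays from K on *)

Section Shift.
Variable K : nat.

Fixpoint shift_expr (e : expr) : expr :=
  match e with
  | Const k => Const k
  | Fetch a e1 => Fetch (K + a) (shift_expr e1)
  | Add e1 e2 => Add (shift_expr e1) (shift_expr e2)
  | Sub e1 e2 => Sub (shift_expr e1) (shift_expr e2)
  | Mul e1 e2 => Mul (shift_expr e1) (shift_expr e2)
  | Div e1 e2 => Div (shift_expr e1) (shift_expr e2)
  | Mod e1 e2 => Mod (shift_expr e1) (shift_expr e2)
  end.

Fixpoint shift_cmd (c : cmd) : cmd :=
  match c with
  | Skip => Skip
  | Store a e1 e2 => Store (K + a) (shift_expr e1) (shift_expr e2)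
  | Flip a e => Flip (K + a) (shift_expr e)
  | Seq c1 c2 => Seq (shift_cmd c1) (shift_cmd c2)
  | If e c1 c2 => If (shift_expr e) (shift_cmd c1) (shift_cmd c2)
  | While e c1 => While (shift_expr e) (shift_cmd c1)
  end.

Definition shifted (s S : store) : Prop := forall a i, S (K + a) i = s a i.

Lemma eval_shift B s S e :
  shifted s S -> eval B S (shift_expr e) = eval B s e.
Proof.
move=> sS; elim: e => //= [a e ->|e1 -> e2 ->|e1 -> e2 ->|e1 -> e2 ->
  |e1 -> e2 ->|e1 -> e2 ->] //.
by case: (eval B s e) => //= i; rewrite sS.
Qed.

Lemma shifted_upd s S a i v :
  shifted s S -> shifted (upd s a i v) (upd S (K + a) i v).
Proof. by move=> sS b j; rewrite /upd eqn_add2l; case: ifP. Qed.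

Lemma upd_other s a i v b j : b != a -> upd s a i v b j = s b j.
Proof. by rewrite /upd => /negPf->. Qed.

(** The called program believes that its memory starts at array 0; after relocation the arrays below
    [K] are private to the caller and survive the call. *)
Lemma exec_shift B c s w t s' w' : exec B c s w t s' w' ->
  forall S, shifted s S -> exists S',
    [/\ exec B (shift_cmd c) S w t S' w', shifted s' S' &
        forall a i, a < K -> S' a i = S a i].
Proof.
have lt_neq a b : a < K -> a != K + b by lia.
elim=> {c s w t s' w'} /=.
- by move=> s w S sS; exists S; split=> //; exact: exec_skip.
- move=> a e1 e2 s w i v E1 E2 S sS; exists (upd S (K + a) i v); split.
  + by apply: exec_store; rewrite (eval_shift _ _ sS).
  + exact: shifted_upd.
  + by move=> b j bK; rewrite upd_other ?lt_neq.
- move=> a e s b w i E S sS; exists (upd S (K + a) i b); split.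
  + by apply: exec_flip; rewrite (eval_shift _ _ sS).
  + exact: shifted_upd.
  + by move=> d j dK; rewrite upd_other ?lt_neq.
- move=> c1 c2 s w t1 s1 w1 t2 s2 w2 _ IH1 _ IH2 S /IH1[S1 [x1 /IH2[S2 [x2 sS2 f2]] f1]].
  exists S2; split=> //; first exact: exec_seq x1 x2.
  by move=> a i aK; rewrite f2 ?f1.
- move=> e c1 c2 s w v t s' w' E _ IH S sS; have [S' [x sS' f]] := IH S sS.
  exists S'; split=> //; apply: (@exec_if _ _ _ _ _ _ v).
    by rewrite (eval_shift _ _ sS).
  by case: (v != 0) x.
- move=> e c s w E S sS; exists S; split=> //; apply: exec_while_stop.
  by rewrite (eval_shift _ _ sS).
- move=> e c s w v t1 s1 w1 t2 s2 w2 E _ IH1 _ IH2 S sS.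
  have [S1 [x1 /IH2[S2 [x2 sS2 f2]] f1]] := IH1 S sS.
  exists S2; split=> //; last by move=> a i aK; rewrite f2 ?f1.
  by apply: exec_while_loop x1 x2; rewrite (eval_shift _ _ sS) E.
Qed.

End Shift.

(** * Total correctness with time bounds *)

Section Logic.
Variable B : nat.

(** The tosses [u] are those consumed, exactly: a deterministic command has [[::]], and a randomized
    one is analysed as a deterministic run for each fixed outcome. *)
Definition wp (c : cmd) (u : seq bool) (T : nat) (Q : store -> Prop)
    (s : store) : Prop :=
  bounded B s -> exists t s',
    [/\ t <= T, Q s', bounded B s' & forall w, exec B c s (u ++ w) t s' w].

Lemma wp_weak c u T T' (Q Q' : store -> Prop) s :
  wp c u T Q s -> T <= T' -> (forall s', Q s' -> Q' s') -> wp c u T' Q' s.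
Proof.
move=> H TT QQ bs; have [t [s' [tT Qs' bs' x]]] := H bs.
by exists t, s'; split=> //; [exact: leq_trans TT | exact: QQ].
Qed.

Lemma wp_skip T (Q : store -> Prop) s : 0 < T -> Q s -> wp Skip [::] T Q s.
Proof. by move=> T0 Qs bs; exists 1, s; split=> // w; exact: exec_skip. Qed.

Lemma wp_store a e1 e2 (Q : store -> Prop) s :
  (bounded B s -> [/\ fits B s e1, fits B s e2 &
    Q (upd s a (value s e1) (value s e2))]) ->
  wp (Store a e1 e2) [::] 1 Q s.
Proof.
move=> H bs; have [f1 f2 Qs] := H bs.
exists 1, (upd s a (value s e1) (value s e2)); split=> //.
  by apply: bounded_upd => //; exact: value_le f2.
by move=> w; apply: exec_store; apply: eval_value.
Qed.

Lemma wp_flip a e b (Q : store -> Prop) s :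
  0 < B ->
  (bounded B s -> fits B s e /\ Q (upd s a (value s e) (nat_of_bool b))) ->
  wp (Flip a e) [:: b] 1 Q s.
Proof.
move=> B0 H bs; have [f Qs] := H bs.
exists 1, (upd s a (value s e) b); split=> //.
  by apply: bounded_upd => //; exact: leq_trans (leq_b1 _) B0.
by move=> w; apply: exec_flip; apply: eval_value.
Qed.

Lemma wp_seq_coins c1 c2 u1 u2 T1 T2 (Q : store -> Prop) s :
  wp c1 u1 T1 (wp c2 u2 T2 Q) s -> wp (Seq c1 c2) (u1 ++ u2) (T1 + T2) Q s.
Proof.
move=> H bs; have [t1 [s1 [tT1 H2 /H2[t2 [s2 [tT2 Qs2 bs2 x2]]] x1]]] := H bs.
exists (t1 + t2), s2; split=> //; first exact: leq_add.
by move=> w; rewrite -catA; apply: exec_seq (x1 _) (x2 _).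
Qed.

Lemma wp_seq c1 c2 T1 T2 (Q : store -> Prop) s :
  wp c1 [::] T1 (wp c2 [::] T2 Q) s -> wp (Seq c1 c2) [::] (T1 + T2) Q s.
Proof. exact: wp_seq_coins. Qed.

Lemma wp_if e c1 c2 u T (Q : store -> Prop) s :
  (bounded B s -> fits B s e /\ wp (if value s e != 0 then c1 else c2) u T Q s) ->
  wp (If e c1 c2) u T.+1 Q s.
Proof.
move=> H bs; have [f /(_ bs)[t [s' [tT Qs' bs' x]]]] := H bs.
exists t.+1, s'; split=> // w; apply: exec_if (x _); exact: eval_value.
Qed.

Definition var (a : nat) : expr := Fetch a (Const 0).

Definition set_var (a : nat) (e : expr) : cmd := Store a (Const 0) e.

Lemma wp_set a e (Q : store -> Prop) s :
  (bounded B s -> fits B s e /\ Q (upd s a 0 (value s e))) ->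
  wp (set_var a e) [::] 1 Q s.
Proof. by move=> H; apply: wp_store => /H[]. Qed.

Definition incr (i : nat) : cmd := set_var i (Add (var i) (Const 1)).

Definition for_ (i : nat) (N : expr) (c : cmd) : cmd :=
  Seq (set_var i (Const 0)) (While (Sub N (var i)) (Seq c (incr i))).

(** The invariant has to be insensitive to the counter, which is reset and advanced outside the
    body. The time counts one step for the reset, one for the last test, and a test and an increment
    in each turn. *)
Lemma wp_for_coins i eN c N (I : nat -> store -> Prop) (u : nat -> seq bool) T s :
  N < B ->
  (forall s v k, I k s -> I k (upd s i 0 v)) ->
  (forall s k, I k s -> fits B s eN /\ value s eN = N) ->
  (forall s k, k < N -> I k s -> s i 0 = k ->
     wp c (u k) T (fun s' => I k.+1 s' /\ s' i 0 = k) s) ->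
  I 0 s ->
  wp (for_ i eN c) (flatten [seq u k | k <- iota 0 N]) (2 + N * (T + 2)) (I N) s.
Proof.
move=> NB Iupd IN Ic I0.
have loop d k s1 : k + d = N -> I k s1 -> s1 i 0 = k ->
    wp (While (Sub eN (var i)) (Seq c (incr i)))
       (flatten [seq u j | j <- iota k d]) (d * (T + 2)).+1 (I N) s1.
  elim: d k s1 => [|d IH] k s1 kN Ik ik bs.
    have [f v] := IN _ _ Ik.
    exists 1, s1; split=> //; first by rewrite -kN addn0.
    move=> w; apply: exec_while_stop.
    by rewrite (eval_value bs) /= ?f //= v ik -kN addn0 subnn.
  have [f v] := IN _ _ Ik.
  have kN' : k < N by lia.
  have [t [s2 [tT [Ik1 ik1] bs2 x2]]] := Ic _ _ kN' Ik ik bs.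
  have vB : value s2 (Add (var i) (Const 1)) = k.+1 by rewrite /= ik1 addn1.
  have f2 : fits B s2 (Add (var i) (Const 1)) by rewrite /= ik1; lia.
  set s3 := upd s2 i 0 k.+1.
  have bs3 : bounded B s3 by apply: bounded_upd => //; lia.
  have [||t' [s4 [tT' I4 bs4 x4]]] := IH k.+1 s3 _ (Iupd _ _ _ Ik1) _ bs3.
  - by rewrite addSnnS.
  - by rewrite /s3 /upd !eqxx.
  exists (t + 1 + t').+1, s4; split=> //.
    by rewrite mulSn; lia.
  move=> w; rewrite /= -catA; apply: (@exec_while_loop _ _ _ _ _ (N - k).-1).
  - by rewrite (eval_value bs) /= ?f //= v ik; congr Some; lia.
  - apply: exec_seq (x2 _) _; apply: exec_store; first by [].
    by rewrite (eval_value bs2 f2) vB.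
  - exact: x4.
rewrite -[flatten _]cat0s -(add1n (1 + _)) -addnA.
apply: wp_seq_coins; apply: wp_set => _; split=> //=.
by apply: (@loop N 0) => //; [exact: Iupd | rewrite /upd !eqxx].
Qed.

Lemma wp_for i eN c N (I : nat -> store -> Prop) T s :
  N < B ->
  (forall s v k, I k s -> I k (upd s i 0 v)) ->
  (forall s k, I k s -> fits B s eN /\ value s eN = N) ->
  (forall s k, k < N -> I k s -> s i 0 = k ->
     wp c [::] T (fun s' => I k.+1 s' /\ s' i 0 = k) s) ->
  I 0 s -> wp (for_ i eN c) [::] (2 + N * (T + 2)) (I N) s.
Proof.
move=> NB Iupd IN Ic I0.
have := @wp_for_coins i eN c N I (fun=> [::]) T s NB Iupd IN Ic I0.
by elim: (iota 0 N).
Qed.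

End Logic.

(** * Coin tosses *)

(** The sample space is a list of plain sequences and not a set of tuples, so that counting recurses
    on the first toss ([cntS]); [cnt_set] and [set_cnt] translate to the tuples of [solves_in]. *)
Fixpoint words (T : nat) : seq (seq bool) :=
  if T is T'.+1 then
    [seq true :: w | w <- words T'] ++ [seq false :: w | w <- words T']
  else [:: [::]].

Lemma mem_words T w : (w \in words T) = (size w == T).
Proof.
elim: T w => [|T IH] [|b w] //=; rewrite mem_cat.
  by apply/orP => -[] /mapP[].
rewrite eqSS -IH; apply/orP/idP => [[]/mapP[v v_T [_ ->]] //|w_T].
by case: b; [left | right]; apply/mapP; exists w.
Qed.

Lemma uniq_words T : uniq (words T).
Proof.
elim: T => //= T IH; rewrite cat_uniq !map_inj_uniq ?IH ?andbT //=; last 2 first.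
- by move=> ? ? [].
- by move=> ? ? [].
by apply/hasPn => _ /mapP[w _ ->]; apply/mapP => -[].
Qed.

Lemma size_words T : size (words T) = 2 ^ T.
Proof. by elim: T => //= T IH; rewrite size_cat !size_map IH expnS mul2n addnn. Qed.

Definition cnt (T : nat) (X : seq bool -> Prop) : nat :=
  count (fun w => `[< X w >]) (words T).

Lemma cntS T X :
  cnt T.+1 X = cnt T (fun w => X (true :: w)) + cnt T (fun w => X (false :: w)).
Proof. by rewrite /cnt /= count_cat !count_map. Qed.

Lemma leq_cnt T (X Y : seq bool -> Prop) :
  (forall w, size w = T -> X w -> Y w) -> cnt T X <= cnt T Y.
Proof.
move=> XY; rewrite /cnt; have: all (fun w => size w == T) (words T).
  by apply/allP => w; rewrite mem_words.
elim: (words T) => //= w l IH /andP[/eqP wT /IH]; apply: leq_add.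
by case: asboolP => //; case: asboolP => // nY /(XY _ wT).
Qed.

Lemma eq_cnt T (X Y : seq bool -> Prop) :
  (forall w, size w = T -> X w <-> Y w) -> cnt T X = cnt T Y.
Proof.
by move=> XY; apply/eqP; rewrite eqn_leq !leq_cnt // => w wT; case: (XY w wT).
Qed.

Lemma cnt_le T X : cnt T X <= 2 ^ T.
Proof. by rewrite -size_words; exact: count_size. Qed.

Lemma cntN T (X : seq bool -> Prop) : cnt T X + cnt T (fun w => ~ X w) = 2 ^ T.
Proof.
rewrite -size_words -(count_predC (fun w => `[< X w >])); congr (_ + _).
by apply: eq_count => w /=; rewrite asbool_neg.
Qed.

Lemma cntT T (X : seq bool -> Prop) : (forall w, size w = T -> X w) -> cnt T X = 2 ^ T.
Proof.
move=> X_T; rewrite -(cntN T X); set c := cnt T (fun w => ~ X w).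
suff -> : c = 0 by rewrite addn0.
apply/eqP; rewrite -leqn0 -(count_pred0 (words T)).
rewrite /c /cnt -size_filter -size_filter; apply: eq_leq; congr size.
apply: eq_in_filter => w; rewrite mem_words => /eqP/X_T Xw.
by apply: asboolF.
Qed.

Lemma cnt_set T (X : seq bool -> Prop) : exists2 A : {set T.-tuple bool},
  (forall w, w \in A -> X w) & #|A| = cnt T X.
Proof.
exists [set w : T.-tuple bool | `[< X w >]] => [w|]; first by rewrite inE => /asboolP.
rewrite cardE -(size_map val) /cnt -size_filter; apply/perm_size/uniq_perm.
- by rewrite map_inj_uniq ?enum_uniq //; exact: val_inj.
- by rewrite filter_uniq ?uniq_words.
move=> w; rewrite mem_filter mem_words; apply/mapP/andP => [[v]|[Xw /eqP wT]].
  by rewrite mem_enum inE => Xv ->; rewrite size_tuple.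
have wE : val (tcast wT (in_tuple w)) = w by exact: val_tcast.
by exists (tcast wT (in_tuple w)); rewrite ?mem_enum ?inE ?wE //; apply/asboolP.
Qed.

Lemma set_cnt T (X : seq bool -> Prop) (A : {set T.-tuple bool}) :
  (forall w, w \in A -> X (val w)) -> #|A| <= cnt T X.
Proof.
move=> AX; rewrite cardE -(size_map val) /cnt -size_filter; apply: uniq_leq_size.
  by rewrite map_inj_uniq ?enum_uniq //; exact: val_inj.
move=> _ /mapP[v v_A ->]; rewrite mem_filter mem_words size_tuple eqxx andbT.
by apply/asboolP/AX; rewrite -mem_enum.
Qed.

(* If the coins u lead to a point D u from which at least g of the T2-coin
   continuations succeed, then the successes multiply; the coins left over
   from the first T1 are passed on to the second part. *)
Lemma cnt_bind T1 T2 (D : seq bool -> Prop) (E : seq bool -> seq bool -> Prop) g :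
  (forall u, D u -> g <= cnt T2 (E u)) ->
  (forall u w z, D u -> E u w -> E u (w ++ z)) ->
  cnt T1 (fun w => exists u v, w = u ++ v /\ D u) * g <=
  cnt (T1 + T2) (fun w => exists u v, [/\ w = u ++ v, D u & E u v]).
Proof.
elim: T1 D E => [|T1 IH] D E Dg Eext.
  rewrite add0n; case: (pselect (D [::])) => D0.
    apply: (@leq_trans (cnt T2 (E [::]))); first
      by rewrite -[leqRHS]mul1n leq_mul ?cnt_le ?Dg.
    by apply: leq_cnt => w _ Ew; exists [::], w.
  rewrite (_ : cnt 0 _ = 0) // /cnt /= asboolF // => -[u [v [uv Du]]].
  by apply: D0; case: u uv Du.
case: (pselect (D [::])) => D0.
  apply: (@leq_trans (2 ^ T1.+1 * cnt T2 (E [::]))).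
    by rewrite leq_mul ?cnt_le ?Dg.
  have ext k : 2 ^ k * cnt T2 (E [::]) <= cnt (k + T2) (E [::]).
    elim: k => [|k IHk]; first by rewrite mul1n.
    rewrite addnC addnS -addnC.
    have rec (X : seq bool -> Prop) T : (forall w z, X w -> X (w ++ z)) ->
        2 * cnt T X <= cnt T.+1 X.
      elim: T X => [|T IHT] X Xext.
        rewrite cntS /cnt /=; case: asboolP => // X0.
        by rewrite !asboolT //; exact: (Xext [::]).
      rewrite cntS mulnDr (cntS T.+1); apply: leq_add; apply: IHT => w z;
        exact: (Xext (_ :: _)).
    apply: leq_trans (rec _ _ (fun w z => Eext [::] w z D0)).
    by rewrite expnS -mulnA leq_mul2l.
  by apply: leq_trans (ext _) _; apply: leq_cnt => w _ Ew; exists [::], w.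
have step b T : cnt T (fun w => exists u v, b :: w = u ++ v /\ D u) =
    cnt T (fun w => exists u v, w = u ++ v /\ D (b :: u)).
  apply: eq_cnt => w _; split=> [[[|c u] [v [e Du]]]|[u [v [-> Du]]]].
  - by case: (D0 Du).
  - by case: e Du => <- ->; exists u, v.
  - by exists (b :: u), v.
rewrite addSn !cntS mulnDl; apply: leq_add; rewrite step.
  apply: leq_trans (IH (fun u => D (true :: u)) (fun u => E (true :: u)) _ _) _.
  - by move=> u; exact: Dg.
  - by move=> u w z; exact: Eext.
  - by apply: leq_cnt => w _ [u [v [-> Du Ev]]]; exists (true :: u), v.
apply: leq_trans (IH (fun u => D (false :: u)) (fun u => E (false :: u)) _ _) _.
- by move=> u; exact: Dg.
- by move=> u w z; exact: Eext.
- by apply: leq_cnt => w _ [u [v [-> Du Ev]]]; exists (false :: u), v.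
Qed.

(** * Commands that succeed with high probability *)

Section Good.
Variable B : nat.

Definition succeeds (c : cmd) (T : nat) (Q : store -> Prop) (s : store)
    (w : seq bool) : Prop :=
  exists t s' w', [/\ exec B c s w t s' w', t <= T, bounded B s' & Q s'].

(* The failure probability is at most a / d. *)
Definition good (a d : nat) (c : cmd) (T : nat) (Q : store -> Prop)
    (s : store) : Prop :=
  bounded B s -> (d - a) * 2 ^ T <= d * cnt T (succeeds c T Q s).

Lemma succeeds_ext c T Q s w z : succeeds c T Q s w -> succeeds c T Q s (w ++ z).
Proof.
move=> [t [s' [w' [/exec_coins[u -> x] tT bs' Qs']]]].
by exists t, s', (w' ++ z); split=> //; rewrite -catA; exact: x.
Qed.

(** The case of [cnt_bind] in which the first part stops before any toss. *)
Lemma cnt_ext (X : seq bool -> Prop) T k : (forall w z, X w -> X (w ++ z)) ->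
  2 ^ k * cnt T X <= cnt (k + T) X.
Proof.
move=> Xext; have := @cnt_bind k T (fun u => u = [::]) (fun _ => X) (cnt T X).
rewrite (@cntT k) => [|w _]; last by exists [::], w.
move=> H; apply: leq_trans (H _ _) _.
- by [].
- by move=> u w z _; exact: Xext.
- by apply: leq_cnt => _ _ [_ [v [-> ->]]].
Qed.

Lemma good_weak a a' d c T T' (Q Q' : store -> Prop) s :
  good a d c T Q s -> a <= a' -> T <= T' -> (forall s', Q s' -> Q' s') ->
  good a' d c T' Q' s.
Proof.
move=> H aa TT QQ bs; have {H} := H bs.
rewrite -(subnK TT) expnD => H.
apply: (@leq_trans (d * (2 ^ (T' - T) * cnt T (succeeds c T Q s)))).
  rewrite [leqLHS]mulnCA [leqRHS]mulnCA leq_mul2l; apply/orP; right; apply: leq_trans H.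
  by rewrite leq_mul2r leq_sub2l ?orbT.
rewrite leq_mul2l; apply/orP; right.
apply: leq_trans (cnt_ext _ _ (fun w z => @succeeds_ext c T Q s w z)) _.
apply: leq_cnt => w _ [t [s' [w' [x tT bs' Qs']]]]; exists t, s', w'; split=> //.
  by rewrite subnK //; exact: leq_trans TT.
exact: QQ.
Qed.

Lemma good_wp d c T Q s : wp B c [::] T Q s -> good 0 d c T Q s.
Proof.
move=> H bs; have [t [s' [tT Qs' bs' x]]] := H bs.
rewrite subn0 cntT // => w _; exists t, s', w; split=> //; exact: x.
Qed.

(** The union bound, as (1 - a/d)(1 - b/d) >= 1 - (a + b)/d. The number [k] is the cost of gluing
    the two runs: 0 for [Seq], 1 for a turn of a loop. *)
Lemma good_bind a b d c c1 c2 T1 T2 (R Q : store -> Prop) s k :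
  a <= d -> b <= d ->
  (forall s1 w t1 w1 t2 s2 w2, exec B c1 s w t1 s1 w1 ->
     exec B c2 s1 w1 t2 s2 w2 -> exec B c s w (k + (t1 + t2)) s2 w2) ->
  good a d c1 T1 R s -> (forall s1, R s1 -> good b d c2 T2 Q s1) ->
  good (a + b) d c (k + (T1 + T2)) Q s.
Proof.
move=> ad bd comb H1 H2.
have [->|d0] := posnP d; first by move=> bs; rewrite sub0n mul0n.
move=> bs; have {}H1 := H1 bs.
(* The worst number of successful continuations over all bounded stores satisfying [R]; if there is
   none, 2 ^ T2 serves vacuously. A uniform [g] is what [cnt_bind] asks for. *)
have [g g_min] : exists g, (d - b) * 2 ^ T2 <= d * g /\
    forall s1, R s1 -> bounded B s1 -> g <= cnt T2 (succeeds c2 T2 Q s1).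
  have hasg : exists g, `[< (exists2 s1, R s1 /\ bounded B s1 &
      g = cnt T2 (succeeds c2 T2 Q s1)) \/
      ((forall s1, R s1 -> ~ bounded B s1) /\ g = 2 ^ T2) >].
    case: (pselect (exists s1, R s1 /\ bounded B s1)) => [[s1 Rs1]|nR].
      by exists (cnt T2 (succeeds c2 T2 Q s1)); apply/asboolP; left; exists s1.
    exists (2 ^ T2); apply/asboolP; right; split=> // s1 Rs1 bs1.
    by apply: nR; exists s1.
  case: (ex_minnP hasg) => g /asboolP Hg gmin; exists g; split.
    case: Hg => [[s1 [Rs1 bs1] ->]|[_ ->]]; first exact: H2.
    by rewrite leq_mul2r leq_subr orbT.
  move=> s1 Rs1 bs1; apply: gmin; apply/asboolP; left; by exists s1.
have [gd gR] := g_min.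
pose D u := exists t s1, [/\ forall w, exec B c1 s (u ++ w) t s1 w, t <= T1,
  bounded B s1 & R s1].
pose E u v := exists t s1, [/\ forall w, exec B c1 s (u ++ w) t s1 w, t <= T1 &
  succeeds c2 T2 Q s1 v].
have DE u : D u -> g <= cnt T2 (E u).
  move=> [t [s1 [x tT bs1 Rs1]]]; apply: leq_trans (gR _ Rs1 bs1) _.
  by apply: leq_cnt => w _ Sw; exists t, s1.
have Eext u w z : D u -> E u w -> E u (w ++ z).
  move=> _ [t [s1 [x tT Sw]]]; exists t, s1; split=> //; exact: succeeds_ext.
have D_succ : cnt T1 (succeeds c1 T1 R s) <=
    cnt T1 (fun w => exists u v, w = u ++ v /\ D u).
  apply: leq_cnt => w _ [t [s1 [w1 [/exec_coins[u -> x] tT bs1 Rs1]]]].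
  by exists u, w1; split=> //; exists t, s1.
have E_succ : cnt (T1 + T2) (fun w => exists u v, [/\ w = u ++ v, D u & E u v]) <=
    cnt (T1 + T2) (succeeds c (k + (T1 + T2)) Q s).
  apply: leq_cnt => _ _ [u [v [-> _ [t1 [s1 [x1 t1T]]]]]].
  move=> [t2 [s2 [w2 [x2 t2T bs2 Qs2]]]]; exists (k + (t1 + t2)), s2, w2.
  by split=> //; [exact: comb (x1 v) x2 | rewrite leq_add2l leq_add].
have := leq_trans (@cnt_bind T1 T2 D E g DE Eext) E_succ.
move/(leq_trans (leq_mul D_succ (leqnn g))) => {D_succ E_succ}.
set N := cnt (T1 + T2) _; set N1 := cnt T1 _ in H1 * => N1g.
have ext : 2 ^ k * N <= cnt (k + (T1 + T2)) (succeeds c (k + (T1 + T2)) Q s).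
  by apply: cnt_ext => w z; exact: succeeds_ext.
apply: leq_trans (leq_mul (leqnn d) ext).
rewrite expnD [leqLHS]mulnCA [leqRHS]mulnCA leq_mul2l expnD; apply/orP; right.
rewrite -(leq_pmul2l d0).
apply: (@leq_trans (((d - a) * 2 ^ T1) * ((d - b) * 2 ^ T2))).
  rewrite (mulnACA (d - a)) mulnA leq_mul2r; apply/orP; right.
  (* Subtraction is truncated: for a + b >= d the left-hand side is 0, otherwise the inequality is
     the expanded product. *)
  have [x xE] : exists x, d = a + x by exists (d - a); lia.
  have [y yE] : exists y, d = b + y by exists (d - b); lia.
  have -> : d - a = x by lia.
  have -> : d - b = y by lia.
  have -> : d - (a + b) = x - b by lia.
  rewrite xE in yE *; have [xb|/ltnW xb] := leqP x b; last first.
    have [z zE] : exists z, x = b + z by exists (x - b); lia.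
    have -> : x - b = z by lia.
    have -> : y = a + z by lia.
    by rewrite zE; nia.
  by rewrite (eqP (_ : x - b == 0)) ?muln0.
apply: leq_trans (leq_mul H1 gd) _.
by rewrite mulnACA -mulnA leq_mul2l leq_mul2l N1g !orbT.
Qed.

Lemma good_seq a b d c1 c2 T1 T2 (R Q : store -> Prop) s :
  a <= d -> b <= d -> good a d c1 T1 R s ->
  (forall s1, R s1 -> good b d c2 T2 Q s1) ->
  good (a + b) d (Seq c1 c2) (T1 + T2) Q s.
Proof.
move=> ad bd H1 H2; apply: (@good_bind _ _ _ _ _ _ _ _ _ _ _ 0) H1 H2 => //.
by move=> s1 w t1 w1 t2 s2 w2 x1 x2; exact: exec_seq x1 x2.
Qed.

Lemma good_loop a b d e c T1 T2 (R Q : store -> Prop) s :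
  a <= d -> b <= d -> fits B s e -> 0 < value s e -> good a d c T1 R s ->
  (forall s1, R s1 -> good b d (While e c) T2 Q s1) ->
  good (a + b) d (While e c) (1 + (T1 + T2)) Q s.
Proof.
move=> ad bd fe e0 H1 H2 bs.
apply: (@good_bind _ _ _ _ _ _ _ _ _ _ _ 1) H1 H2 (bs) => //.
move=> s1 w t1 w1 t2 s2 w2 x1 x2; apply: (@exec_while_loop _ _ _ _ _ (value s e).-1) x1 x2.
by rewrite (eval_value bs fe) prednK.
Qed.

(** Turns a count of bad toss sequences, such as the one of the isolation lemma, into a failure
    bound: for each good outcome of the [L] tosses the run is settled. *)
Lemma good_coins a d c L T (D : seq bool -> Prop) (Q : store -> Prop) s :
  L <= T -> d * cnt L (fun u => ~ D u) <= a * 2 ^ L ->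
  (forall u, size u = L -> D u -> wp B c u T Q s) -> good a d c T Q s.
Proof.
move=> LT few H bs.
have := @cnt_ext (succeeds c T Q s) L (T - L) (fun w z => @succeeds_ext _ _ _ _ w z).
rewrite subnK // => /(leq_mul (leqnn d)); apply: leq_trans.
rewrite -{1}(subnK LT) expnD [leqLHS]mulnCA [leqRHS]mulnCA leq_mul2l.
apply/orP; right.
have {few} few : (d - a) * 2 ^ L <= d * cnt L D.
  by move: few; rewrite mulnBl leq_subLR -{2}(cntN L D) mulnDr addnC leq_add2r.
apply: leq_trans few _; rewrite leq_mul2l; apply/orP; right.
apply: leq_cnt => u uL Du; have [t [s' [tT Qs' bs' x]]] := H u uL Du bs.
by exists t, s', [::]; split=> //; have := x [::]; rewrite cats0.
Qed.

(** The error 1/nv of the call is at most 1/d for every d up to the number of vertices. Garbage left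
    in the memory by earlier work is harmless, because [solves_in] allows any initial memory of
    words. *)
Lemma good_call (Q : problem) P T (x : instance Q) d K s :
  0 < B -> 0 < d <= nv (graph x) -> solves_in P B T x ->
  holds s K (code_graph (graph x) ++ query x) ->
  good 1 d (shift_cmd K P) T
    (fun s' => (exists2 l, answer x l & holds s' K.+1 l) /\
               forall a i, a < K -> s' a i = s a i) s.
Proof.
move=> B0 /andP[d0 dn] PQ sK bs; pose s0 : store := fun a i => s (K + a) i.
have [||A AP cardA] := PQ s0.
- by move=> a i; exact: bs.
- by move=> i il; rewrite /s0 addn0; exact: sK.
have n0 := leq_trans d0 dn.
have {}cardA : d.-1 * 2 ^ T <= d * #|A|.
  move: cardA; set n := nv _ in dn n0 *.
  have := max_card (mem A); rewrite card_tuple card_bool; nia.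
rewrite subn1; apply: leq_trans cardA _; rewrite leq_mul2l; apply/orP; right.
apply: set_cnt => w /AP[t [s' [w' [l [ex tT s'l xl]]]]].
have [|S' [ex' sS' f]] := exec_shift ex (K := K) (S := s) _; first by [].
exists t, S', w'; split=> //; first exact: exec_bounded B0 ex' bs.
by split=> //; exists l => // i il; rewrite -addn1 sS' s'l.
Qed.
End Good.

(** * Building the input of a called program *)

Definition triples (E : seq (nat * nat * nat)) : seq nat :=
  flatten [seq [:: e.1.1; e.1.2; e.2] | e <- E].

Lemma size_triples E : size (triples E) = 3 * size E.
Proof.
by elim: E => //= e E IH; rewrite /triples /= -/(triples E) IH mulnS.
Qed.

Lemma nth_triples E i : let e := nth (0, 0, 0) E i in i < size E ->
  [/\ nth 0 (triples E) (3 * i) = e.1.1, nth 0 (triples E) (3 * i + 1) = e.1.2 &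
      nth 0 (triples E) (3 * i + 2) = e.2].
Proof.
elim: E i => // e E IH [|i]; cbv zeta; first by [].
rewrite [size _]/= ltnS => iE; have [h0 h1 h2] := IH i iE.
have E3 : triples (e :: E) = [:: e.1.1; e.1.2; e.2] ++ triples E by [].
rewrite E3 [nth (0, 0, 0) _ _]/=; split; rewrite nth_cat ifF /=; try lia.
all: by [rewrite -h0; congr nth; lia | rewrite -h1; congr nth; lia | rewrite -h2; congr nth; lia].
Qed.

Section Build.
Variable B : nat.

(* Array 20 is the input of the called program, 5 holds the length of what has
   been written there and 4 the loop index. *)
Definition emit (e : expr) : cmd := Seq (Store 20 (var 5) e) (incr 5).

Definition emits (es : seq expr) : cmd :=
  foldr (fun e c => Seq (emit e) c) Skip es.

Definition emit_loop : Type := expr * seq expr.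

Definition build (fs : seq emit_loop) : cmd :=
  Seq (set_var 5 (Const 0))
      (foldr (fun F c => Seq (for_ 4 F.1 (emits F.2)) c) Skip fs).

Definition at_index (s : store) (k : nat) : store := upd s 4 0 k.

Definition emitted (s : store) (F : emit_loop) : seq nat :=
  flatten [seq [seq value (at_index s k) e | e <- F.2] | k <- iota 0 (value s F.1)].

Definition built (s : store) (fs : seq emit_loop) : seq nat :=
  flatten [seq emitted s F | F <- fs].

(** Emitted values may depend on the loop index 4, loop bounds may not; neither may read the length
    5 or the output 20, which change while building. So everything can be evaluated in the store
    before the loops. *)
Definition loop_closed (F : emit_loop) : bool :=
  all (fun a => a \notin [:: 4; 5; 20]) (reads F.1) &&
  all (fun e => all (fun a => a \notin [:: 5; 20]) (reads e)) F.2.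

Definition loop_fits (s : store) (F : emit_loop) : Prop :=
  [/\ fits B s F.1, value s F.1 < B & forall k, k < value s F.1 ->
    all (fits B (at_index s k)) F.2].

Fixpoint loops_fit (s : store) (fs : seq emit_loop) : Prop :=
  if fs is F :: fs' then loop_fits s F /\ loops_fit s fs' else True.

(** Per turn: two steps for each emitted number, one for the final [Skip], two for the loop
    itself. *)
Definition loop_time (s : store) (F : emit_loop) : nat :=
  2 + value s F.1 * (2 * size F.2 + 3).

Definition build_time (s : store) (fs : seq emit_loop) : nat :=
  2 + sumn [seq loop_time s F | F <- fs].

Definition emitting (s0 : store) (l : seq nat) (s : store) : Prop :=
  [/\ holds s 20 l, s 5 0 = size l &
      forall a i, a \notin [:: 5; 20] -> s a i = at_index s0 (s 4 0) a i].

Lemma emitting_at s0 l s k : emitting s0 l s -> s 4 0 = k ->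
  forall a, a \notin [:: 5; 20] -> s a =1 at_index s0 k a.
Proof. by move=> [_ _ H] <- a ha i; exact: H. Qed.

Lemma wp_emit s0 l s k e :
  emitting s0 l s -> s 4 0 = k -> (size l).+1 < B ->
  all (fun a => a \notin [:: 5; 20]) (reads e) -> fits B (at_index s0 k) e ->
  wp B (emit e) [::] 2
    (fun s' => emitting s0 (rcons l (value (at_index s0 k) e)) s' /\ s' 4 0 = k) s.
Proof.
move=> em sk lB /allP cl fe.
have E a : a \in reads e -> s a =1 at_index s0 k a.
  by move=> /cl; exact: emitting_at em sk a.
have [h20 h5 hf] := em.
apply: (@wp_seq B _ _ 1 1); apply: wp_store => bs; split=> //.
  by rewrite (fits_eq B E).
rewrite /= h5 (value_eq E); set v := value _ e; apply: wp_set => bs1.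
rewrite /= {1 2}/upd /= h5; split; first by lia.
split; last by rewrite /upd /=.
split.
- move=> i; rewrite size_rcons ltnS nth_rcons /upd /= leq_eqVlt.
  by case: (ltngtP i (size l)) => //= il _; exact: h20.
- by rewrite size_rcons /upd /= addn1 h5.
- move=> a i; rewrite !inE negb_or => /andP[a5 a20]; rewrite /upd /=.
  by rewrite (negPf a5) (negPf a20) /= hf // !inE negb_or a5.
Qed.

Lemma wp_emits s0 l s k es :
  emitting s0 l s -> s 4 0 = k -> size l + size es < B ->
  all (fun e => all (fun a => a \notin [:: 5; 20]) (reads e)) es ->
  all (fits B (at_index s0 k)) es ->
  wp B (emits es) [::] (2 * size es + 1)
    (fun s' => emitting s0 (l ++ [seq value (at_index s0 k) e | e <- es]) s' /\
               s' 4 0 = k) s.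
Proof.
elim: es l s => [|e es IH] l s em sk lB /=.
  by move=> _ _; rewrite cats0; exact: wp_skip.
move=> /andP[ce ces] /andP[fe fes].
have -> : 2 * (size es).+1 + 1 = 2 + (2 * size es + 1) by lia.
apply: wp_seq; apply: wp_weak (wp_emit em sk _ ce fe) _ _ => //; first by move: lB => /=; lia.
move=> s' [em' sk']; rewrite -cat_rcons; apply: IH => //.
by move: lB; rewrite size_rcons /= addSnnS.
Qed.

Lemma wp_build fs s :
  1 < B -> all loop_closed fs -> loops_fit s fs ->
  (size (built s fs)).+1 < B ->
  wp B (build fs) [::] (build_time s fs)
    (fun s' => holds s' 20 (built s fs) /\
               forall a i, a \notin [:: 4; 5; 20] -> s' a i = s a i) s.
Proof.
move=> B1 cl ft lB; rewrite /build_time /build -[2]/(1 + 1) -addnA.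
apply: wp_seq; apply: wp_set => bs; split=> //=.
set s1 := upd s 5 0 0.
have em1 : emitting s [::] s1.
  split=> // a i; rewrite !inE negb_or => /andP[a5 a20].
  rewrite /s1 /at_index /upd /= (negPf a5) /=; case: eqP => //= ->.
  by case: eqP => // ->.
have inv l s2 : emitting s l s2 -> size l + size (built s fs) < B ->
    wp B (foldr (fun F c => Seq (for_ 4 F.1 (emits F.2)) c) Skip fs) [::]
       (1 + sumn [seq loop_time s F | F <- fs])
       (fun s' => emitting s (l ++ built s fs) s') s2; last first.
  apply: wp_weak (inv [::] s1 em1 (ltnW lB)) _ _ => //.
  move=> s' [h20 _ hf]; split=> // a i; rewrite !inE !negb_or => /and3P[a4 a5 a20].
  by rewrite hf ?inE ?negb_or ?a5 ?a20 // /at_index upd_other.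
clear lB em1; elim: fs cl ft l s2 => [|F fs IH] /=.
  by move=> _ _ l s2 em _; rewrite cats0; exact: wp_skip.
move=> /andP[/andP[cN cF] cfs] [[fN vB fF] ft] l s2 em lsB.
rewrite addnCA; apply: wp_seq.
set N := value s F.1 in vB fF *.
pose part k := flatten [seq [seq value (at_index s j) e | e <- F.2] | j <- iota 0 k].
have partS k : part k.+1 = part k ++ [seq value (at_index s k) e | e <- F.2].
  by rewrite /part -addn1 iotaD map_cat flatten_cat /= cats0.
have sizeS k : size (part k) = k * size F.2.
  elim: k => // k IHk; rewrite partS size_cat IHk size_map mulSn addnC //.
have szl : size l + size (part N) + size (built s fs) < B.
  by move: lsB; rewrite /built /= size_cat addnA.
pose I k s' := emitting s (l ++ part k) s'.
have Nat s' k : I k s' -> fits B s' F.1 /\ value s' F.1 = N.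
  move=> [_ _ hf]; have E a : a \in reads F.1 -> s' a =1 s a.
    move=> /(allP cN); rewrite !inE !negb_or => /and3P[a4 a5 a20] i.
    by rewrite hf ?inE ?negb_or ?a5 ?a20 // /at_index upd_other.
  by rewrite (fits_eq _ E) (value_eq E).
have Iupd s' v k : I k s' -> I k (upd s' 4 0 v).
  move=> [h20 h5 hf]; split=> // a i ha; rewrite {1}/upd.
  case: ifP => [/andP[/eqP-> /eqP->]|h]; first by rewrite /at_index /upd.
  by rewrite hf // /at_index /upd h.
have body s' k : k < N -> I k s' -> s' 4 0 = k ->
    wp B (emits F.2) [::] (2 * size F.2 + 1) (fun s'' => I k.+1 s'' /\ s'' 4 0 = k) s'.
  move=> kN Ik ik; rewrite /I partS catA.
  apply: wp_emits => //; last exact: fF.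
  rewrite size_cat sizeS; move: szl; rewrite sizeS.
  have : k.+1 * size F.2 <= N * size F.2 by rewrite leq_mul2r kN orbT.
  by rewrite mulSn; lia.
have I0 : I 0 s2 by rewrite /I cats0.
apply: wp_weak (wp_for vB Iupd Nat body I0) _ _ => //.
  by rewrite /loop_time -/N -[3]/(1 + 2) addnA.
move=> s3 Is3; rewrite /built /= -/(built s fs) catA.
by apply: IH => //; rewrite size_cat.
Qed.

End Build.

Section Minimum.
Variable B : nat.

(* Variable 7 is the minimum of a cap (initially in 7) and of the nonzero ones
   among the first cnt entries of the array src. *)
Definition scan_min (src : nat) (cnt : expr) : cmd :=
  for_ 4 cnt
    (If (Fetch src (var 4))
        (If (Sub (var 7) (Fetch src (var 4))) (set_var 7 (Fetch src (var 4))) Skip)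
        Skip).

(** Zeros are passed over because [code_value] writes +oo as 0. *)
Definition min_positive (c : nat) (l : seq nat) : nat :=
  foldl (fun r x => if (x != 0) && (x < r) then x else r) c l.

Lemma wp_scan_min src cnt l s :
  src \notin [:: 4; 7] -> (size l).+1 < B ->
  all (fun a => a \notin [:: 4; 7]) (reads cnt) ->
  fits B s cnt -> value s cnt = size l -> holds s src l ->
  wp B (scan_min src cnt) [::] (2 + size l * 5)
    (fun s' => s' 7 0 = min_positive (s 7 0) l /\
               forall a i, a \notin [:: 4; 7] -> s' a i = s a i) s.
Proof.
rewrite !inE negb_or => /andP[src4 src7] lB /allP cl fc vc sl.
pose I k s' := s' 7 0 = min_positive (s 7 0) (take k l) /\
  forall a i, a \notin [:: 4; 7] -> s' a i = s a i.
have sl' s' k i : I k s' -> i < size l -> s' src i = nth 0 l i.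
  by move=> [_ hf] il; rewrite hf ?inE ?negb_or ?src4 // sl.
rewrite -{2}[l]take_size; apply: (@wp_for B 4 cnt _ _ I 3 s); first exact: ltnW.
- move=> s' v k [h7 hf]; split=> // a i; rewrite !inE negb_or => /andP[a4 a7].
  by rewrite upd_other // hf // !inE negb_or a4.
- move=> s' k [_ hf]; have E a : a \in reads cnt -> s' a =1 s a.
    by move=> /cl ha i; exact: hf.
  by rewrite (fits_eq _ E) (value_eq E).
- move=> s' k kl Ik ik; have [h7 hf] := Ik.
  rewrite /I (take_nth 0 kl) /min_positive foldl_rcons -/(min_positive _ _) -h7.
  apply: wp_if => bs; split=> //=; rewrite ik (sl' _ _ _ Ik kl).
  set x := nth 0 l k; case: (x =P 0) => [_|x0] /=.
    exact: wp_skip.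
  apply: wp_if => bs'; split=> //=; rewrite ik (sl' _ _ _ Ik kl) -/x.
  rewrite subn_eq0 -ltnNge; case: ltnP => // _; last exact: wp_skip.
  apply: wp_set => bs''; split=> //=; rewrite ik (sl' _ _ _ Ik kl) -/x /upd /=.
  split=> //; split=> // a i; rewrite !inE negb_or => /andP[a4 a7].
  by rewrite (negPf a7) /= hf // !inE negb_or a4.
- by split; rewrite ?take0.
Qed.

Lemma min_positive_le c l : min_positive c l <= c /\
  (forall x, x \in l -> x != 0 -> min_positive c l <= x).
Proof.
elim/last_ind: l => [|l x [IHc IHl]]; first by [].
rewrite /min_positive foldl_rcons -/(min_positive c l); split.
  by case: ifP => // /andP[_ /ltnW h]; exact: leq_trans h IHc.
move=> y; rewrite mem_rcons inE => /predU1P[->|y_l] y0.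
  by rewrite y0 /=; case: ltnP.
by case: ifP => [/andP[_ /ltnW h]|_]; [apply: leq_trans h _|]; exact: IHl.
Qed.

Lemma min_positive_mem c l :
  min_positive c l = c \/ min_positive c l \in l /\ min_positive c l != 0.
Proof.
elim/last_ind: l => [|l x IH]; first by left.
rewrite /min_positive foldl_rcons -/(min_positive c l).
case: ifP => [/andP[x0 _]|_]; first by right; rewrite mem_rcons mem_head.
by case: IH => [|[h h0]]; [left | right; rewrite mem_rcons inE h orbT].
Qed.

End Minimum.

(** * Walks and minimum cycles *)

Definition nedges (G : digraph) : seq (nat * nat * nat) :=
  [seq (val e.1.1, val e.1.2, e.2) | e <- edges G].

Lemma size_nedges G : size (nedges G) = ne G.
Proof. exact: size_map. Qed.

Lemma code_graphE G : code_graph G = nv G :: ne G :: triples (nedges G).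
Proof. by rewrite /code_graph /triples /nedges -map_comp. Qed.

(** Lets every construction be given by plain numbers, so that ranges and disjointness of the edges
    are arithmetic, without dependent vertex types. *)
Lemma make_graph N E :
  all (fun e => [&& e.1.1 < N, e.1.2 < N & e.1.1 != e.1.2]) E ->
  uniq [seq e.1 | e <- E] ->
  exists G, nv G = N /\ nedges G = E.
Proof.
move=> ok uE.
pose conv (e : nat * nat * nat) : option ('I_N * 'I_N * nat) :=
  obind (fun u => omap (fun v => (u, v, e.2)) (insub e.1.2)) (insub e.1.1).
pose L := pmap conv E.
have LE : [seq (val e.1.1, val e.1.2, e.2) | e <- L] = E.
  rewrite /L; elim: E ok {uE L} => //= -[[u v] w] E IH /andP[/and3P[/= uN vN _] /IH E_ok].
  have -> : conv (u, v, w) = Some (Ordinal uN, Ordinal vN, w).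
    have valK' k (kN : k < N) : insub k = Some (Ordinal kN).
      by rewrite -[k]/(val (Ordinal kN)) valK.
    by rewrite /conv /= !valK'.
  by rewrite /= E_ok.
have uL : uniq [seq e.1 | e <- L].
  apply: (@map_uniq _ _ (fun e => (val e.1, val e.2))).
  rewrite -map_comp; rewrite -{1}LE -map_comp in uE.
  by move: uE; congr (uniq _); apply: eq_map.
have lL : all (fun e => e.1.1 != e.1.2) L.
  by move: ok; rewrite -{1}LE all_map; apply: sub_all => e /= /and3P[].
by exists (Digraph uL lL).
Qed.

Section Walk.
Variable R : nat -> nat -> nat -> Prop.

(** Walks grow at the end, so that induction on a walk checks an invariant of its current endpoint
    against each edge in turn. *)
Inductive walk (x : nat) : nat -> nat -> Prop :=
  | walk_nil : walk x x 0
  | walk_rcons y z d w : walk x y d -> R y z w -> walk x z (d + w).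

Definition closed_walk (x d : nat) : Prop :=
  exists y k w, [/\ walk x y k, R y x w & d = k + w].

Lemma walk_edge x y w : R x y w -> walk x y w.
Proof. by move=> xy; rewrite -[w]add0n; apply: walk_rcons xy; exact: walk_nil. Qed.

Lemma walk_cat x y z d d' : walk x y d -> walk y z d' -> walk x z (d + d').
Proof.
move=> xy; elim=> [|u v k w _ IH uv]; first by rewrite addn0.
by rewrite addnA; exact: walk_rcons uv.
Qed.

End Walk.

Lemma walk_sub (R R' : nat -> nat -> nat -> Prop) x y d :
  (forall u v w, R u v w -> R' u v w) -> walk R x y d -> walk R' x y d.
Proof.
by move=> RR'; elim=> [|u v k w _ IH /RR']; [exact: walk_nil | exact: walk_rcons].
Qed.

Definition least (W : nat -> Prop) (d : option nat) : Prop :=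
  if d is Some k then W k /\ (forall k', W k' -> k <= k') else forall k, ~ W k.

Lemma ex_min_value (T : Type) (S : T -> Prop) (f : T -> nat) :
  exists d, min_value S f d.
Proof.
case: (pselect (exists p, S p)) => [[p Sp]|nS]; last first.
  by exists None; exists None => // q Sq; apply: nS; exists q.
have ex : exists n, `[< exists2 q, S q & f q = n >].
  by exists (f p); apply/asboolP; exists p.
case: (ex_minnP ex) => n /asboolP[q Sq fq] nmin.
exists (Some (f q)); exists (Some q) => //; split=> // q' Sq'.
by rewrite fq; apply: nmin; apply/asboolP; exists q'.
Qed.

(** Meant for simple paths or cycles as [S] and walks as [W]: removing loops from a walk never
    raises its weight. *)
Lemma min_value_least (T : Type) (S : T -> Prop) (f : T -> nat) d
    (W : nat -> Prop) :
  (forall p, S p -> W (f p)) -> (forall k, W k -> exists2 p, S p & f p <= k) ->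
  min_value S f d -> least W d.
Proof.
move=> SW WS [[p [Sp pmin] ->|nS ->]] /=.
  by split=> [|k /WS[q Sq]]; [exact: SW | apply: leq_trans; exact: pmin].
by move=> k /WS[p /nS].
Qed.

Section Paths.
Variable G : digraph.
Local Notation V := 'I_(nv G).

Definition edge (u v w : nat) : Prop := (u, v, w) \in nedges G.

Lemma edgeP (u v w : nat) :
  reflect (exists a b : V, [/\ u = a, v = b & (a, b, w) \in edges G])
          ((u, v, w) \in nedges G).
Proof.
apply: (iffP mapP) => [[[[a b] k] abk [-> -> ->]]|[a [b [-> -> abw]]]].
  by exists a, b.
by exists (a, b, w).
Qed.

Lemma edge_bound u v w : edge u v w -> [/\ u < nv G, v < nv G & u != v].
Proof.
move=> /edgeP[a [b [-> -> abw]]]; split=> //.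
by have := allP (edges_loopless G) _ abw.
Qed.

Lemma wt_edge (u v : V) w : (u, v, w) \in edges G -> wt u v = w.
Proof.
move=> e_in; rewrite /wt.
have := edges_uniq G; elim: (edges G) e_in => //= e E IH.
rewrite inE big_cons => /predU1P[<- /andP[nE _]|e_E /andP[nE uE]] /=.
  rewrite eqxx big_seq_cond big1 ?addn0 // => e' /andP[e'E /eqP e'uv].
  by case/mapP: nE; exists e'.
case: eqP => [euv|_]; last exact: IH.
by case/mapP: nE; exists (u, v, w).
Qed.

Lemma arc_wt (u v : V) : arc u v -> (u, v, wt u v) \in edges G.
Proof. by move=> /mapP[[[a b] w] e_in [-> ->]]; rewrite (wt_edge e_in). Qed.

Lemma edge_arc (u v : V) w : (u, v, w) \in edges G -> arc u v.
Proof. by move=> e_in; apply/mapP; exists (u, v, w). Qed.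

Lemma consecutive_cat (x : V) p q :
  consecutive x (p ++ q) = consecutive x p ++ consecutive (last x p) q.
Proof. by elim: p x => // a p IH x; congr cons; exact: IH. Qed.

Lemma weight_cat (x : V) p q :
  weight x (p ++ q) = weight x p + weight (last x p) q.
Proof. by rewrite /weight consecutive_cat big_cat. Qed.

Lemma weight_cons (x y : V) p : weight x (y :: p) = wt x y + weight y p.
Proof. by rewrite /weight [consecutive _ _]/= big_cons. Qed.

Lemma weight_rcons (x y : V) p :
  weight x (rcons p y) = weight x p + wt (last x p) y.
Proof. by rewrite -cats1 weight_cat weight_cons /weight /= big_nil addn0. Qed.

Lemma path_consecutive (x : V) p e :
  path (@arc G) x p -> e \in consecutive x p -> arc e.1 e.2.
Proof.
elim: p x => //= a p IH x /andP[xa ap].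
by rewrite inE => /predU1P[->//|]; exact: IH.
Qed.

Lemma consecutive_path (x : V) p :
  (forall e, e \in consecutive x p -> arc e.1 e.2) -> path (@arc G) x p.
Proof.
elim: p x => //= a p IH x H; rewrite (H (x, a)) ?mem_head //=.
by apply: IH => e e_in; apply: H; rewrite inE e_in orbT.
Qed.

Variable F : V * V -> Prop.

(** [F] is trivial for distances, excludes one path edge for replacement paths, and excludes the
    edges into the hub for betweenness. *)
Definition edge_in (u v w : nat) : Prop :=
  exists a b : V, [/\ u = a, v = b, (a, b, w) \in edges G & F (a, b)].

Lemma path_walk (x : V) p : path (@arc G) x p ->
  (forall e, e \in consecutive x p -> F e) ->
  walk edge_in x (last x p) (weight x p).
Proof.
elim/last_ind: p => [|p a IH].
  by rewrite /weight big_nil => _ _; exact: walk_nil.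
rewrite rcons_path weight_rcons last_rcons => /andP[xp pa] xF.
apply: (@walk_rcons _ _ (last x p)).
  by apply: IH => // e e_in; apply: xF; rewrite -cats1 consecutive_cat mem_cat e_in.
exists (last x p), a; split=> //; first exact: arc_wt.
by apply: xF; rewrite -cats1 consecutive_cat mem_cat mem_head orbT.
Qed.

(** Loop erasure: when the walk meets a vertex already on the path, the path is cut back to that
    vertex. This only discards edges, so the weight does not grow and [F] still holds. *)
Lemma walk_path (x : V) k d : walk edge_in x k d ->
  exists (y : V) p, [/\ k = y, simple_path x y p, weight x p <= d &
    forall e, e \in consecutive x p -> F e].
Proof.
elim=> [|_ _ {}d w _ [y [p [-> /and3P[xp /eqP ly up] pd pF]]] [a [b [/val_inj <- -> yb Fyb]]]].
  by exists x, [::]; split; rewrite // /simple_path /weight /= ?eqxx // big_nil.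
have [b_p|b_p] := boolP (b \in x :: p); last first.
  exists b, (rcons p b); rewrite weight_rcons ly (wt_edge yb) leq_add2r; split=> //.
    rewrite /simple_path rcons_path last_rcons eqxx xp ly (edge_arc yb) /=.
    by have := rcons_uniq (x :: p) b; rewrite b_p up /= => ->.
  move=> e; rewrite -cats1 consecutive_cat mem_cat ly inE.
  by case/orP=> [/pF|/eqP->].
case/splitPl: b_p xp up pd pF {ly} => p1 p2 lb.
rewrite cat_path weight_cat consecutive_cat -cat_cons cat_uniq.
move=> /andP[xp1 _] /andP[up1 _] pd pF.
exists b, p1; split=> //; first by rewrite /simple_path xp1 lb eqxx.
  by apply: leq_trans (leq_addr _ _) (leq_trans pd _); exact: leq_addr.
by move=> e e_in; apply: pF; rewrite mem_cat e_in.
Qed.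

Lemma min_path_walk (S : seq V -> Prop) (s t : V) d :
  (forall q, S q <->
     simple_path s t q /\ (forall e, e \in consecutive s q -> F e)) ->
  min_value S (weight s) d -> least (walk edge_in s t) d.
Proof.
move=> SF; apply: min_value_least => [q /SF[/and3P[sq /eqP<- _] qF]|k].
  exact: path_walk.
move=> /walk_path[y [p [/val_inj <- sp pk pF]]]; exists p => //.
by apply/SF; split.
Qed.

End Paths.

Lemma edge_inT G (F : 'I_(nv G) * 'I_(nv G) -> Prop) : (forall e, F e) ->
  forall u v w, edge G u v w <-> edge_in F u v w.
Proof.
move=> FT u v w; split=> [/edgeP[a [b [-> -> abw]]]|[a [b [-> -> abw _]]]].
  by exists a, b.
by apply/edgeP; exists a, b.
Qed.

Lemma is_dist_walk G (x y : 'I_(nv G)) d :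
  is_dist x y d -> least (walk (edge G) x y) d.
Proof.
pose F := fun _ : 'I_(nv G) * 'I_(nv G) => True.
move=> /(min_path_walk (F := F)) H.
have {H} : least (walk (edge_in F) x y) d by apply: H => q; split=> [|[]].
have E k : walk (edge_in F) x y k <-> walk (edge G) x y k.
  by split; apply: walk_sub => u v w; rewrite (@edge_inT _ F).
case: d => [d|] /= => [[/E xy dm]|H k /E/H //]; split=> // k /E; exact: dm.
Qed.

Lemma path_edge_walk G (x : 'I_(nv G)) p : path (@arc G) x p ->
  walk (edge G) x (last x p) (weight x p).
Proof.
move=> xp; apply: walk_sub (path_walk (F := fun=> True) xp _) => // u v w.
by rewrite -edge_inT.
Qed.

Lemma walk_simple_path G (x : 'I_(nv G)) k d : walk (edge G) x k d ->
  exists (y : 'I_(nv G)) p, [/\ k = y, simple_path x y p & weight x p <= d].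
Proof.
move=> xk; have /walk_path[y [p [ky xp pd _]]] :
    walk (edge_in (fun _ : 'I_(nv G) * 'I_(nv G) => True)) x k d.
  by apply: walk_sub xk => u v w; rewrite -edge_inT.
by exists y, p.
Qed.

Lemma simple_cycle_walk G (x : 'I_(nv G)) p :
  simple_cycle x p -> closed_walk (edge G) x (cycle_weight x p).
Proof.
rewrite /simple_cycle /= rcons_path => /andP[/andP[xp px] _].
exists (last x p), (weight x p), (wt (last x p) x); split.
- exact: path_edge_walk.
- by apply/edgeP; exists (last x p), x; split=> //; exact: arc_wt.
- by rewrite /cycle_weight weight_rcons.
Qed.

Lemma walk_simple_cycle G (x : 'I_(nv G)) d :
  closed_walk (edge G) x d -> exists2 p, simple_cycle x p & cycle_weight x p <= d.
Proof.
move=> [_ [k [w [/walk_simple_path[y [p [-> /and3P[xp /eqP ly up] pk]]] yx ->]]]].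
case/edgeP: yx => a [b [/val_inj ya /val_inj xb]]; rewrite -ya -xb => yx.
exists p; last by rewrite /cycle_weight weight_rcons ly (wt_edge yx) leq_add2r.
by rewrite /simple_cycle up andbT /= rcons_path xp ly (edge_arc yx).
Qed.

Lemma closed_walk_bound G x d : closed_walk (edge G) x d -> x < nv G.
Proof. by move=> [y [k [w [_ /edge_bound[]]]]]. Qed.

Definition min_cycle (G : digraph) : option nat -> Prop :=
  least (fun k => exists v, closed_walk (edge G) v k).

Lemma is_min_cycle_weight_least G d : is_min_cycle_weight G d -> min_cycle G d.
Proof.
apply: min_value_least => [[x p] /= /simple_cycle_walk xp|k [v vk]].
  by exists (val x).
have vn := closed_walk_bound vk.
have [p xp pk] := @walk_simple_cycle G (Ordinal vn) k vk.
by exists (Ordinal vn, p).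
Qed.

(* Exceeds the weight of every simple cycle. *)
Definition heavy (G : digraph) : nat := (\sum_(e <- edges G) e.2) * nv G + 1.

Lemma wt_le G (u v : 'I_(nv G)) : wt u v <= \sum_(e <- edges G) e.2.
Proof. by rewrite /wt [leqRHS](bigID (fun e => e.1 == (u, v))) leq_addr. Qed.

Lemma weight_le G (x : 'I_(nv G)) p :
  weight x p <= (\sum_(e <- edges G) e.2) * size p.
Proof.
elim: p x => [|a p IH] x; first by rewrite /weight big_nil.
by rewrite weight_cons /= mulnS leq_add ?wt_le.
Qed.

Lemma min_cycle_heavy G k : min_cycle G (Some k) -> k < heavy G.
Proof.
move=> [[v vk] kmin]; have vn := closed_walk_bound vk.
have [p xp pk] := @walk_simple_cycle G (Ordinal vn) k vk.
apply: leq_ltn_trans (kmin _ _) _.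
  by exists v; exact: simple_cycle_walk xp.
rewrite /heavy addn1 ltnS (leq_trans (weight_le _ _)) // leq_mul2l size_rcons.
case/andP: xp => _ /card_uniqP up; have := max_card (mem (Ordinal vn :: p)).
by rewrite up card_ord /= => ->; rewrite orbT.
Qed.

(* The least positive entry of l is one plus off plus the minimum cycle weight
   d, or is larger than off + cap when there is no cycle. *)
Definition reveals (off cap : nat) (l : seq nat) (d : option nat) : Prop :=
  (forall x, x \in l -> x != 0 -> off + odflt cap d < x) /\
  (forall k, d = Some k -> (off + k).+1 \in l).

(** The initial cap (off + cap).+1 is itself the right value when there is no cycle, and lies above
    it otherwise. *)
Lemma reveals_min off cap l d : (forall k, d = Some k -> k < cap) ->
  reveals off cap l d ->
  min_positive (off + cap).+1 l = (off + odflt cap d).+1.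
Proof.
move=> dcap [H1 H2]; set c := (off + cap).+1.
have [mc ml] := min_positive_le c l.
case: d dcap H1 H2 => [k|] /= dcap H1 H2.
  have kc := dcap _ erefl; have {}H2 := H2 _ erefl.
  apply/eqP; rewrite eqn_leq ml //=.
  case: (min_positive_mem c l) => [->|[h1 h2]]; last exact: H1.
  by rewrite /c ltnS leq_add2l ltnW.
by case: (min_positive_mem c l) => // -[h1 h2]; apply/eqP; rewrite eqn_leq mc H1.
Qed.

(** * The detour graph *)

(** A family is what one loop of a program emits, so that a construction and its program are
    compared family by family ([spells]). [collected] is an iterated disjunction in order that a
    hypothesis on an edge splits into the families. *)
Definition edge_family : Type := nat * (nat -> nat * nat * nat).

Definition collect (fs : seq edge_family) : seq (nat * nat * nat) :=
  flatten [seq [seq F.2 i | i <- iota 0 F.1] | F <- fs].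

Fixpoint collected (fs : seq edge_family) (e : nat * nat * nat) : Prop :=
  if fs is F :: fs' then (exists2 i, i < F.1 & e = F.2 i) \/ collected fs' e
  else False.

Lemma collectP fs e : reflect (collected fs e) (e \in collect fs).
Proof.
apply: (iffP idP); elim: fs => //= F fs IH; rewrite mem_cat.
  case/orP=> [/mapP[i]|/IH]; last by right.
  by rewrite mem_iota => iF ->; left; exists i.
case=> [[i iF ->]|/IH->]; last by rewrite orbT.
by rewrite map_f // mem_iota.
Qed.

Lemma size_collect fs : size (collect fs) = sumn [seq F.1 | F <- fs].
Proof.
elim: fs => //= F fs IH.
by rewrite /collect /= size_cat size_map size_iota -/(collect fs) IH.
Qed.

Lemma uniq_collect_cons F fs :
  (forall i j, i < F.1 -> j < F.1 -> (F.2 i).1 = (F.2 j).1 -> i = j) ->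
  (forall i e, i < F.1 -> collected fs e -> e.1 <> (F.2 i).1) ->
  uniq [seq e.1 | e <- collect fs] -> uniq [seq e.1 | e <- collect (F :: fs)].
Proof.
move=> injF disj ufs; rewrite /collect /= map_cat cat_uniq -/(collect fs) ufs andbT.
rewrite -map_comp map_inj_in_uniq ?iota_uniq => [|i j]; last first.
  by rewrite !mem_iota => iF jF; exact: injF.
apply/hasPn => _ /mapP[e /collectP e_fs ->]; apply/mapP => -[i].
by rewrite mem_iota => iF /(disj _ _ iF e_fs).
Qed.

Section Core.
Variable G : digraph.
Local Notation n := (nv G).
Local Notation m := (ne G).

Definition src (i : nat) : nat := (nth (0, 0, 0) (nedges G) i).1.1.
Definition dst (i : nat) : nat := (nth (0, 0, 0) (nedges G) i).1.2.
Definition cost (i : nat) : nat := (nth (0, 0, 0) (nedges G) i).2.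

Lemma ith_edge i : i < m -> edge G (src i) (dst i) (cost i).
Proof.
move=> im; rewrite /edge /src /dst /cost -!surjective_pairing.
by rewrite mem_nth // size_nedges.
Qed.

Lemma edge_ith u v w : edge G u v w ->
  exists2 i, i < m & [/\ u = src i, v = dst i & w = cost i].
Proof.
move=> /(nthP (0, 0, 0))[i im e]; exists i; first by rewrite -size_nedges.
by rewrite /src /dst /cost e.
Qed.

Lemma src_lt i : i < m -> src i < n.
Proof. by move=> /ith_edge/edge_bound[]. Qed.

Lemma dst_lt i : i < m -> dst i < n.
Proof. by move=> /ith_edge/edge_bound[]. Qed.

Lemma src_dst i : i < m -> src i <> dst i.
Proof. by move=> /ith_edge/edge_bound[_ _ /eqP]. Qed.

Lemma ith_edge_inj i j : i < m -> j < m -> src i = src j -> dst i = dst j -> i = j.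
Proof.
move=> im jm sij dij; apply/eqP.
have um : uniq [seq e.1 | e <- nedges G].
  rewrite -map_comp (map_comp (fun e => (val e.1, val e.2)) (fun e => e.1)).
  by rewrite map_inj_uniq ?edges_uniq // => -[a b] [c d] /= [/val_inj-> /val_inj->].
have sz : size [seq e.1 | e <- nedges G] = m by rewrite size_map size_nedges.
rewrite -(nth_uniq (0, 0) (s := [seq e.1 | e <- nedges G])) ?sz //.
rewrite !(nth_map (0, 0, 0)) ?size_nedges //; apply/eqP.
by rewrite [LHS]surjective_pairing [RHS]surjective_pairing; congr (_, _).
Qed.

End Core.

Ltac split_edges :=
  repeat match goal with
  | H : _ \/ _ |- _ => destruct H as [H|H]
  | H : exists2 _, _ & _ |- _ => let i := fresh "i" in let hi := fresh "hi" in
      destruct H as [i hi H]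
  | H : False |- _ => destruct H
  end.

Ltac edge_ranges G :=
  repeat match goal with
  | H : is_true (?i < ne G) |- _ => lazymatch goal with
     | _ : is_true (dst G i < nv G) |- _ => fail
     | _ => have := @src_lt G i H; have := @dst_lt G i H; have := @src_dst G i H;
            do 3 move=> ?
     end
  end.

Ltac edges_disjoint G := first
  [ by [] | apply: uniq_collect_cons;
    [ let i := fresh "i" in let j := fresh "j" in let hi := fresh "hi" in
      let hj := fresh "hj" in intros i j hi hj; simpl in hi, hj;
      first [case | move=> _]; edge_ranges G;
      first [lia | exact: ith_edge_inj | move=> ? ?; apply: (@ith_edge_inj G) => //; lia]
    | let i := fresh "i" in let e := fresh "e" in let hi := fresh "hi" in
      let H := fresh "H" in intros i e hi H; simpl in hi, H; split_edges;
      subst e; simpl; case; edge_ranges G; try lia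
    | edges_disjoint G ] ].

Section Detour.
Variable G : digraph.
Local Notation n := (nv G).
Local Notation m := (ne G).
Local Notation Q := (heavy G).
Hypothesis n_gt0 : 0 < n.

(* The vertex v of G is split into v (leaving) and n + v (entering); 2n + j,
   j <= n, is the j-th vertex of the given path.  The detour by v costs
   (n - v)Q + (v + 1)Q = (n + 1)Q plus the weight of a cycle through v. *)
Definition detour_families : seq edge_family :=
  [:: (m, fun i => (src G i, dst G i, cost G i));
      (m, fun i => (src G i, n + dst G i, cost G i));
      (n, fun j => (2 * n + j, 2 * n + j + 1, 0));
      (n, fun j => (2 * n + j, j, (n - j) * Q));
      (n, fun j => (n + j, 2 * n + j + 1, (j + 1) * Q));
      (1, fun _ => (3 * n, 2 * n, 0))].

Lemma detour_graph : exists G',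
  nv G' = 3 * n + 1 /\ nedges G' = collect detour_families.
Proof.
apply: make_graph.
  apply/allP => e /collectP /= H; split_edges; subst e => /=; edge_ranges G.
  all: try by apply/and3P; split; lia.
rewrite /detour_families; edges_disjoint G.
Qed.

Lemma detour_edges (G' : digraph) u v w : nedges G' = collect detour_families ->
  edge G' u v w <-> collected detour_families (u, v, w).
Proof. by move=> E'; rewrite /edge E'; split=> /collectP. Qed.

Definition detour (j u v w : nat) : Prop :=
  collected detour_families (u, v, w) /\ (u, v) <> (2 * n + j, 2 * n + j + 1).

(* What a walk from the path vertex 2n that avoids the path edge number j costs:
   it is still to the left of that edge, or inside G, having left the path at
   some i <= j, or it has already paid for a cycle or for an extra Q. *)
Definition detour_inv (j y d : nat) : Prop :=
  [\/ (n + 2) * Q <= d \/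
      exists v k, closed_walk (edge G) v k /\ (n + 1) * Q + k <= d,
      2 * n <= y <= 2 * n + j,
      y < n /\ exists i k, [/\ i <= j, walk (edge G) i y k & (n - i) * Q + k <= d] |
      n <= y < 2 * n /\ exists i u k w, [/\ i <= j, walk (edge G) i u k,
        edge G u (y - n) w & (n - i) * Q + (k + w) <= d]].

(** Leaving the path at some i <= j costs (n - i)Q and returning from n + i' costs (i' + 1)Q. A
    return with i' < j ends again to the left of the missing edge. If i' >= j and i' differs from i,
    then i' > i and at least (n + 2)Q has been paid; if i' = i, the total is (n + 1)Q and the part
    inside G is closed at i. *)
Lemma detour_lower j d : j < n -> walk (detour j) (2 * n) (3 * n) d ->
  (n + 2) * Q <= d \/ exists v k, closed_walk (edge G) v k /\ (n + 1) * Q + k <= d.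
Proof.
move=> jn W; suff : detour_inv j (3 * n) d by case=> [//|?|[? _]|[? _]]; lia.
elim: W => [|y z {}d w _ IH [H nj]]; first by apply: Or42; lia.
case: IH => [[done|[v [k [vk done]]]]|left|[yn [i [k [ij ik dk]]]]
  |[yn [i [u [k [w' [ij iu uy dk]]]]]]].
- by apply: Or41; left; apply: leq_trans done (leq_addr _ _).
- by apply: Or41; right; exists v, k; split=> //; apply: leq_trans done (leq_addr _ _).
- rewrite /= in H; split_edges; case: H => ? ? ?; subst y z w; edge_ranges G.
  + lia.
  + lia.
  + apply: Or42; have : i <> j by move=> ij; apply: nj; rewrite ij.
    by lia.
  + apply: Or43; split=> //; exists i, 0; split; [lia|exact: walk_nil|].
    by rewrite addn0 leq_addl.
  + lia.
  + lia.
- rewrite /= in H; split_edges; case: H => ? ? ?; subst y z w; edge_ranges G.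
  + apply: Or43; split=> //; exists i, (k + cost G i0); split=> //; last first.
      by rewrite addnA leq_add2r.
    by apply: walk_rcons ik _; exact: ith_edge.
  + apply: Or44; split; first by lia.
    exists i, (src G i0), k, (cost G i0); split=> //; last by rewrite addnA leq_add2r.
    by rewrite addKn; exact: ith_edge.
  all: try lia.
- rewrite /= in H; split_edges; case: H => ? ? ?; subst y z w; edge_ranges G.
  all: try lia.
  rewrite addKn in uy; have [lt|ge] := ltnP i0 j; first by apply: Or42; lia.
  apply: Or41; have [ii|ii] := eqVneq i0 i; last first.
    left; have -> : n + 2 = (n - i) + (i + 2) by lia.
    rewrite mulnDl; apply: leq_add; first exact: leq_trans (leq_addr _ _) dk.
    by rewrite leq_mul2r; lia.
  subst i0; right; exists i, (k + w'); split; first by exists u, k, w'.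
  have -> : n + 1 = (n - i) + (i + 1) by lia.
  by rewrite mulnDl; lia.
Qed.

Lemma detour_path j a b : a <= b <= n -> (b <= j \/ j < a) ->
  walk (detour j) (2 * n + a) (2 * n + b) 0.
Proof.
move=> /andP[]; elim: b => [|b IH] ab bn jb.
  by move: ab; rewrite leqn0 => /eqP->; exact: walk_nil.
have [->|ab'] := eqVneq a b.+1; first exact: walk_nil.
rewrite -[0]addn0; apply: (@walk_rcons _ _ (2 * n + b)).
  by apply: IH; lia.
split; last by case; lia.
by right; right; left; exists b => //=; congr (_, _, _); lia.
Qed.

Lemma detour_upper v d : closed_walk (edge G) v d ->
  walk (detour v) (2 * n) (3 * n) ((n + 1) * Q + d).
Proof.
move=> vd; have vn := closed_walk_bound vd; case: vd => [u [k [w [vu uv ->]]]].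
have core : walk (detour v) v u k.
  apply: walk_sub vu => a b c ab; have [an bn _] := edge_bound ab.
  have [i im [-> -> ->]] := edge_ith ab.
  by split; [left; exists i | case; have := src_lt im; lia].
have [i im [us vs ws]] := edge_ith uv; have [un _ _] := edge_bound uv.
have W1 : walk (detour v) (2 * n) (2 * n + v) 0.
  by rewrite -{1}[2 * n]addn0; apply: detour_path; lia.
have W2 : walk (detour v) (2 * n + v) v ((n - v) * Q).
  apply: walk_edge; split; last by case; lia.
  by do 3 right; left; exists v.
have W3 : walk (detour v) u (n + v) w.
  apply: walk_edge; split; last by case; lia.
  by right; left; exists i => //; rewrite us vs ws.
have W4 : walk (detour v) (n + v) (2 * n + (v + 1)) ((v + 1) * Q).
  apply: walk_edge; split; last by case; lia.
  by do 4 right; left; exists v => //=; congr (_, _, _); lia.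
have W5 : walk (detour v) (2 * n + (v + 1)) (2 * n + n) 0 by apply: detour_path; lia.
have -> : 3 * n = 2 * n + n by lia.
have -> : (n + 1) * Q + (k + w) = 0 + ((n - v) * Q + (k + (w + ((v + 1) * Q + 0)))).
  have -> : n + 1 = (n - v) + (v + 1) by lia.
  by rewrite mulnDl; lia.
exact: walk_cat W1 (walk_cat W2 (walk_cat core (walk_cat W3 (walk_cat W4 W5)))).
Qed.

End Detour.

Definition vtx (N : nat) (x0 : 'I_N) (k : nat) : 'I_N := insubd x0 k.

Lemma val_vtx N (x0 : 'I_N) k : k < N -> val (vtx x0 k) = k.
Proof. by move=> kN; rewrite val_insubd kN. Qed.

Lemma mem_consecutive G (x : 'I_(nv G)) p e :
  e \in consecutive x p -> e.1 \in x :: p /\ e.2 \in p.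
Proof.
elim: p x => //= a p IH x; rewrite inE => /predU1P[->|/IH[h1 h2]] /=.
  by rewrite !mem_head.
by rewrite inE h1 orbT inE h2 orbT.
Qed.

(** A simple path has only one edge out of each vertex, so [q] is forced to follow [p]. Hence a
    simple path other than [p] misses an edge of [p]: this ties 2-SiSP to replacement paths and
    reduces isolation to single edges. *)
Lemma simple_path_sub G (s t : 'I_(nv G)) p q :
  simple_path s t p -> simple_path s t q ->
  {subset consecutive s p <= consecutive s q} -> p = q.
Proof.
elim: p s q => [|a p IH] s q.
  move=> /and3P[_ /eqP<- _] /and3P[_ lq uq] _; case: q lq uq => //= b q /eqP lq.
  by rewrite -lq mem_last.
move=> /and3P[/= /andP[sa ap] lp /andP[sp up]].
case: q => [_ /(_ (s, a))|b q]; first by rewrite mem_head => /(_ isT).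
move=> /and3P[/= /andP[sb bq] lq /andP[sq uq]] sub.
have ab : a = b.
  have := sub (s, a); rewrite mem_head inE => /(_ isT)/predU1P[[]//|].
  by move=> /mem_consecutive[/= s_q _]; rewrite s_q in sq.
rewrite -{b}ab in sb bq lq sq uq sub *; congr (_ :: _).
apply: (IH a); [by apply/and3P | by apply/and3P | move=> e e_p].
have := sub e; rewrite !inE e_p orbT => /(_ isT)/predU1P[es|//].
by case: (mem_consecutive e_p); rewrite es /= (negPf sp).
Qed.

Lemma consecutive_map G (f : nat -> 'I_(nv G)) a k :
  consecutive (f a) [seq f i | i <- iota a.+1 k] =
  [seq (f i, f i.+1) | i <- iota a k].
Proof. by elim: k a => //= k IH a; congr (_ :: _); exact: IH. Qed.

Lemma last_map_iota (T : Type) (f : nat -> T) a k :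
  last (f a) [seq f i | i <- iota a.+1 k] = f (a + k).
Proof. by elim: k a => [|k IH] a; rewrite /= ?addn0 // IH addSnnS. Qed.

Section DetourInstance.
Variables G G' : digraph.
Local Notation n := (nv G).
Local Notation Q := (heavy G).
Hypothesis n_gt0 : 0 < n.
Hypothesis nvG' : nv G' = 3 * n + 1.
Hypothesis edgesG' : nedges G' = collect (detour_families G).

Lemma detour_nv_gt0 : 0 < nv G'. Proof. by rewrite nvG' addn1. Qed.

Definition pvtx (j : nat) : 'I_(nv G') := vtx (Ordinal detour_nv_gt0) (2 * n + j).
Definition ppath : seq 'I_(nv G') := [seq pvtx j | j <- iota 1 n].

Lemma val_pvtx j : j <= n -> val (pvtx j) = 2 * n + j.
Proof. by move=> jn; rewrite val_vtx // nvG'; lia. Qed.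

Lemma pvtx_inj i j : i <= n -> j <= n -> pvtx i = pvtx j -> i = j.
Proof. by move=> /val_pvtx vi /val_pvtx vj /(congr1 val); rewrite vi vj; lia. Qed.

Lemma consecutive_ppath :
  consecutive (pvtx 0) ppath = [seq (pvtx j, pvtx j.+1) | j <- iota 0 n].
Proof. exact: consecutive_map. Qed.

Lemma pvtx_edge j : j < n -> (pvtx j, pvtx j.+1, 0) \in edges G'.
Proof.
move=> jn; have : edge G' (2 * n + j) (2 * n + j + 1) 0.
  by apply/(detour_edges _ _ _ edgesG'); right; right; left; exists j.
case/edgeP=> a [b [aj bj ab]].
have -> : pvtx j = a by apply: val_inj; rewrite val_pvtx // ltnW.
by have -> : pvtx j.+1 = b by apply: val_inj; rewrite val_pvtx //= -bj; lia.
Qed.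

Lemma last_ppath : last (pvtx 0) ppath = pvtx n.
Proof. exact: last_map_iota. Qed.

Lemma simple_ppath : simple_path (pvtx 0) (pvtx n) ppath.
Proof.
rewrite /simple_path last_ppath eqxx -[pvtx 0 :: _]/[seq pvtx j | j <- iota 0 n.+1].
apply/and3P; split=> //.
  apply: consecutive_path => e; rewrite consecutive_ppath => /mapP[j].
  by rewrite mem_iota => jn ->; exact: edge_arc (pvtx_edge jn).
rewrite map_inj_in_uniq ?iota_uniq // => i j; rewrite !mem_iota => iN jN.
by apply: pvtx_inj; lia.
Qed.

Lemma weight_ppath : weight (pvtx 0) ppath = 0.
Proof.
rewrite /weight consecutive_ppath big_map big_seq big1 // => j.
by rewrite mem_iota => jn; exact: wt_edge (pvtx_edge jn).
Qed.

Lemma shortest_ppath : shortest_path (pvtx 0) (pvtx n) ppath.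
Proof. by split; [exact: simple_ppath | rewrite weight_ppath]. Qed.

Lemma avoid_detour j : j < n -> forall u v w,
  edge_in (fun e => e <> (pvtx j, pvtx j.+1)) u v w <-> detour G j u v w.
Proof.
move=> jn u v w; have vj := @val_pvtx j (ltnW jn); have vj1 := @val_pvtx j.+1 jn.
split=> [[a [b [-> -> ab nj]]]|[/(detour_edges _ _ _ edgesG')/edgeP[a [b [-> -> ab]]] nj]].
  split; first by apply/(detour_edges _ _ _ edgesG')/edgeP; exists a, b.
  case=> aj bj; apply: nj; congr (_, _); apply: val_inj; rewrite ?vj ?vj1 //.
  by rewrite /= bj; lia.
exists a, b; split=> // -[aj bj]; apply: nj; rewrite aj bj.
by congr (_, _); move: vj vj1 => /=; lia.
Qed.

Definition avoids (e : 'I_(nv G') * 'I_(nv G')) (q : seq 'I_(nv G')) : Prop :=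
  simple_path (pvtx 0) (pvtx n) q /\ e \notin consecutive (pvtx 0) q.

Lemma avoids_least j d : j < n ->
  min_value (avoids (pvtx j, pvtx j.+1)) (weight (pvtx 0)) d ->
  least (walk (detour G j) (2 * n) (3 * n)) d.
Proof.
move=> jn /(min_path_walk (F := fun e => e <> (pvtx j, pvtx j.+1))) H.
have {H} : least (walk (edge_in (fun e => e <> (pvtx j, pvtx j.+1)))
    (pvtx 0) (pvtx n)) d.
  apply: H => q; split=> [[sq /negP nq]|[sq nq]]; split=> //.
    by move=> e e_q ej; apply: nq; rewrite -ej.
  by apply/negP => /nq.
rewrite !val_pvtx // addn0 (_ : 2 * n + n = 3 * n); last by lia.
have E k : walk (edge_in (fun e => e <> (pvtx j, pvtx j.+1))) (2 * n) (3 * n) k <->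
    walk (detour G j) (2 * n) (3 * n) k.
  by split; apply: walk_sub => u v w; rewrite avoid_detour.
by case: d => [d|] /= => [[/E ? dm]|H k /E/H //]; split=> // k /E; exact: dm.
Qed.

Variable d : option nat.
Hypothesis min_d : is_min_cycle_weight G d.

(** Since [odflt Q d] is at most Q, the alternative (n + 2)Q of [detour_lower] is also covered. *)
Lemma avoids_lower j k : j < n ->
  walk (detour G j) (2 * n) (3 * n) k -> (n + 1) * Q + odflt Q d <= k.
Proof.
have dQ : odflt Q d <= Q.
  by move: min_d; case: d => //= k0 /is_min_cycle_weight_least/min_cycle_heavy/ltnW.
move=> jn /(detour_lower n_gt0 jn)[|[v [k0 [vk0 k0k]]]].
  by rewrite -[2]/(1 + 1) addnA mulnDl mul1n; lia.
apply: leq_trans k0k; rewrite leq_add2l.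
have := is_min_cycle_weight_least min_d; case: (d) => [k1|] /=; last first.
  by move=> /(_ k0)[]; exists v.
by move=> [_]; apply; exists v.
Qed.

Lemma replacement_reveals (de : 'I_(nv G') * 'I_(nv G') -> option nat) :
  (forall e, e \in consecutive (pvtx 0) ppath ->
     min_value (avoids e) (weight (pvtx 0)) (de e)) ->
  reveals ((n + 1) * Q) Q
    [seq code_value (de e) | e <- consecutive (pvtx 0) ppath] d.
Proof.
rewrite consecutive_ppath => de_min.
have le j : j < n -> least (walk (detour G j) (2 * n) (3 * n)) (de (pvtx j, pvtx j.+1)).
  move=> jn; apply: avoids_least => //; apply: de_min.
  by apply/mapP; exists j; rewrite ?mem_iota.
split=> [x /mapP[e /mapP[j]]|k dk].
  rewrite mem_iota => jn -> ->; have := le j jn; case: (de _) => //= k [W _] _.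
  exact: avoids_lower W.
have := is_min_cycle_weight_least min_d; rewrite dk => -[[v vk] _].
have vn := closed_walk_bound vk; have U := detour_upper n_gt0 vk.
apply/mapP; exists (pvtx v, pvtx v.+1); first by apply/mapP; exists v; rewrite ?mem_iota.
have := le v vn; case: (de _) => [k'|] /=; last by move=> /(_ _ U).
move=> [W /(_ _ U) k'k]; congr S; apply/eqP; rewrite eqn_leq k'k.
by have := avoids_lower vn W; rewrite dk /= => ->.
Qed.

Definition second_path (q : seq 'I_(nv G')) : Prop :=
  simple_path (pvtx 0) (pvtx n) q /\ q <> ppath.

Lemma second_avoids q : second_path q <->
  exists2 e, e \in consecutive (pvtx 0) ppath & avoids e q.
Proof.
split=> [[sq qp]|[e e_p [sq e_q]]]; last by split=> // qp; rewrite qp e_p in e_q.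
case: (boolP (all (mem (consecutive (pvtx 0) q)) (consecutive (pvtx 0) ppath))).
  by move=> /allP sub; case: qp; rewrite (simple_path_sub simple_ppath sq sub).
by rewrite -has_predC => /hasP[e e_p e_q]; exists e.
Qed.

(** A second path is a path that avoids some edge of the first, so its least weight is the least of
    all the replacement weights. *)
Lemma second_reveals o : optimal second_path (weight (pvtx 0)) o ->
  reveals ((n + 1) * Q) Q [:: code_value (omap (weight (pvtx 0)) o)] d.
Proof.
have /boolp.choice[de de_min] e := ex_min_value (avoids e) (weight (pvtx 0)).
have [R1 R2] := replacement_reveals (fun e _ => de_min e).
have lower q : second_path q -> (n + 1) * Q + odflt Q d <= weight (pvtx 0) q.
  move=> /second_avoids[e e_p eq]; have := de_min e.
  have de_in : code_value (de e) \in
      [seq code_value (de e0) | e0 <- consecutive (pvtx 0) ppath] by exact: map_f.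
  move=> [[p [_ pmin]|nS] deE]; last by case: (nS q eq).
  have := R1 _ de_in; rewrite deE /= => /(_ isT); rewrite ltnS => h.
  exact: leq_trans h (pmin _ eq).
move=> oP; split=> [x|k dk]; rewrite inE.
  move=> /eqP->; case: o oP => //= q [sq _] _; exact: lower.
have /mapP[e e_p ek] := R2 k dk.
have := de_min e; move: ek; case: (de e) => //= k' [k'E] [[p [ep _]|//] [pE]].
have sp : second_path p by apply/second_avoids; exists e.
case: o oP => [q [sq qmin]|/(_ p)//] /=; rewrite eqSS eqn_leq k'E pE qmin // andbT.
by have := lower q sq; rewrite dk /= k'E pE.
Qed.

(** As this is the only edge into 2n, simple cycles through 2n are exactly the simple paths from 2n
    to 3n, closed up at no cost; 2-SiSC thus inherits the analysis of 2-SiSP. *)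
Lemma closing_edgeP u w : edge G' u (2 * n) w <-> u = 3 * n /\ w = 0.
Proof.
rewrite (detour_edges _ _ _ edgesG') /=; split=> [H|[-> ->]]; last first.
  by do 5 right; left; exists 0.
by split_edges; case: H; edge_ranges G; lia.
Qed.

Lemma closing_edge : (pvtx n, pvtx 0, 0) \in edges G'.
Proof.
have /edgeP[a [b [an b0 ab]]] : edge G' (3 * n) (2 * n) 0 by apply/closing_edgeP.
have -> : pvtx n = a by apply: val_inj; rewrite val_pvtx //= -an; lia.
by have -> : pvtx 0 = b by apply: val_inj; rewrite val_pvtx //= -b0; lia.
Qed.

Lemma simple_cycle_ppath q :
  simple_cycle (pvtx 0) q <-> simple_path (pvtx 0) (pvtx n) q.
Proof.
split.
  rewrite /simple_cycle /simple_path /= rcons_path => /andP[/andP[-> lq] ->].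
  rewrite andbT /=; apply/eqP/val_inj; rewrite val_pvtx //.
  have /closing_edgeP[/= -> _] : edge G' (last (pvtx 0) q) (2 * n) (wt (last (pvtx 0) q) (pvtx 0)).
    apply/edgeP; exists (last (pvtx 0) q), (pvtx 0); split=> //; last exact: arc_wt.
    by rewrite val_pvtx // addn0.
  by lia.
move=> /and3P[pq /eqP lq uq]; rewrite /simple_cycle /= rcons_path pq lq.
by rewrite (edge_arc closing_edge); move: uq => /= ->.
Qed.

Lemma cycle_weight_ppath q :
  simple_path (pvtx 0) (pvtx n) q -> cycle_weight (pvtx 0) q = weight (pvtx 0) q.
Proof.
move=> /and3P[_ /eqP lq _].
by rewrite /cycle_weight weight_rcons lq (wt_edge closing_edge) addn0.
Qed.

Lemma shortest_cycle_ppath : shortest_cycle (pvtx 0) ppath.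
Proof.
split; first exact/simple_cycle_ppath/simple_ppath.
by move=> q _; rewrite cycle_weight_ppath ?weight_ppath //; exact: simple_ppath.
Qed.

Lemma second_cycle_reveals o :
  optimal (fun q => simple_cycle (pvtx 0) q /\ q <> ppath) (cycle_weight (pvtx 0)) o ->
  optimal second_path (weight (pvtx 0)) o.
Proof.
case: o => [q [[/simple_cycle_ppath sq qp] qmin]|nS]; last first.
  by move=> q [/simple_cycle_ppath sq qp]; exact: (nS q).
split=> // q' [sq' q'p]; rewrite -!cycle_weight_ppath //; apply: qmin.
by split=> //; exact/simple_cycle_ppath.
Qed.

End DetourInstance.

(** * The radius graph *)

Section Radius.
Variable G : digraph.
Local Notation n := (nv G).
Local Notation m := (ne G).
Local Notation Q := (heavy G).
Hypothesis n_gt0 : 0 < n.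

(* Each vertex v of G is split into v and n + v and gets a source 2n + v.  The
   chains 3n + j and 4n + 1 + j, j <= n, run down and up: they let the source of
   v reach every n + u but n + v at cost Q, the hub 5n + 2 makes everything else
   reachable at cost Q, and 5n + 3 keeps all but the sources (and, at cost 2Q,
   the hub) from being centres. *)
Definition radius_families : seq edge_family :=
  [:: (m, fun i => (src G i, dst G i, cost G i));
      (m, fun i => (src G i, n + dst G i, Q + cost G i));
      (n, fun j => (2 * n + j, j, 0));
      (n, fun j => (2 * n + j, 3 * n + j, 0));
      (n, fun j => (2 * n + j, 4 * n + j + 2, 0));
      (n, fun j => (2 * n + j, 5 * n + 2, 0));
      (n, fun j => (2 * n + j, 5 * n + 3, Q));
      (n, fun j => (3 * n + j + 1, 3 * n + j, 0));
      (n, fun j => (3 * n + j + 1, n + j, Q));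
      (n, fun j => (4 * n + j + 1, 4 * n + j + 2, 0));
      (n, fun j => (4 * n + j + 1, n + j, Q));
      (n, fun j => (5 * n + 2, 2 * n + j, Q));
      (n, fun j => (5 * n + 2, j, Q));
      (1, fun _ => (5 * n + 2, 4 * n, Q));
      (1, fun _ => (5 * n + 2, 4 * n + 1, Q))].

Lemma radius_graph : exists G',
  nv G' = 5 * n + 4 /\ nedges G' = collect radius_families.
Proof.
apply: make_graph.
{ apply/allP => e /collectP /= H; split_edges; subst e => /=; edge_ranges G.
  all: by apply/and3P; split; lia. }
by rewrite /radius_families; edges_disjoint G.
Qed.

Definition rad (u v w : nat) : Prop := collected radius_families (u, v, w).

(** In order: places that the source of v reaches for free outside G, where the chains lie on the
    two sides of n + v; G itself; anything else, where Q has already been paid; the target n + v. *)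
Definition source_inv (v y d : nat) : Prop :=
  [\/ [|| y == 2 * n + v, y == 5 * n + 2, 3 * n <= y <= 3 * n + v |
          4 * n + v + 1 < y <= 5 * n + 1],
      y < n /\ (exists2 k, walk (edge G) v y k & k <= d),
      Q <= d /\ y != n + v |
      y = n + v /\ (2 * Q <= d \/ exists2 k, closed_walk (edge G) v k & Q + k <= d)].

(** Every edge into n + v costs at least Q, so a walk that has paid Q before arrives with 2Q. The
    free chain vertices of the source have no edge to n + v; there remain walks that run only
    through G, and they close a walk at v. *)
Lemma source_lower v d : v < n -> walk rad (2 * n + v) (n + v) d ->
  2 * Q <= d \/ exists2 k, closed_walk (edge G) v k & Q + k <= d.
Proof.
move=> vn W; suff : source_inv v (n + v) d.
  by case=> [?|[? _]|[_ /eqP]|[_]] //; lia.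
elim: W => [|y z {}d w _ IH H]; first by apply: Or41; rewrite eqxx.
case: IH => [first|[yn [k vy kd]]|[Qd yv]|[yv _]].
{ rewrite /rad /= in H; split_edges; case: H => ? ? ?; subst y z w; edge_ranges G.
  all: try by exfalso; lia.
  all: try by apply: Or41; lia.
  all: try by apply: Or43; split; lia.
  apply: Or42; split; first by lia.
  have -> : i = v by lia.
  by exists 0 => //; exact: walk_nil. }
{ rewrite /rad /= in H; split_edges; case: H => ? ? ?; subst y z w; edge_ranges G.
  all: try by exfalso; lia.
    apply: Or42; split=> //; exists (k + cost G i); last by rewrite leq_add2r.
    by apply: walk_rcons vy _; exact: ith_edge.
  have [iv|iv] := eqVneq (dst G i) v; last by apply: Or43; split; lia.
  apply: Or44; split; first by rewrite iv.
  right; exists (k + cost G i); last by lia.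
  by exists (src G i), k, (cost G i); split=> //; rewrite -iv; exact: ith_edge. }
{ have [zv|zv] := eqVneq z (n + v); last by apply: Or43; split=> //; lia.
  apply: Or44; split=> //; left.
  rewrite /rad /= in H; split_edges; case: H => ? ? ?; subst y z w; edge_ranges G.
  all: lia. }
{ rewrite /rad /= in H; split_edges; case: H => ? ? ?; subst y z w; edge_ranges G.
  all: by exfalso; lia. }
Qed.

Lemma rad_down a b : b <= a <= n -> walk rad (3 * n + a) (3 * n + b) 0.
Proof.
move=> /andP[]; elim: a => [|a IH] ba an.
  by move: ba; rewrite leqn0 => /eqP->; exact: walk_nil.
have [->|ab] := eqVneq b a.+1; first exact: walk_nil.
rewrite -[0]addn0; apply: (@walk_cat _ _ (3 * n + a)); last by apply: IH; lia.
apply: walk_edge; do 7 right; left; exists a => //=.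
by congr (_, _, _); lia.
Qed.

Lemma rad_up a b : a <= b <= n -> walk rad (4 * n + a + 1) (4 * n + b + 1) 0.
Proof.
move=> /andP[]; elim: b => [|b IH] ab bn.
  by move: ab; rewrite leqn0 => /eqP->; exact: walk_nil.
have [->|ab'] := eqVneq a b.+1; first exact: walk_nil.
rewrite -[0]addn0; apply: (@walk_rcons _ _ (4 * n + b + 1)); first by apply: IH; lia.
do 9 right; left; exists b => //=.
by congr (_, _, _); lia.
Qed.

Lemma source_upper v d y : closed_walk (edge G) v d -> y < 5 * n + 4 ->
  exists2 d', walk rad (2 * n + v) y d' & d' <= Q + d.
Proof.
move=> vd yN; have vn := closed_walk_bound vd.
have Xh : walk rad (2 * n + v) (5 * n + 2) 0.
  by apply: walk_edge; do 5 right; left; exists v.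
have via_hub u : walk rad (5 * n + 2) u Q ->
    exists2 d', walk rad (2 * n + v) u d' & d' <= Q + d.
  by move=> hu; exists (0 + Q); [exact: walk_cat Xh hu | exact: leq_addr].
have [y1|y1] := ltnP y n.
  by apply: via_hub; apply: walk_edge; do 12 right; left; exists y.
have [y2|y2] := ltnP y (2 * n).
  have [yv|yv|yv] := ltngtP (y - n) v.
  - exists (0 + (0 + Q)); last exact: leq_addr.
    apply: (@walk_cat _ _ (3 * n + v)).
      by apply: walk_edge; do 3 right; left; exists v.
    apply: (@walk_cat _ _ (3 * n + (y - n).+1)); first by apply: rad_down; lia.
    apply: walk_edge; do 8 right; left; exists (y - n) => /=; first by lia.
    by congr (_, _, _); lia.
  - exists (0 + (0 + Q)); last exact: leq_addr.
    apply: (@walk_cat _ _ (4 * n + v.+1 + 1)).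
      apply: walk_edge; do 4 right; left; exists v => //=.
      by congr (_, _, _); lia.
    apply: (@walk_cat _ _ (4 * n + (y - n) + 1)); first by apply: rad_up; lia.
    apply: walk_edge; do 10 right; left; exists (y - n) => /=; first by lia.
    by congr (_, _, _); lia.
  (* The target n + v is the one vertex for which the cycle through v is needed. *)
  case: vd => [u [k [w [vu uv ->]]]]; exists (0 + (k + (Q + w))); last by lia.
  apply: (@walk_cat _ _ v).
    by apply: walk_edge; do 2 right; left; exists v.
  apply: (@walk_cat _ _ u).
    apply: walk_sub vu => a b c /edge_ith[i im [-> -> ->]].
    by left; exists i.
  have [i im [-> vi ->]] := edge_ith uv; apply: walk_edge; right; left.
  by exists i => //=; congr (_, _, _); lia.
have [y3|y3] := ltnP y (3 * n).
  apply: via_hub; apply: walk_edge; do 11 right; left; exists (y - 2 * n) => /=.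
    by lia.
  by congr (_, _, _); lia.
have [y4|y4] := leqP y (4 * n).
  apply: via_hub; rewrite -[Q]addn0; apply: (@walk_cat _ _ (3 * n + n)).
    apply: walk_edge; do 13 right; left; exists 0 => //=.
    by congr (_, _, _); lia.
  by have -> : y = 3 * n + (y - 3 * n); [lia | apply: rad_down; lia].
have [y5|y5] := leqP y (5 * n + 1).
  apply: via_hub; rewrite -[Q]addn0; apply: (@walk_cat _ _ (4 * n + 0 + 1)).
    apply: walk_edge; do 14 right; left; exists 0 => //=.
    by congr (_, _, _); lia.
  by have -> : y = 4 * n + (y - (4 * n + 1)) + 1; [lia | apply: rad_up; lia].
have [->|y6] := eqVneq y (5 * n + 2); first by exists 0.
have -> : y = 5 * n + 3 by lia.
exists Q; last exact: leq_addr.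
by apply: walk_edge; do 6 right; left; exists v.
Qed.

(** Every edge out of the hub costs Q, and 5n + 3 is entered only from the sources, again at cost
    Q. *)
Lemma hub_lower d : walk rad (5 * n + 2) (5 * n + 3) d -> 2 * Q <= d.
Proof.
have inv y e : walk rad (5 * n + 2) y e ->
    y = 5 * n + 2 \/ Q <= e /\ (y = 5 * n + 3 -> 2 * Q <= e).
  { elim=> [|{}y z {}e w _ IH H]; first by left.
  have {}IH : y = 5 * n + 2 /\ true \/ Q <= e by case: IH => [|[]]; [left | right].
  rewrite /rad /= in H; split_edges; case: H => ? ? ?; subst y z w; edge_ranges G.
  all: right; split; lia. }
by move=> /inv[|[_]]; [lia | apply].
Qed.

(** The hub is entered only from sources and the sources only from the hub, so the set of all other
    vertices is closed under edges. These vertices have infinite eccentricity. *)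
Lemma no_centre y d : ~ (2 * n <= y < 3 * n) -> y != 5 * n + 2 ->
  ~ walk rad y (5 * n + 2) d.
Proof.
move=> y1 y2; have inv x e : walk rad y x e ->
    ~ (2 * n <= x < 3 * n) /\ x != 5 * n + 2.
  { elim=> [|{}x z {}e w _ [x1 x2] H]; first by split.
  rewrite /rad /= in H; split_edges; case: H => ? ? ?; subst x z w; edge_ranges G.
  all: split; lia. }
by move=> /inv[_]; rewrite eqxx.
Qed.

End Radius.

Lemma ex_ecc G (x : 'I_(nv G)) : exists r, is_ecc x r.
Proof.
have /boolp.choice[d dP] (y : 'I_(nv G)) := ex_min_value (simple_path x y) (weight x).
by eexists; exists d.
Qed.

Lemma ecc_walk G (x : 'I_(nv G)) k : is_ecc x (Some k) ->
  forall y, y < nv G -> exists2 d, walk (edge G) x y d &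
    d <= k /\ forall d', walk (edge G) x y d' -> d <= d'.
Proof.
move=> [d dP]; case: forallP => // dN [->] y yN.
have := dN (Ordinal yN); case E: (d (Ordinal yN)) => [dy|] // _.
have := is_dist_walk (dP (Ordinal yN)); rewrite E => -[W dmin]; exists dy => //.
by split=> //; have := @leq_bigmax 'I_(nv G) (fun y => odflt 0 (d y)) (Ordinal yN); rewrite E.
Qed.

Lemma ecc_le G (x : 'I_(nv G)) r K : is_ecc x r ->
  (forall y, y < nv G -> exists2 d, walk (edge G) x y d & d <= K) ->
  exists2 k, r = Some k & k <= K.
Proof.
move=> [d dP ->] H.
have dy y : exists2 k, d y = Some k & k <= K.
  have [k W kK] := H y (ltn_ord y); have := is_dist_walk (dP y).
  case: (d y) => [k'|] /=; last by move=> /(_ k).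
  by move=> [_ /(_ k W) k'k]; exists k' => //; exact: leq_trans kK.
case: forallP => [_|[]y]; last by have [k ->] := dy y.
exists (\max_y odflt 0 (d y)) => //; apply/bigmax_leqP => y _.
by have [k ->] := dy y.
Qed.

Section RadiusInstance.
Variables G G' : digraph.
Local Notation n := (nv G).
Local Notation Q := (heavy G).
Hypothesis n_gt0 : 0 < n.
Hypothesis nvG' : nv G' = 5 * n + 4.
Hypothesis edgesG' : nedges G' = collect (radius_families G).
Variable d : option nat.
Hypothesis min_d : is_min_cycle_weight G d.

Lemma rad_edge u v w : edge G' u v w <-> rad G u v w.
Proof. by rewrite /edge edgesG'; split=> /collectP. Qed.

Lemma rad_walk x y k : walk (edge G') x y k <-> walk (rad G) x y k.
Proof. by split; apply: walk_sub => u v w /rad_edge. Qed.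

Lemma odflt_min_le : odflt Q d <= Q.
Proof. by move: min_d; case: d => //= k /is_min_cycle_weight_least/min_cycle_heavy/ltnW. Qed.

Lemma odflt_min_cycle v k : closed_walk (edge G) v k -> odflt Q d <= k.
Proof.
move=> vk; have := is_min_cycle_weight_least min_d; case: d => [k0|] /=.
  by move=> [_]; apply; exists v.
by move=> /(_ k)[]; exists v.
Qed.

Lemma ecc_lower (x : 'I_(nv G')) k : is_ecc x (Some k) -> Q + odflt Q d <= k.
Proof.
have QQ := odflt_min_le; move=> /ecc_walk H.
have [xh|xh] := eqVneq (val x) (5 * n + 2).
  have [|e /rad_walk] := H (5 * n + 3); first by rewrite nvG'; lia.
  by rewrite -[nat_of_ord x]/(val x) xh => /(hub_lower n_gt0) ? [? _]; lia.
case: (boolP (2 * n <= val x < 3 * n)) => [xs|xs]; last first.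
  have [|e /rad_walk W] := H (5 * n + 2); first by rewrite nvG'; lia.
  by case: (@no_centre G n_gt0 (val x) e); rewrite ?xs //; apply/negP.
have [|e /rad_walk W [ek _]] := H (n + (x - 2 * n)).
  by move: xs nvG' => /=; lia.
have xE : nat_of_ord x = 2 * n + (x - 2 * n) by move: xs => /=; lia.
rewrite {1}xE in W.
have [|?|[k0 /odflt_min_cycle ? ?]] := source_lower n_gt0 _ W; try lia.
by move: xs => /=; lia.
Qed.

Lemma ecc_upper v k r : closed_walk (edge G) v k ->
  forall x : 'I_(nv G'), val x = 2 * n + v -> is_ecc x r ->
  exists2 K, r = Some K & K <= Q + k.
Proof.
move=> vk x xv /ecc_le; apply=> y yN; have yN' : y < 5 * n + 4 by rewrite -nvG'.
have [e W eK] := source_upper n_gt0 vk yN'.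
by exists e => //; apply/rad_walk; rewrite -[nat_of_ord x]/(val x) xv.
Qed.

Lemma eccentricities_reveals l :
  answer (p := eccentricities) G' l -> reveals Q Q l d.
Proof.
move=> [r rP ->]; split=> [e /mapP[x _ ->]|k dk].
  by have := rP x; case: (r x) => //= K /ecc_lower.
have := is_min_cycle_weight_least min_d; rewrite dk => -[[v vk] _].
have vn := closed_walk_bound vk; have xN : 2 * n + v < nv G' by rewrite nvG'; lia.
have [K rK Kk] := ecc_upper vk (erefl (val (Ordinal xN))) (rP (Ordinal xN)).
apply/mapP; exists (Ordinal xN); first by rewrite mem_enum.
rewrite rK /=; congr S; apply/eqP; rewrite eqn_leq Kk andbT.
by have := rP (Ordinal xN); rewrite rK => /ecc_lower; rewrite dk.
Qed.

Lemma radius_reveals l : answer (p := radius) G' l -> reveals Q Q l d.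
Proof.
move=> [r [o oP ->] ->]; split=> [e|k dk]; rewrite inE.
  by move=> /eqP->; case: o oP => //= K [[x xK] _] _; exact: ecc_lower xK.
have := is_min_cycle_weight_least min_d; rewrite dk => -[[v vk] _].
have vn := closed_walk_bound vk; have xN : 2 * n + v < nv G' by rewrite nvG'; lia.
have [r' r'P] := ex_ecc (Ordinal xN).
have [K rK Kk] := ecc_upper vk (erefl (val (Ordinal xN))) r'P.
have xK : exists x : 'I_(nv G'), is_ecc x (Some K) by exists (Ordinal xN); rewrite -rK.
case: o oP => [K0 [[x xK0] /(_ K xK) K0K]|/(_ K)//] /=.
rewrite eqSS eqn_leq (leq_trans K0K Kk) andbT.
by have := ecc_lower xK0; rewrite dk.
Qed.

End RadiusInstance.

Lemma ansc_reveals G d l :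
  is_min_cycle_weight G d -> answer (p := ansc) G l -> reveals 0 (heavy G) l d.
Proof.
move=> min_d [r rP ->]; split=> [e /mapP[x _ ->]|k dk].
  have := rP x; case: (r x) => //= k [[p [/simple_cycle_walk W _]|//] [->]] _.
  rewrite add0n ltnS; exact (odflt_min_cycle min_d W).
have [o oP oE] := min_d; rewrite dk in oE.
case: o oP oE => [[x p]|//] [/= xp pmin] [kE].
apply/mapP; exists x; first by rewrite mem_enum.
rewrite add0n; have [[q|] qP rE] := rP x; last by case: (qP _ xp).
rewrite rE /= kE; congr S; apply/eqP; rewrite eqn_leq (pmin (x, q) qP.1) /=.
exact: qP.2.
Qed.

(** * Isolation by random weights *)

Lemma reweight_uniq G (f : 'I_(nv G) * 'I_(nv G) * nat -> nat) :
  uniq [seq e.1 | e <- [seq (e.1, f e) | e <- edges G]].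
Proof. by rewrite -map_comp; exact: edges_uniq. Qed.

Lemma reweight_loopless G (f : 'I_(nv G) * 'I_(nv G) * nat -> nat) :
  all (fun e => e.1.1 != e.1.2) [seq (e.1, f e) | e <- edges G].
Proof. by rewrite all_map; exact: edges_loopless. Qed.

Definition reweight G (f : 'I_(nv G) * 'I_(nv G) * nat -> nat) : digraph :=
  Digraph (reweight_uniq f) (reweight_loopless f).

Section Reweight.
Variable G : digraph.
Local Notation V := 'I_(nv G).

Lemma ne_reweight f : ne (@reweight G f) = ne G.
Proof. exact: size_map. Qed.

Lemma arc_reweight f (u v : V) : @arc (reweight f) u v = arc u v.
Proof. by rewrite /arc /= -map_comp. Qed.

Lemma simple_path_reweight f (s t : V) p :
  @simple_path (reweight f) s t p = simple_path s t p.
Proof. by rewrite /simple_path (eq_path (e' := @arc G)) //; exact: arc_reweight. Qed.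

Lemma wt_reweight f (u v : V) :
  arc u v -> @wt (reweight f) u v = f (u, v, wt u v).
Proof.
move=> /arc_wt uv; apply: (@wt_edge (reweight f)).
by apply/mapP; exists (u, v, wt u v).
Qed.

Lemma weight_reweight f (x : V) p : path (@arc G) x p ->
  @weight (reweight f) x p = \sum_(e <- consecutive x p) f (e, wt e.1 e.2).
Proof.
move=> xp; rewrite /weight big_seq [RHS]big_seq; apply: eq_bigr => -[u v] e_p.
by rewrite wt_reweight //; exact: path_consecutive xp e_p.
Qed.

Lemma consecutive_uniq (x : V) p : uniq (x :: p) -> uniq (consecutive x p).
Proof.
elim: p x => //= a p IH x /andP[xp up]; rewrite (IH a up) andbT.
by apply/negP => /mem_consecutive[/= x_p _]; rewrite x_p in xp.
Qed.

Section Scale.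
Variables (S N : nat) (r : V * V -> nat).
Hypothesis r_lt : forall e, r e < N.
Hypothesis S_ge : nv G * N <= S.

Definition perturb (e : V * V * nat) : nat := e.2 * S + r e.1.

Lemma weight_perturb (x : V) p : path (@arc G) x p ->
  @weight (reweight perturb) x p =
  weight x p * S + \sum_(e <- consecutive x p) r e.
Proof.
move=> xp; rewrite weight_reweight // /perturb /= big_split /= -big_distrl /=.
by congr (_ * S + _); apply: eq_bigr => -[].
Qed.

Lemma weight_perturb_ge (x : V) p : path (@arc G) x p ->
  weight x p * S <= @weight (reweight perturb) x p.
Proof. by move=> /weight_perturb->; exact: leq_addr. Qed.

(** A simple path has fewer than [nv G] edges, so its noise adds up to less than nv G * N <= S and
    cannot outweigh a difference of 1 in the original weights. *)
Lemma weight_perturb_lt (s t : V) p : simple_path s t p ->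
  @weight (reweight perturb) s p < (weight s p).+1 * S.
Proof.
move=> /and3P[sp _ up]; rewrite weight_perturb // mulSn addnC ltn_add2r.
have small (q : seq (V * V)) : \sum_(e <- q) r e <= size q * N.
  elim: q => [|e q IH]; first by rewrite big_nil.
  by rewrite big_cons mulSn leq_add // ltnW.
have N0 : 0 < N := leq_ltn_trans (leq0n _) (r_lt (s, s)).
apply: leq_ltn_trans (small _) (leq_trans _ S_ge).
rewrite ltn_pmul2r // /consecutive size_zip /= (minn_idPr _) //.
by have := max_card (mem (s :: p)); rewrite (card_uniqP up) card_ord.
Qed.

End Scale.
End Reweight.

Definition bits (u : seq bool) : nat := foldl (fun r (b : bool) => 2 * r + b) 0 u.

Lemma bits_lt u : bits u < 2 ^ size u.
Proof.
elim/last_ind: u => // u b IH; rewrite /bits foldl_rcons -/(bits u) size_rcons expnS.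
by case: b => /=; lia.
Qed.

Lemma bits_inj u v : size u = size v -> bits u = bits v -> u = v.
Proof.
elim/last_ind: u v => [[] //|u b IH v]; case/lastP: v => [|v c].
  by rewrite size_rcons.
rewrite !size_rcons => -[uv]; rewrite /bits !foldl_rcons -/(bits u) -/(bits v) => e.
have bc : b = c by case: b c e => [] [] /=; lia.
by rewrite bc; congr rcons; apply: IH => //; rewrite bc /= in e; lia.
Qed.

Definition block (b i : nat) (u : seq bool) : seq bool := take b (drop (b * i) u).

Lemma size_block b i M u : size u = b * M -> i < M -> size (block b i u) = b.
Proof.
move=> uM iM; rewrite size_take size_drop uM -mulnBr; case: ltnP => // h.
by apply/eqP; rewrite eqn_leq h /= leq_pmulr // subn_gt0.
Qed.

(** If the other blocks leave at most one value for block i, then replacing that block by all 2 ^ b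
    values, for all members of [X], yields distinct sequences; there are at most 2 ^ (b * M) of
    them. *)
Lemma cnt_block b i M (X : seq bool -> Prop) : i < M ->
  (forall u v, size u = b * M -> size v = b * M -> X u -> X v ->
     take (b * i) u = take (b * i) v -> drop (b * i + b) u = drop (b * i + b) v ->
     u = v) ->
  cnt (b * M) X * 2 ^ b <= 2 ^ (b * M).
Proof.
move=> iM Xinj; set L := b * M; pose l := b * i.
have lL : l + b <= L by rewrite /l /L addnC -mulnS leq_mul2l iM orbT.
pose put (u x : seq bool) := take l u ++ x ++ drop (l + b) u.
pose goods := [seq u <- words L | `[< X u >]].
have sz : size [seq put u x | u <- goods, x <- words b] = cnt L X * 2 ^ b.
  by rewrite size_allpairs size_words /goods size_filter.
rewrite -sz -size_words; apply: uniq_leq_size.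
  apply: allpairs_uniq; rewrite ?filter_uniq ?uniq_words //.
  move=> [u x] [v y] /allpairsP[[u' x'] /= [+ + [-> ->]]] /allpairsP[[v' y'] /= [+ + [-> ->]]].
  rewrite !mem_filter !mem_words => /andP[/asboolP Xu /eqP uL] /eqP xb.
  move=> /andP[/asboolP Xv /eqP vL] /eqP yb.
  have tl w : size w = L -> size (take l w) = l.
    by move=> wL; rewrite size_takel // wL; lia.
  rewrite /put => /eqP; rewrite eqseq_cat ?tl // eqseq_cat ?xb ?yb //.
  by move=> /and3P[/eqP h1 /eqP-> /eqP h2]; rewrite (Xinj u' v').
move=> _ /allpairsP[[u x] /= [+ + ->]]; rewrite mem_filter !mem_words.
move=> /andP[_ /eqP uL] /eqP xb; rewrite !size_cat size_drop xb uL size_takel ?uL; lia.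
Qed.

Lemma cnt_union T (I : finType) (X : seq bool -> Prop) (Y : I -> seq bool -> Prop) :
  (forall u, size u = T -> X u -> exists i, Y i u) ->
  cnt T X <= \sum_i cnt T (Y i).
Proof.
move=> XY; have : all (fun u => size u == T) (words T).
  by apply/allP => u; rewrite mem_words.
rewrite /cnt; elim: (words T) => //= u l IH /andP[/eqP uT /IH].
rewrite big_split /=; apply: leq_add; case: asboolP => // /(XY _ uT)[i Yi].
by rewrite (bigD1 i) //= asboolT.
Qed.

Section Isolation.
Variable G : digraph.
Local Notation V := 'I_(nv G).
Local Notation M := (ne G).
Variables (b S : nat).

Definition edge_rank (e : V * V) : nat := index e [seq e.1 | e <- edges G].

Definition noise (u : seq bool) (e : V * V) : nat := bits (block b (edge_rank e) u).

Definition noisy (u : seq bool) : digraph := reweight (perturb S (noise u)).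

(* For fixed bits of the other edges, only one value of the noise of e can make
   a lightest path through e as light as a lightest path avoiding e. *)
Lemma noisy_ambiguous (s t : V) (e : V * V) : edge_rank e < M ->
  cnt (b * M) (fun u => exists p q,
    [/\ @shortest_path (noisy u) s t p, @shortest_path (noisy u) s t q,
        e \in consecutive s p & e \notin consecutive s q]) * 2 ^ b <= 2 ^ (b * M).
Proof.
move=> eM; apply: cnt_block (eM) _ => u v uM vM.
move=> [p [q [[sp pmin] [sq qmin] e_p e_q]]] [p' [q' [[sp' pmin'] [sq' qmin'] e_p' e_q']]].
set i := edge_rank e => tk dr.
rewrite simple_path_reweight in sp; rewrite simple_path_reweight in sq.
rewrite simple_path_reweight in sp'; rewrite simple_path_reweight in sq'.
have bl j : j != i -> block b j u = block b j v.
  rewrite neq_ltn => /orP[ji|ij].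
    have bb : b * j + b <= b * i by rewrite addnC -mulnS leq_mul2l ji orbT.
    have dd w : size w = b * M -> block b j w = take b (drop (b * j) (take (b * i) w)).
      move=> wM; have iL : b * i <= size w by rewrite wM leq_mul2l (ltnW eM) orbT.
      rewrite /block -{1}[w](cat_take_drop (b * i)) drop_cat size_takel //.
      case: ltnP => [_|h]; last first.
        by have b0 : b = 0; [lia | rewrite b0 !take0].
      by rewrite takel_cat // size_drop size_takel //; lia.
    by rewrite !dd // tk.
  have bb : b * i + b <= b * j by rewrite addnC -mulnS leq_mul2l ij orbT.
  have dd w : drop (b * j) w = drop (b * j - (b * i + b)) (drop (b * i + b) w).
    by rewrite drop_drop subnK.
  by rewrite /block !dd dr.
have rank_inj e1 : arc e1.1 e1.2 -> edge_rank e1 = i -> e1 = e.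
  rewrite /arc -surjective_pairing => e1_in e1i.
  have e_in : e \in [seq e.1 | e <- edges G] by rewrite -index_mem size_map.
  have := nth_index e e1_in; rewrite -/(edge_rank e1) e1i => <-.
  exact: nth_index.
have noiseE (x y : V) p0 : path (@arc G) s p0 -> forall e1,
    e1 \in consecutive s p0 -> e1 != e -> noise u e1 = noise v e1.
  move=> sp0 e1 e1_p e1e; rewrite /noise bl //; apply: contraNneq e1e => e1i.
  by apply/eqP/rank_inj => //; exact: path_consecutive sp0 e1_p.
have same q0 : simple_path s t q0 -> e \notin consecutive s q0 ->
    @weight (noisy u) s q0 = @weight (noisy v) s q0.
  move=> /and3P[sq0 _ _] eq0; rewrite !weight_perturb //; congr (_ + _).
  rewrite !big_seq; apply: eq_bigr => e1 e1_q; apply: (noiseE s t q0) => //.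
  by apply: contraNneq eq0 => <-.
have differ p0 : simple_path s t p0 -> e \in consecutive s p0 ->
    @weight (noisy u) s p0 + noise v e = @weight (noisy v) s p0 + noise u e.
  move=> /and3P[sp0 _ up0] ep0; rewrite !weight_perturb //.
  have uc := consecutive_uniq up0.
  rewrite !(bigD1_seq e ep0 uc) /=.
  suff -> : \sum_(e1 <- consecutive s p0 | e1 != e) noise u e1 =
            \sum_(e1 <- consecutive s p0 | e1 != e) noise v e1 by lia.
  rewrite big_seq_cond [RHS]big_seq_cond; apply: eq_bigr => e1 /andP[e1_p e1e].
  exact: (noiseE s t p0).
(* From [u] to [v] the paths avoiding [e] keep their weights and all paths through [e] shift by the
   same amount. The two minima tie for [u] as well as for [v], so the shift is 0. *)
have noise_e : noise u e = noise v e.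
  have := differ _ sp e_p; have := differ _ sp' e_p'.
  have := same _ sq e_q; have := same _ sq' e_q'.
  have := pmin q; have := pmin q'; have := pmin p'.
  have := pmin' q; have := pmin' q'; have := pmin' p.
  have := qmin p; have := qmin q'; have := qmin' p'; have := qmin' q.
  rewrite !simple_path_reweight.
  do ![move=> /(_ ltac:(assumption)) ?]; lia.
have be : block b i u = block b i v.
  by apply: bits_inj => //; rewrite !(size_block (M := M)).
rewrite -[u](cat_take_drop (b * i)) -[v](cat_take_drop (b * i)) tk.
rewrite -(cat_take_drop b (drop (b * i) u)) -(cat_take_drop b (drop (b * i) v)).
by rewrite -/(block b i u) -/(block b i v) be !drop_drop [b + _]addnC dr.
Qed.

(** There are n^2 pairs of endpoints and at most n^2 edges, hence at most n^4 ambiguous events, each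
    of probability at most 2^-b; the fifth factor n leaves 1/n. *)
Lemma noisy_unique : 2 ^ b >= nv G ^ 5 ->
  nv G * cnt (b * M) (fun u => ~ unique_shortest_paths (noisy u)) <= 2 ^ (b * M).
Proof.
move=> b5; set C := cnt _ _.
pose Y (i : V * V * 'I_M) (u : seq bool) := exists p q,
    [/\ @shortest_path (noisy u) i.1.1 i.1.2 p,
        @shortest_path (noisy u) i.1.1 i.1.2 q,
        nth i.1 [seq e.1 | e <- edges G] i.2 \in consecutive i.1.1 p &
        nth i.1 [seq e.1 | e <- edges G] i.2 \notin consecutive i.1.1 q].
have CY : C <= \sum_i cnt (b * M) (Y i).
  apply: cnt_union => u _ nu; apply: contrapT => nY; apply: nu => s t p q ps qs.
  apply: contrapT => pq; have [sp _] := ps; have [sq _] := qs.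
  rewrite !simple_path_reweight in sp sq.
  case: (boolP (all (mem (consecutive s q)) (consecutive s p))) => [/allP sub|].
    by apply: pq; exact: simple_path_sub sp sq sub.
  rewrite -has_predC => /hasP[e e_p e_q]; apply: nY.
  have e_in : e \in [seq e.1 | e <- edges G].
    have /and3P[sp' _ _] := sp; have := path_consecutive sp' e_p.
    by rewrite /arc -surjective_pairing.
  have eM : edge_rank e < M by rewrite /edge_rank -index_mem size_map in e_in *.
  exists (s, t, Ordinal eM), p, q; rewrite /= nth_index //.
have Yle i : cnt (b * M) (Y i) * 2 ^ b <= 2 ^ (b * M).
  have iM : i.2 < size [seq e.1 | e <- edges G] by rewrite size_map.
  apply: noisy_ambiguous.
  by rewrite /edge_rank index_uniq ?edges_uniq // size_map in iM *.
have MN : M <= nv G ^ 2.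
  have := max_card (mem [seq e.1 | e <- edges G]).
  by rewrite (card_uniqP (edges_uniq G)) card_prod card_ord size_map.
have : C * 2 ^ b <= nv G ^ 4 * 2 ^ (b * M).
  apply: leq_trans (leq_mul CY (leqnn _)) _; rewrite big_distrl /=.
  apply: (@leq_trans (\sum_(i : V * V * 'I_M) 2 ^ (b * M))).
    by apply: leq_sum => i _; exact: Yle.
  rewrite sum_nat_const !card_prod !card_ord leq_mul2r; apply/orP; right.
  by rewrite (expnD _ 2 2); apply: leq_mul.
have [-> _|n0] := posnP (nv G); first by rewrite mul0n.
move=> H; have : nv G ^ 4 * (nv G * C) <= nv G ^ 4 * 2 ^ (b * M).
  rewrite mulnA -expnSr; apply: leq_trans _ H.
  by rewrite mulnC leq_mul2l b5 orbT.
by rewrite leq_pmul2l // expn_gt0 n0.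
Qed.

End Isolation.

(** * The betweenness graph *)

Section Between.
Variable G : digraph.
Local Notation n := (nv G).
Local Notation m := (ne G).
Hypothesis n_gt0 : 0 < n.
Variables l pad : nat.

(* As in the graph for the radius, but 5n + 2 now offers the way of length
   2l + 1 from the source of v to n + v, and all lengths in G are doubled to
   avoid ties.  The vertices from 5n + 3 on are padding. *)
Definition between_families : seq edge_family :=
  [:: (m, fun i => (src G i, dst G i, 2 * cost G i));
      (m, fun i => (src G i, n + dst G i, 2 * cost G i));
      (n, fun j => (2 * n + j, j, 0));
      (n, fun j => (2 * n + j, 3 * n + j, 0));
      (n, fun j => (2 * n + j, 4 * n + j + 2, 0));
      (n, fun j => (2 * n + j, 5 * n + 2, 2 * l + 1));
      (n, fun j => (3 * n + j + 1, 3 * n + j, 0));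
      (n, fun j => (3 * n + j + 1, n + j, 0));
      (n, fun j => (4 * n + j + 1, 4 * n + j + 2, 0));
      (n, fun j => (4 * n + j + 1, n + j, 0));
      (n, fun j => (5 * n + 2, n + j, 0));
      (pad, fun j => (5 * n + 3 + j, 5 * n + 4 + j, 0))].

Lemma between_graph : exists G',
  nv G' = 5 * n + 4 + pad /\ nedges G' = collect between_families.
Proof.
apply: make_graph.
{ apply/allP => e /collectP /= H; split_edges; subst e => /=; edge_ranges G.
  all: by apply/and3P; split; lia. }
by rewrite /between_families; edges_disjoint G.
Qed.

Definition btw (u v w : nat) : Prop := collected between_families (u, v, w).

Lemma btw_down a b : b <= a <= n -> walk btw (3 * n + a) (3 * n + b) 0.
Proof.
move=> /andP[]; elim: a => [|a IH] ba an.
  by move: ba; rewrite leqn0 => /eqP->; exact: walk_nil.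
have [->|ab] := eqVneq b a.+1; first exact: walk_nil.
rewrite -[0]addn0; apply: (@walk_cat _ _ (3 * n + a)); last by apply: IH; lia.
apply: walk_edge; do 6 right; left; exists a => //=.
by congr (_, _, _); lia.
Qed.

Lemma btw_up a b : a <= b <= n -> walk btw (4 * n + a + 1) (4 * n + b + 1) 0.
Proof.
move=> /andP[]; elim: b => [|b IH] ab bn.
  by move: ab; rewrite leqn0 => /eqP->; exact: walk_nil.
have [->|ab'] := eqVneq a b.+1; first exact: walk_nil.
rewrite -[0]addn0; apply: (@walk_rcons _ _ (4 * n + b + 1)); first by apply: IH; lia.
do 8 right; left; exists b => //=.
by congr (_, _, _); lia.
Qed.

Lemma btw_other u v : u < n -> v < n -> u != v -> walk btw (2 * n + v) (n + u) 0.
Proof.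
move=> un vn; rewrite neq_ltn => /orP[uv|uv].
- rewrite -[0]/(0 + (0 + 0)); apply: (@walk_cat _ _ (3 * n + v)).
    by apply: walk_edge; do 3 right; left; exists v.
  apply: (@walk_cat _ _ (3 * n + u.+1)); first by apply: btw_down; lia.
  apply: walk_edge; do 7 right; left; exists u => //=.
  by congr (_, _, _); lia.
rewrite -[0]/(0 + (0 + 0)); apply: (@walk_cat _ _ (4 * n + v.+1 + 1)).
  apply: walk_edge; do 4 right; left; exists v => //=.
  by congr (_, _, _); lia.
apply: (@walk_cat _ _ (4 * n + u + 1)); first by apply: btw_up; lia.
by apply: walk_edge; do 9 right; left; exists u.
Qed.

Lemma btw_closed v k : closed_walk (edge G) v k ->
  walk btw (2 * n + v) (n + v) (2 * k).
Proof.
move=> vk; have vn := closed_walk_bound vk; case: vk => [u [k' [w [vu uv ->]]]].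
rewrite mulnDr -[2 * k']add0n -addnA; apply: (@walk_cat _ _ v).
  by apply: walk_edge; do 2 right; left; exists v.
have [i im [us vs ws]] := edge_ith uv.
apply: (@walk_cat _ _ u); last first.
  apply: walk_edge; right; left; exists i => //=.
  by rewrite us ws vs.
elim: vu => [|y z d c _ IH /edge_ith[j jm [yj zj cj]]]; first exact: walk_nil.
rewrite mulnDr; apply: walk_rcons IH _; rewrite yj zj cj.
by left; exists j.
Qed.

Definition between_inv (v y d : nat) : Prop :=
  [\/ [|| y == 2 * n + v, 3 * n <= y <= 3 * n + v | 4 * n + v + 1 < y <= 5 * n + 1],
      y < n /\ (exists2 k, walk (edge G) v y k & 2 * k <= d),
      n <= y < 2 * n /\ y != n + v |
      y = n + v /\ exists2 k, closed_walk (edge G) v k & 2 * k <= d].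

(** Without the hub, the chains entered from the source of v lead only to the copies n + u with u
    different from v, and no edge leaves any n + u. So the walk goes through G and closes there at
    v. *)
Lemma btw_lower v d : v < n ->
  walk (fun x y w => btw x y w /\ y <> 5 * n + 2) (2 * n + v) (n + v) d ->
  exists2 k, closed_walk (edge G) v k & 2 * k <= d.
Proof.
move=> vn W; suff : between_inv v (n + v) d.
  by case=> [?|[? _]|[_ /eqP]|[_]] //; lia.
elim: W => [|y z {}d w _ IH [H zb]]; first by apply: Or41; rewrite eqxx.
case: IH => [first|[yn [k vy kd]]|[yn yv]|[yv _]].
{ rewrite /btw /= in H; split_edges; case: H => ? ? ?; subst y z w; edge_ranges G.
  all: try by exfalso; lia.
  all: try by apply: Or41; lia.
  all: try by apply: Or43; split; lia.
  apply: Or42; split; first by lia.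
  have -> : i = v by lia.
  by exists 0 => //; exact: walk_nil. }
{ rewrite /btw /= in H; split_edges; case: H => ? ? ?; subst y z w; edge_ranges G.
  all: try by exfalso; lia.
    apply: Or42; split=> //; exists (k + cost G i); last by lia.
    by apply: walk_rcons vy _; exact: ith_edge.
  have [iv|iv] := eqVneq (dst G i) v; last by apply: Or43; split; lia.
  apply: Or44; split; first by rewrite iv.
  exists (k + cost G i); last by lia.
  by exists (src G i), k, (cost G i); split=> //; rewrite -iv; exact: ith_edge. }
{ rewrite /btw /= in H; split_edges; case: H => ? ? ?; subst y z w; edge_ranges G.
  all: by exfalso; lia. }
{ rewrite /btw /= in H; split_edges; case: H => ? ? ?; subst y z w; edge_ranges G.
  all: by exfalso; lia. }
Qed.

Variable G' : digraph.
Hypothesis nvG' : nv G' = 5 * n + 4 + pad.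
Hypothesis edgesG' : nedges G' = collect between_families.

Lemma between_nv_gt0 : 0 < nv G'. Proof. by rewrite nvG' addn4. Qed.

Definition bvtx (k : nat) : 'I_(nv G') := vtx (Ordinal between_nv_gt0) k.

Lemma val_bvtx k : k < 5 * n + 4 -> val (bvtx k) = k.
Proof. by move=> kn; rewrite val_vtx // nvG'; lia. Qed.

Lemma btw_edge u v w : edge G' u v w <-> btw u v w.
Proof. by rewrite /edge edgesG'; split=> /collectP. Qed.

Lemma btw_arc (u v : 'I_(nv G')) : arc u v -> btw u v (wt u v).
Proof. by move=> uv; apply/btw_edge/edgeP; exists u, v; split=> //; exact: arc_wt. Qed.

Lemma btw_bvtx u v w : btw u v w -> u < 5 * n + 4 -> v < 5 * n + 4 ->
  (bvtx u, bvtx v, w) \in edges G'.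
Proof.
move=> /btw_edge/edgeP[a [c [ua vc ac]]] un vn.
have -> : bvtx u = a by apply: val_inj; rewrite val_bvtx.
by have -> : bvtx v = c by apply: val_inj; rewrite val_bvtx.
Qed.

Variables (S N : nat) (r : 'I_(nv G') * 'I_(nv G') -> nat).
Hypothesis r_lt : forall e, r e < N.
Hypothesis S_ge : nv G' * N <= S.

Local Notation hub := (bvtx (5 * n + 2)).
Local Notation H := (reweight (perturb S r)).

Lemma walk_perturbed (s t : 'I_(nv G')) d p :
  walk btw s t d -> @shortest_path H s t p -> @weight H s p < d.+1 * S.
Proof.
move=> W [_ pmin]; have /walk_simple_path[t' [q [/val_inj <- sq qd]]] :
    walk (edge G') s t d by apply: walk_sub W => u v w /btw_edge.
apply: leq_ltn_trans (pmin q _) _; first by rewrite simple_path_reweight.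
apply: leq_trans (weight_perturb_lt r_lt S_ge sq) _.
by rewrite leq_mul2r ltnS qd orbT.
Qed.

(** The hub is entered only from sources, which have no incoming edge, and left only to vertices n +
    u, which have no outgoing edge. The path therefore has just two edges. *)
Lemma through_hub (s t : 'I_(nv G')) p :
  s != hub -> t != hub -> simple_path s t p -> hub \in p ->
  exists v u, [/\ v < n, u < n, s = bvtx (2 * n + v), t = bvtx (n + u) &
    weight s p = 2 * l + 1].
Proof.
move=> sh th /and3P[+ /eqP lp _] hp; case/splitPr: hp lp => p1 p2.
rewrite cat_path /= last_cat /= => lp /and3P[sp1 xh hp2].
have vh : val hub = 5 * n + 2 by rewrite val_bvtx //; lia.
have [v vn [lv wv]] : exists2 v, v < n &
    val (last s p1) = 2 * n + v /\ wt (last s p1) hub = 2 * l + 1.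
  { have := btw_arc xh; rewrite -[nat_of_ord hub]/(val hub) vh /btw /= => K.
  split_edges; case: K => ? ?; edge_ranges G.
  all: try by exfalso; lia.
  by exists i. }
have p1s : p1 = [::].
  case/lastP: p1 sp1 lv {xh wv} => // p1 c; rewrite rcons_path last_rcons => /andP[_ pc] cv.
  have := btw_arc pc; rewrite -[nat_of_ord c]/(val c) cv /btw /= => K.
  by split_edges; case: K => ? ?; edge_ranges G; lia.
rewrite {}p1s /= in lv wv xh *.
case: p2 lp hp2 => [/= ht|c p2 /= lp /andP[hc cp2]]; first by rewrite ht eqxx in th.
have [u un [cu wu]] : exists2 u, u < n & val c = n + u /\ wt hub c = 0.
  { have := btw_arc hc; rewrite -[nat_of_ord hub]/(val hub) vh /btw /= => K.
  split_edges; case: K => ? ?; edge_ranges G.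
  all: try by exfalso; lia.
  by exists i. }
have p2s : p2 = [::].
  case: p2 cp2 {lp} => // c' p2 /= /andP[cc' _].
  have := btw_arc cc'; rewrite -[nat_of_ord c]/(val c) cu /btw /= => K.
  by split_edges; case: K => ? ?; edge_ranges G; lia.
rewrite {}p2s /= in lp *; exists v, u; split=> //.
- by apply: val_inj; rewrite val_bvtx //; lia.
- by rewrite -lp; apply: val_inj; rewrite val_bvtx //; lia.
- by rewrite !weight_cons wv wu /weight big_nil !addn0.
Qed.

(** Only pairs formed by the source of v and n + v can count, and they do exactly if every closed
    walk at v is heavier than l. So k is n minus the number of v on a closed walk of weight at most
    l. *)
Lemma between_count (b : 'I_(nv G')) k : val b = 5 * n + 2 ->
  @is_betweenness H b k ->
  (k < n) <-> exists v d, closed_walk (edge G) v d /\ d <= l.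
Proof.
move=> vb; have bh : b = hub by apply: val_inj; rewrite val_bvtx //; lia.
rewrite {b vb}bh => -[A AP kA].
have S0 : 0 < S.
  apply: leq_trans S_ge; rewrite muln_gt0 between_nv_gt0.
  exact: leq_ltn_trans (r_lt (hub, hub)).
pose f (v : 'I_n) := (bvtx (2 * n + v), bvtx (n + v)).
have f_inj : injective f.
  move=> u v [/(congr1 val) + _]; have un := ltn_ord u; have vn := ltn_ord v.
  by rewrite !val_bvtx => [h||]; [apply: val_inj => /=|..]; lia.
have far (v : 'I_n) : f v \in A <-> forall d, closed_walk (edge G) v d -> l < d.
  have [un vn] : n + v < 5 * n + 4 /\ 2 * n + v < 5 * n + 4.
    by have := ltn_ord v; lia.
  have vlt := ltn_ord v.
  have hn : 5 * n + 2 < 5 * n + 4 by lia.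
  split.
    move=> /AP[sh th [p sp hp]] d vd; rewrite ltnNge; apply/negP => dl.
    have sp' : @simple_path G' (bvtx (2 * n + v)) (bvtx (n + v)) p.
      by have [] := sp; rewrite simple_path_reweight.
    have [_ [_ [_ _ _ _ wp]]] := through_hub sh th sp' hp.
    have W : walk btw (val (bvtx (2 * n + v))) (val (bvtx (n + v))) (2 * d).
      by rewrite !val_bvtx //; exact: btw_closed.
    have := walk_perturbed W sp; rewrite ltnNge => /negP; apply.
    have /and3P[pp _ _] := sp'.
    apply: leq_trans (weight_perturb_ge _ _ pp); rewrite wp leq_mul2r; lia.
  move=> vl; apply/AP.
  have neq x y : x < 5 * n + 4 -> y < 5 * n + 4 -> x != y -> bvtx x != bvtx y.
    by move=> xn yn; apply: contra => /eqP/(congr1 val); rewrite !val_bvtx // => /eqP.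
  split; [by apply: neq; lia | by apply: neq; lia |].
  set s := bvtx _; set t := bvtx _.
  have e1 : (s, hub, 2 * l + 1) \in edges G'.
    by apply: btw_bvtx => //; do 5 right; left; exists v.
  have e2 : (hub, t, 0) \in edges G'.
    by apply: btw_bvtx => //; do 10 right; left; exists v.
  have sq : @simple_path G' s t [:: hub; t].
    rewrite /simple_path /= (edge_arc e1) (edge_arc e2) eqxx !inE !negb_or /= !andbT.
    by rewrite !neq //; lia.
  have [d [o oP _]] := ex_min_value (@simple_path H s t) (@weight H s).
  case: o oP => [p pP|/(_ [:: hub; t])]; last by rewrite simple_path_reweight.
  exists p => //; apply: contraT => hp; have [sp pmin] := pP.
  rewrite simple_path_reweight in sp; have /and3P[pp /eqP lp up] := sp.
  have /btw_lower : walk (fun x y w => btw x y w /\ y <> 5 * n + 2)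
      (2 * n + v) (n + v) (@weight G' s p).
    rewrite -[2 * n + v](val_bvtx vn) -[n + v](val_bvtx un) -/s -/t -lp.
    pose F (e : 'I_(nv G') * 'I_(nv G')) := e.2 <> hub.
    apply: walk_sub (path_walk (F := F) pp _) => [x y w [a [c [-> -> ac Fc]]]|e].
      split; first by apply/btw_edge/edgeP; exists a, c.
      by move=> ch; apply: Fc; apply: val_inj; rewrite val_bvtx.
    by move=> /mem_consecutive[_ e2p] e2h; rewrite -e2h e2p in hp.
  (* The way around the hub weighs at least 2k' >= 2l + 2, a full unit more than 2l + 1, and the
     noise cannot bridge that. *)
  move=> /(_ (ltn_ord v))[k' /vl lk' k'p].
  have := pmin [:: hub; t]; rewrite simple_path_reweight => /(_ sq).
  rewrite leqNgt => /negP[]; apply: leq_trans (weight_perturb_lt r_lt S_ge sq) _.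
  apply: leq_trans (weight_perturb_ge _ _ pp).
  rewrite !weight_cons (wt_edge e1) (wt_edge e2) /weight big_nil leq_mul2r.
  by apply/orP; right; move: lk' k'p; rewrite /weight; lia.
have Af s t : (s, t) \in A -> exists v, (s, t) = f v.
  move=> /AP[sh th [p sp hp]].
  have sp' : @simple_path G' s t p by have [] := sp; rewrite simple_path_reweight.
  have [v [u [vn un sv tu wp]]] := through_hub sh th sp' hp.
  have [uv|uv] := eqVneq u v; first by exists (Ordinal vn); rewrite sv tu uv.
  (* Between different u and v the chains offer a way of weight 0, which beats the hub. *)
  have W : walk btw (val s) (val t) 0.
    by rewrite sv tu !val_bvtx; try lia; exact: btw_other.
  have := walk_perturbed W sp; rewrite ltnNge => /negP[].
  have /and3P[pp _ _] := sp'.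
  by apply: leq_trans (weight_perturb_ge _ _ pp); rewrite wp leq_mul2r; lia.
have AE : A = [set f v | v in [set v | f v \in A]].
  apply/setP => -[s t]; apply/idP/imsetP => [stA|[v]]; last by rewrite inE => + ->.
  by have [v fv] := Af s t stA; exists v => //; rewrite inE -fv.
rewrite kA AE card_imset //.
rewrite -[X in _ < X](card_ord n) -cardsT; split.
  move=> lt; have : ~~ ([set: 'I_n] \subset [set v | f v \in A]).
    by apply: contraL lt => /subset_leq_card; rewrite -leqNgt.
  case/subsetPn => v _; rewrite inE => /negP nA.
  apply: contrapT => nE; apply: nA; apply/far => d vd; rewrite ltnNge; apply/negP => dl.
  by apply: nE; exists v, d.
move=> [v [d [vd dl]]]; have vn := closed_walk_bound vd.
apply: proper_card; apply/properP; split; first exact: subsetT.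
exists (Ordinal vn); rewrite ?inE //; apply/negP => /far/(_ d vd).
by rewrite ltnNge dl.
Qed.

End Between.

(** * Sub-mn growth *)

Section Growth.
Local Open Scope ring_scope.
Import Order.TTheory GRing.Theory Num.Theory.
Variable R : realType.
Implicit Types (x y : R).

Lemma powR_ge1 x (e : R) : 1 <= x -> 0 <= e -> 1 <= x `^ e.
Proof. by move=> x1 e0; have := ler_powR x1 e0; rewrite powRr0. Qed.

(** From 2^k <= n follows k ln 2 <= ln n, while n^e = exp(e ln n) >= 1 + e ln n. *)
Lemma log_le_powR (e : R) : 0 < e -> exists2 D : R, 1 <= D &
  forall n : nat, (0 < n)%N -> (trunc_log 2 n).+1%:R <= D * n%:R `^ e.
Proof.
move=> e0; have l2 : 0 < ln 2 :> R by rewrite ln_gt0 // ltr1n.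
have c0 : 0 < e * ln 2 by exact: mulr_gt0.
exists (1 + (e * ln 2)^-1); first by rewrite lerDl invr_ge0 ltW.
move=> n n0; set k := trunc_log 2 n.
have n1 : 1 <= n%:R :> R by rewrite ler1n.
have kn : k%:R * (e * ln 2) <= n%:R `^ e.
  apply: (@le_trans _ _ (1 + e * ln n%:R)); last first.
    by rewrite /powR gt_eqF ?(lt_le_trans _ n1) //; exact: expR_ge1Dx.
  rewrite -[leLHS]add0r lerD // mulrCA ler_wpM2l ?(ltW e0) //.
  rewrite -ln_powR powR_mulrn // ler_ln ?posrE ?exprn_gt0 ?ltr0n //.
  by rewrite -natrX ler_nat trunc_logP.
rewrite -natr1 addrC mulrDl mul1r; apply: lerD; first by rewrite powR_ge1 // ltW.
by rewrite mulrC ler_pdivlMr.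
Qed.

(** The exponents of a sub-mn bound may be negative; the two-sided window on x' together with [|e|]
    covers both signs. *)
Lemma powR_window x x' k e : 0 < x -> 1 <= k -> x <= x' <= k * x ->
  x' `^ e <= k `^ `|e| * x `^ e.
Proof.
move=> x0 k1 /andP[xx' x'k]; have k0 : 0 <= k by exact: le_trans k1.
have x'0 : 0 < x' by exact: lt_le_trans xx'.
have [e0|e0] := leP 0 e.
  rewrite ger0_norm // -powRM ?(ltW x0) //.
  by apply: ge0_ler_powR; rewrite ?nnegrE ?(ltW x'0) ?mulr_ge0 ?(ltW x0).
apply: (@le_trans _ _ (x `^ e)); last first.
  by rewrite ler_peMl ?powR_ge0 // powR_ge1.
rewrite -[e]opprK !(powRN _ (- e)) lef_pV2 ?posrE ?powR_gt0 //.
by apply: ge0_ler_powR; rewrite ?nnegrE ?(ltW x0) ?(ltW x'0) // oppr_ge0 ltW.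
Qed.

Lemma powR_balance x y (a b A s : R) : 1 <= y -> y <= x -> a <= A -> a + b <= s ->
  x `^ a * y `^ b <= x `^ A * y `^ (s - A).
Proof.
move=> y1 yx aA abs; have y0 : 0 < y by exact: lt_le_trans y1.
have x0 : 0 < x by exact: lt_le_trans yx.
have -> : x `^ a = x `^ A * x `^ (a - A).
  by rewrite -powRD ?(gt_eqF x0) ?implybT // addrCA subrr addr0.
rewrite -mulrA ler_wpM2l ?powR_ge0 //.
apply: (@le_trans _ _ (y `^ (a - A) * y `^ b)).
  rewrite ler_wpM2r ?powR_ge0 // -opprB !powRN lef_pV2 ?posrE ?powR_gt0 //.
  by apply: ge0_ler_powR; rewrite ?nnegrE ?(ltW x0) ?(ltW y0) // subr_ge0.
rewrite -powRD ?(gt_eqF y0) ?implybT //; apply: ler_powR => //.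
by rewrite addrAC lerD2r.
Qed.

(* As n <= m, a bound m^alpha n^beta is at most m^A n^(s - A) for every A >= alpha
   and s >= alpha + beta; this absorbs the linear cost of the reduction, and the
   logarithmic factors only cost an arbitrarily small power of n. *)
Lemma sub_mn_blowup (g : nat -> nat -> R) (K p : nat) : sub_mn g ->
  exists2 g' : nat -> nat -> R, sub_mn g' & forall m n m' n' T' T : nat,
    (0 < n <= m)%N ->
    (n <= n' <= K * (trunc_log 2 n).+1 * n)%N ->
    (m <= m' <= K * (trunc_log 2 n).+1 * m)%N ->
    (n' <= m')%N -> T'%:R <= g m' n' ->
    (T <= K * (trunc_log 2 n).+1 ^ p * (m + T'))%N -> T%:R <= g' m n.
Proof.
move=> [al [be [C [ab2 gC]]]].
(* The maxima with 1 make m <= m^A n^(s - A), which pays for the linear cost. Half of the gap 2 - s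
   becomes the spare power [dl], and [q] collects all logarithms: [p] from the stated overhead, the
   rest from n' and m' exceeding n and m by a logarithmic factor. *)
pose s := Num.max (al + be) 1; pose A := Num.max al 1.
have s2 : s < 2 by rewrite /s gt_max ab2 ltr1n.
pose q : nat := (p + Num.truncn (`|al| + `|be|)).+1.
pose dl := (2 - s) / 2.
have dl0 : 0 < dl by rewrite divr_gt0 // subr_gt0.
have q0 : 0 < q%:R :> R by rewrite ltr0n.
have [D D1 logD] := log_le_powR (divr_gt0 dl0 q0).
pose K' := (K%:R : R).
pose F := (1 + `|C|) * K' * (1 + K') ^+ q * D ^+ q.
exists (fun m n => F * (m%:R `^ A * n%:R `^ (s - A + dl))).
  exists A, (s - A + dl), F; split=> //.
  rewrite addrA addrCA subrr addr0 /dl.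
  by rewrite -ltrBrDl ltr_pdivrMr // ltr_pMr ?subr_gt0 // ltr1n.
move=> m n m' n' T' T /andP[n0 nm] /andP[nn' n'K] /andP[mm' m'K] n'm' T'g TK.
set L := (trunc_log 2 n).+1 in n'K m'K TK *; pose l := (L%:R : R).
have K0 : (0 < K)%N by case: (K) n'K => // ; rewrite !mul0n => h; lia.
have K1 : 1 <= K' by rewrite ler1n.
have l1 : 1 <= l by rewrite ler1n.
have n1 : 1 <= n%:R :> R by rewrite ler1n.
have mn : n%:R <= m%:R :> R by rewrite ler_nat.
have m1 : 1 <= m%:R :> R := le_trans n1 mn.
have kl1 : 1 <= K' * l by rewrite mulr_ege1.
have n'0 : (0 < n' <= m')%N by rewrite n'm' (leq_trans n0 nn').
pose M := m%:R `^ A * n%:R `^ (s - A) : R.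
have M0 : 0 <= M by rewrite mulr_ge0 ?powR_ge0.
have mM : m%:R <= M.
  have := @powR_balance m%:R n%:R 1 0 A s n1 mn _ _.
  by rewrite powRr1 // powRr0 mulr1; apply; rewrite ?addr0 le_max lexx orbT.
have T'M : T'%:R <= `|C| * (K' * l) ^+ (Num.truncn (`|al| + `|be|)).+1 * M.
  apply: le_trans T'g (le_trans (gC _ _ n'0) _).
  apply: (@le_trans _ _ (`|C| * (m'%:R `^ al * n'%:R `^ be))).
    by rewrite ler_wpM2r ?mulr_ge0 ?powR_ge0 // ler_norm.
  rewrite -mulrA ler_wpM2l //.
  have m'w : m'%:R `^ al <= (K' * l) `^ `|al| * m%:R `^ al.
    apply: powR_window => //; first exact: lt_le_trans m1.
    by rewrite ler_nat mm' /K' /l -!natrM ler_nat.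
  have n'w : n'%:R `^ be <= (K' * l) `^ `|be| * n%:R `^ be.
    apply: powR_window => //; first exact: lt_le_trans n1.
    by rewrite ler_nat nn' /K' /l -!natrM ler_nat.
  apply: le_trans (ler_pM (powR_ge0 _ _) (powR_ge0 _ _) m'w n'w) _.
  rewrite mulrACA; apply: ler_pM; rewrite ?mulr_ge0 ?powR_ge0 //.
    rewrite -powRD; last by rewrite (gt_eqF (lt_le_trans _ kl1)) ?implybT.
    rewrite -powR_mulrn ?(le_trans _ kl1) //; apply: ler_powR => //.
    by rewrite ltW // real_truncnS_gt ?num_real.
  by apply: powR_balance => //; rewrite le_max lexx.
have TT : T%:R <= K' * l ^+ p * (m%:R + T'%:R).
  by rewrite /K' /l -natrX -natrD -!natrM ler_nat.
apply: le_trans TT _.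
set j := (Num.truncn _).+1 in T'M *.
have j1 : 1 <= (K' * l) ^+ j by rewrite exprn_ege1.
have {T'M} sumM : m%:R + T'%:R <= (1 + `|C|) * (K' * l) ^+ j * M.
  rewrite mulrDl mulrDl mul1r; apply: lerD => //.
  by apply: le_trans mM _; rewrite ler_peMl.
have lq : l ^+ q <= D ^+ q * n%:R `^ dl.
  have -> : n%:R `^ dl = (n%:R `^ (dl / q%:R)) ^+ q.
    by rewrite -powR_mulrn ?powR_ge0 // -powRrM divfK // gt_eqF.
  rewrite -exprMn; apply: lerXn2r; rewrite ?nnegrE ?mulr_ge0 ?powR_ge0 ?ler0n //.
    exact: le_trans D1.
  exact: logD.
apply: (@le_trans _ _ (K' * l ^+ p * ((1 + `|C|) * (K' * l) ^+ j * M))).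
  by rewrite ler_wpM2l // mulr_ge0 ?exprn_ge0 ?ler0n.
have -> : K' * l ^+ p * ((1 + `|C|) * (K' * l) ^+ j * M) =
    ((1 + `|C|) * K' * K' ^+ j) * l ^+ q * M.
  by rewrite exprMn /q -addnS exprD -/j; ring.
have -> : F * (m%:R `^ A * n%:R `^ (s - A + dl)) =
    ((1 + `|C|) * K' * (1 + K') ^+ q) * (D ^+ q * n%:R `^ dl) * M.
  by rewrite powRD ?(gt_eqF (lt_le_trans _ n1)) ?implybT // /F /M; ring.
rewrite ler_wpM2r //; apply: ler_pM => //.
- by rewrite !mulr_ge0 ?exprn_ge0 ?addr_ge0 ?ler0n.
- by rewrite exprn_ge0.
rewrite ler_wpM2l //; first by rewrite mulr_ge0 ?addr_ge0 ?ler0n.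
apply: (@le_trans _ _ ((1 + K') ^+ j)).
  by apply: lerXn2r; rewrite ?nnegrE ?addr_ge0 ?ler0n // lerDr.
by apply: ler_weXn2l; rewrite ?lerDl ?ler0n // /q -addnS leq_addl.
Qed.

End Growth.

(** * Reductions that read a single list *)

Lemma triples_cat E E' : triples (E ++ E') = triples E ++ triples E'.
Proof. by rewrite /triples map_cat flatten_cat. Qed.

Lemma built_cat s fs fs' : built s (fs ++ fs') = built s fs ++ built s fs'.
Proof. by rewrite /built map_cat flatten_cat. Qed.

Definition arcs_cmd : Type := expr * (expr * expr * expr).

Definition arcs_loop (F : arcs_cmd) : emit_loop :=
  (F.1, [:: F.2.1.1; F.2.1.2; F.2.2]).

Fixpoint spells (s : store) (Ps : seq arcs_cmd) (Fs : seq edge_family) : Prop :=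
  match Ps, Fs with
  | [::], [::] => True
  | P :: Ps', F :: Fs' =>
      (value s P.1 = F.1 /\ forall i, i < F.1 ->
        (value (at_index s i) P.2.1.1, value (at_index s i) P.2.1.2,
         value (at_index s i) P.2.2) = F.2 i) /\
      spells s Ps' Fs'
  | _, _ => False
  end.

Lemma built_arcs s Ps Fs : spells s Ps Fs ->
  built s [seq arcs_loop P | P <- Ps] = triples (collect Fs).
Proof.
elim: Ps Fs => [|P Ps IH] [|F Fs] //= [[vN vF] /IH {}IH].
rewrite /built /= -/(built s _) IH /collect /= -/(collect Fs) triples_cat.
congr (_ ++ _); rewrite /emitted /triples /= vN; congr flatten; rewrite -map_comp.
by apply/eq_in_map => i; rewrite mem_iota /= => /vF <-.
Qed.

Definition esrc : expr := Fetch 0 (Add (Mul (Const 3) (var 4)) (Const 2)).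
Definition edst : expr := Fetch 0 (Add (Mul (Const 3) (var 4)) (Const 3)).
Definition ecost : expr := Fetch 0 (Add (Mul (Const 3) (var 4)) (Const 4)).

Lemma nth_code_graph G l i : i < ne G ->
  [/\ nth 0 (code_graph G ++ l) (3 * i + 2) = src G i,
      nth 0 (code_graph G ++ l) (3 * i + 3) = dst G i &
      nth 0 (code_graph G ++ l) (3 * i + 4) = cost G i].
Proof.
move=> im; have iE : i < size (nedges G) by rewrite size_nedges.
have [h1 h2 h3] := nth_triples iE.
rewrite code_graphE /src /dst /cost -{}h1 -{}h2 -{}h3 !addn2 -[3 * i + 3]addSnnS addn2.
rewrite -[3 * i + 4]addSnnS addn3 /= !nth_cat size_triples size_nedges.
by do 3 (rewrite ifT; last by lia); rewrite ?addn1 ?addn2.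
Qed.

Lemma size_code_graph G : size (code_graph G) = 3 * ne G + 2.
Proof. by rewrite code_graphE /= size_triples size_nedges addn2. Qed.

Definition loaded (G : digraph) (s : store) : Prop :=
  [/\ s 2 0 = nv G, s 3 0 = ne G, s 6 0 = heavy G & holds s 0 (code_graph G)].

Lemma loaded_eq G s s' : (forall a i, a \in [:: 0; 2; 3; 6] -> s' a i = s a i) ->
  loaded G s -> loaded G s'.
Proof. by move=> E [h2 h3 h6 h0]; split; try rewrite E //; move=> i /h0; rewrite E. Qed.

Lemma holds_catl s a l l' : holds s a (l ++ l') -> holds s a l.
Proof.
move=> H i il; rewrite H ?nth_cat ?il // size_cat.
by apply: leq_trans il _; exact: leq_addr.
Qed.

Lemma holds_arc G s a l i : holds s a (code_graph G ++ l) -> i < ne G ->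
  [/\ s a (3 * i + 2) = src G i, s a (3 * i + 3) = dst G i &
      s a (3 * i + 4) = cost G i].
Proof.
move=> /holds_catl H im; have [h1 h2 h3] := nth_code_graph [::] im.
rewrite cats0 in h1 h2 h3.
by split; rewrite H ?size_code_graph //; lia.
Qed.

Lemma sum_cost G (k : nat) : k <= ne G ->
  \sum_(0 <= i < k) cost G i <= \sum_(e <- edges G) e.2.
Proof.
move=> km; have -> : \sum_(e <- edges G) e.2 = \sum_(0 <= i < ne G) cost G i.
  rewrite -(size_nedges G) /cost -(big_nth (0, 0, 0) xpredT (fun e => e.2)) /nedges.
  by rewrite big_map.
by rewrite [leqRHS](big_cat_nat (n := k)) //= leq_addr.
Qed.

Lemma sum_cost_all G : \sum_(0 <= i < ne G) cost G i = \sum_(e <- edges G) e.2.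
Proof.
rewrite -(size_nedges G) /cost -(big_nth (0, 0, 0) xpredT (fun e => e.2)) /nedges.
by rewrite big_map.
Qed.

Definition setup : cmd :=
  Seq (set_var 2 (Fetch 0 (Const 0)))
 (Seq (set_var 3 (Fetch 0 (Const 1)))
 (Seq (set_var 6 (Const 0))
 (Seq (for_ 4 (var 3) (set_var 6 (Add (var 6) ecost)))
      (set_var 6 (Add (Mul (var 6) (var 2)) (Const 1)))))).

Lemma wp_setup B G s : 0 < nv G -> 3 * ne G + 4 + heavy G <= B ->
  holds s 0 (code_graph G) ->
  wp B setup [::] (6 + 3 * ne G) (loaded G) s.
Proof.
move=> n0 XB h0; set n := nv G in n0 *; set m := ne G in XB *.
have sumB : \sum_(e <- edges G) e.2 < heavy G.
  by rewrite /heavy addn1 ltnS leq_pmulr.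
have hn : s 0 0 = n by rewrite h0 // size_code_graph; lia.
have hm : s 0 1 = m by rewrite h0 // size_code_graph; lia.
rewrite -[6 + _]/(1 + (1 + (1 + (3 + 3 * m)))).
apply: wp_seq; apply: wp_set => _; split=> //=; rewrite hn.
apply: wp_seq; apply: wp_set => _; split=> //=; first by lia.
rewrite (_ : upd s 2 0 n 0 1 = m); last by rewrite /upd /= hm.
apply: wp_seq; apply: wp_set => _; split=> //=; set s1 := upd _ 6 0 0.
pose I k s' := [/\ s' 2 0 = n, s' 3 0 = m, s' 6 0 = \sum_(0 <= i < k) cost G i &
  holds s' 0 (code_graph G)].
have -> : 3 + 3 * m = (2 + m * (1 + 2)) + 1 by lia.
apply: wp_seq; apply: wp_weak (@wp_for B 4 (var 3) _ m I 1 s1 _ _ _ _ _) _ _ => //.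
- by lia.
- by move=> s' k [_ h3 _ _]; split=> //=.
- move=> s' k km [h2 h3 h6 hc] ik.
  have hc' : holds s' 0 (code_graph G ++ [::]) by rewrite cats0.
  have [_ _ hk] := holds_arc hc' km.
  have sk := @sum_cost G k.+1 km; rewrite big_nat_recr //= in sk.
  apply: wp_set => _ /=; rewrite ik hk h6; split; first by lia.
  by split=> //; split=> //; rewrite /upd /= big_nat_recr.
- by split=> //; rewrite /s1 /upd /= big_geq.
move=> s' [h2 h3 h6 hc]; apply: wp_set => _ /=; rewrite h2 h6 sum_cost_all.
rewrite -/(heavy G); split; first by rewrite /heavy in XB *; lia.
by split=> //; rewrite /upd /=.
Qed.

Definition cap (off : expr) : expr := Add (Add off (var 6)) (Const 1).

(** The minimum is off + d + 1, so subtracting [off] leaves exactly [code_value d]; a minimum that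
    stays at the cap means that there is no cycle, which is written 0. *)
Definition readout (sr : nat) (cnt off : expr) : cmd :=
  Seq (set_var 7 (cap off))
 (Seq (scan_min sr cnt)
      (If (Sub (cap off) (var 7)) (set_var 1 (Sub (var 7) off))
                                  (set_var 1 (Const 0)))).

Lemma wp_readout B G s sr cnt off l d :
  sr \notin [:: 4; 7] ->
  all (fun a => a \notin [:: 4; 7]) (reads cnt) ->
  all (fun a => a \notin [:: 4; 7]) (reads off) ->
  loaded G s -> is_min_cycle_weight G d ->
  fits B s off -> fits B s cnt -> holds s sr l -> value s cnt = size l ->
  (size l).+1 < B -> value s off + heavy G + 1 <= B ->
  reveals (value s off) (heavy G) l d ->
  wp B (readout sr cnt off) [::] (5 + size l * 5)
    (fun s' => s' 1 0 = code_value d) s.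
Proof.
move=> sr47 /allP cl /allP ol sG dG fo fc sl vc lB oB rev.
have dcap k : d = Some k -> k < heavy G.
  by move=> dk; apply: min_cycle_heavy; rewrite -dk; exact: is_min_cycle_weight_least.
have mE := reveals_min dcap rev; have [_ _ h6 _] := sG.
set o := value s off in oB rev mE; set Q := heavy G in oB dcap rev mE h6.
have same (s' : store) e : (forall a, a \in reads e -> a \notin [:: 4; 7]) ->
    (forall a i, a \notin [:: 4; 7] -> s' a i = s a i) ->
    fits B s' e = fits B s e /\ value s' e = value s e.
  move=> he hs; have E a : a \in reads e -> s' a =1 s a by move=> /he ha i; exact: hs.
  by rewrite (fits_eq _ E) (value_eq E).
rewrite -[5 + _]/(1 + (4 + _)); apply: wp_seq; apply: wp_set => _.
rewrite /= fo h6; split; first by lia.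
have -> : 4 + size l * 5 = (2 + size l * 5) + 2 by lia.
rewrite -/o; set s1 := upd _ 7 0 _.
have s1s a i : a \notin [:: 4; 7] -> s1 a i = s a i.
  by rewrite !inE negb_or => /andP[_ a7]; rewrite /s1 upd_other.
apply: wp_seq; have [fc1 vc1] := same s1 cnt cl s1s.
apply: wp_weak (wp_scan_min (l := l) _ _ _ _ _ _) _ _ => //.
- exact/allP.
- by rewrite fc1.
- by rewrite vc1.
- by move=> i il; rewrite s1s // sl.
move=> s2 [h7 hf]; have s2s a i : a \notin [:: 4; 7] -> s2 a i = s a i.
  by move=> ha; rewrite hf // s1s.
have [fo2 vo2] := same s2 off ol s2s.
have {}h7 : s2 7 0 = (o + odflt Q d).+1.
  by rewrite h7 -mE; congr min_positive; rewrite /s1 /upd /= addn1.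
have h62 : s2 6 0 = Q by rewrite s2s.
apply: wp_if => _; rewrite /= fo2 fo h62 vo2 -/o h7; split; first by lia.
case: d dcap {dG rev mE} h7 => [k|] /= dcap h7; last first.
  by rewrite addn1 subnn /=; apply: wp_set => _.
have kQ := dcap k erefl; rewrite ifT; last by lia.
apply: wp_set => _ /=; rewrite fo2 fo vo2 -/o h7; split=> //.
by rewrite /upd /= -addnS addKn.
Qed.

Lemma ne_le G : ne G <= nv G ^ 2.
Proof.
have := max_card (mem [seq e.1 | e <- edges G]).
by rewrite (card_uniqP (edges_uniq G)) card_prod card_ord size_map.
Qed.

Definition room (G : digraph) : nat :=
  1000 * (nv G + 1) * (nv G + ne G) * heavy G.

Lemma heavy_gt0 G : 0 < heavy G.
Proof. by rewrite /heavy addn1. Qed.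

Lemma heavy_le G c : 1 < nv G -> all (fun e => e.2 <= nv G ^ c) (edges G) ->
  heavy G <= nv G ^ (c + 4).
Proof.
move=> n1 w; set n := nv G in n1 w *.
have sumw : \sum_(e <- edges G) e.2 <= ne G * n ^ c.
  rewrite /ne; elim: (edges G) w => [|e E IH] /=; first by rewrite big_nil.
  by move=> /andP[ec /IH h]; rewrite big_cons mulSn leq_add.
have h1 : (\sum_(e <- edges G) e.2) * n <= n ^ (c + 3).
  apply: leq_trans (leq_mul sumw (leqnn n)) _.
  rewrite (_ : c + 3 = 2 + c + 1); last by lia.
  by rewrite !expnD expn1 !leq_mul // ne_le.
have h2 : 0 < n ^ (c + 3) by rewrite expn_gt0; lia.
rewrite /heavy -/n (_ : c + 4 = (c + 3).+1); last by lia.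
rewrite expnS; apply: (@leq_trans (2 * n ^ (c + 3))).
  by rewrite mul2n -addnn leq_add.
by rewrite leq_mul2r n1 orbT.
Qed.

(** The exponent is 10 + 2 + 3 + (c + 4), from 1000 <= n^10, n + 1 <= n^2, n + m <= n^3 and
    [heavy_le]. *)
Lemma room_le G c : 1 < nv G -> all (fun e => e.2 <= nv G ^ c) (edges G) ->
  room G <= nv G ^ (c + 19).
Proof.
move=> n1 w; have hQ := heavy_le n1 w; have hm := ne_le G.
rewrite /room; set n := nv G in n1 hQ hm *.
have p k : 2 ^ k <= n ^ k by case: k => // k; rewrite leq_exp2r.
have k1000 : 1000 <= n ^ 10 by apply: leq_trans (p 10).
have kn : n + 1 <= n ^ 2 by rewrite -mulnn; nia.
have knm : n + ne G <= n ^ 3.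
  by apply: leq_trans (leq_add (leqnn n) hm) _; rewrite -mulnn expnS -mulnn; nia.
rewrite (_ : c + 19 = 10 + 2 + 3 + (c + 4)); last by lia.
by rewrite (expnD _ (10 + 2 + 3)) (expnD _ (10 + 2)) (expnD _ 10) !leq_mul.
Qed.

Lemma room_ge G : nv G <= room G /\ 1000 * (nv G + ne G) <= room G.
Proof.
rewrite /room; have := heavy_gt0 G; set a := nv G; set b := ne G; set q := heavy G.
move=> q0; have h : 1000 * (a + b) <= 1000 * (a + 1) * (a + b) * q.
  apply: leq_trans (leq_pmulr _ q0); rewrite -mulnA leq_mul2l leq_pmull //; lia.
by split=> //; apply: leq_trans h; lia.
Qed.

Lemma solves_in_mono (Q : problem) P B T T' (x : instance Q) :
  T <= T' -> solves_in P B T x -> solves_in P B T' x.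
Proof.
move=> TT H s bs hs; have [A AP cA] := H s bs hs.
pose X (w : seq bool) := exists t s' w' l, [/\ exec B P s w t s' w', t <= T,
  holds s' output_array l & answer x l].
have Xext w z : X w -> X (w ++ z).
  move=> [t [s' [w' [l [/exec_coins[u -> ex] tT h xl]]]]].
  by exists t, s', (w' ++ z), l; split=> //; rewrite -catA.
have [A' A'P cA'] := cnt_set T' X; exists A' => [w /A'P|].
  by move=> [t [s' [w' [l [ex tT h xl]]]]]; exists t, s', w', l; split=> //; exact: leq_trans TT.
rewrite cA'; have := cnt_ext T (T' - T) Xext; rewrite subnK // => ext.
apply: leq_trans (leq_mul (leqnn (nv (graph x))) ext).
rewrite -{1}(subnK TT) expnD [leqLHS]mulnCA [leqRHS]mulnCA leq_mul2l.
by apply/orP; right; apply: leq_trans cA _; rewrite leq_mul2l set_cnt ?orbT.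
Qed.

Lemma solves_in_cycle B c T (G : digraph) :
  (forall s d, is_min_cycle_weight G d -> holds s 0 (code_graph G) ->
     good B 1 (nv G) c T (fun s' => s' 1 0 = code_value d) s) ->
  solves_in (Q := min_wt_cycle) c B T G.
Proof.
move=> H s bs hs; rewrite cats0 in hs.
have [d dG] := ex_min_value (fun c : 'I_(nv G) * seq 'I_(nv G) => simple_cycle c.1 c.2)
  (fun c => cycle_weight c.1 c.2).
have := H s d dG hs bs; rewrite subn1.
have [A AP <-] := cnt_set T (succeeds B c T (fun s' => s' 1 0 = code_value d) s).
exists A => // w /AP[t [s' [w' [ex tT _ out]]]].
exists t, s', w', [:: code_value d]; split=> //; last by exists d.
by case.
Qed.

(** What a reduction with one call has to supply: [fs] writes the instance, [mid] turns the output
    into a list of numbers where it is not one already, and [sr], [cnt], [off] tell [readout] where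
    that list is and by how much it is shifted. *)
Record list_reduction (Q : problem) (fs : seq emit_loop) (mid : cmd) (sr : nat)
    (cnt off : expr) : Prop := ListReduction {
  closed_loops : all loop_closed fs;
  sr_var : sr \notin [:: 4; 7];
  cnt_var : all (fun a => a \notin [:: 4; 7]) (reads cnt);
  off_var : all (fun a => a \notin [:: 4; 7]) (reads off);
  reduced : forall G, 1 < nv G -> nv G <= ne G -> exists x : instance Q,
    [/\ valid x,
        (nv G <= nv (graph x) <= 20 * nv G) && (ne G <= ne (graph x) <= 20 * ne G),
        nv (graph x) <= ne (graph x),
        all (fun e => e.2 <= room G) (edges (graph x)) &
    forall B d s, room G <= B -> loaded G s -> is_min_cycle_weight G d ->
      [/\ built s fs = code_graph (graph x) ++ query x, loops_fit B s fs,
          build_time s fs <= 1000 * ne G, (size (built s fs)).+1 < B &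
      forall l s', answer x l -> loaded G s' -> holds s' 21 l ->
        wp B mid [::] (1000 * ne G) (fun s2 => loaded G s2 /\ exists l',
          [/\ holds s2 sr l', value s2 cnt = size l', fits B s2 cnt,
              size l' <= 100 * ne G & fits B s2 off /\
              (value s2 off + heavy G + 1 <= B /\
               reveals (value s2 off) (heavy G) l' d)]) s']] }.

Definition reduce_with (fs : seq emit_loop) (mid : cmd) (sr : nat) (cnt off : expr)
    (P : cmd) : cmd :=
  Seq setup (Seq (build fs) (Seq (shift_cmd 20 P) (Seq mid (readout sr cnt off)))).

Lemma one_lt_nv G : 0 < nv G <= ne G -> 1 < nv G.
Proof.
move=> /andP[n0 nm]; have m0 := leq_trans n0 nm.
by have /edge_bound[] := ith_edge (i := 0) m0; lia.
Qed.

(* The time T granted by has_sub_mn_algorithm depends on the instance; the integer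
   part of g serves all the instances of one size. *)
Lemma uniform_time (R : realType) (Q : problem) P (g : nat -> nat -> R) k c N M :
  (forall x : instance Q, valid x -> 0 < nv (graph x) <= ne (graph x) ->
     all (fun e => e.2 <= nv (graph x) ^ c) (edges (graph x)) ->
     exists2 T : nat, (T%:R <= g (ne (graph x)) (nv (graph x)))%R &
       forall B : nat, nv (graph x) ^ k <= B -> solves_in P B T x) ->
  (exists x : instance Q, [/\ valid x, nv (graph x) = N, ne (graph x) = M,
     0 < N <= M & all (fun e => e.2 <= N ^ c) (edges (graph x))]) ->
  exists2 T : nat, (T%:R <= g M N)%R & forall (x : instance Q) B, valid x ->
    nv (graph x) = N -> ne (graph x) = M ->
    all (fun e => e.2 <= N ^ c) (edges (graph x)) -> N ^ k <= B -> solves_in P B T x.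
Proof.
move=> H [x0 [v0 n0 m0 NM w0]].
have pw (x : instance Q) a : nv (graph x) = N -> nv (graph x) ^ a = N ^ a by move=> ->.
have [||T0 T0g _] := H x0 v0; first by rewrite n0 m0.
  by rewrite (pw x0 c n0).
rewrite n0 m0 in T0g; exists (Num.truncn (g M N)).
  by rewrite Num.Theory.truncn_le (Order.POrderTheory.le_trans _ T0g) // Num.Theory.ler0n.
move=> x B v xn xm w NB; have [||T Tg sol] := H x v; first by rewrite xn xm.
  by rewrite (pw x c xn).
apply: solves_in_mono (sol B _); last by rewrite xn.
rewrite xn xm in Tg; rewrite Num.Theory.truncn_ge_nat //.
exact: Order.POrderTheory.le_trans (Num.Theory.ler0n _ _) Tg.
Qed.

Lemma reduce_good B G (Q : problem) P fs mid sr cnt off (x : instance Q) T d s :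
  list_reduction Q fs mid sr cnt off -> 1 < nv G -> nv G <= ne G ->
  room G <= B -> nv G <= nv (graph x) -> solves_in P B T x ->
  (forall s', loaded G s' ->
      [/\ built s' fs = code_graph (graph x) ++ query x, loops_fit B s' fs,
          build_time s' fs <= 1000 * ne G, (size (built s' fs)).+1 < B &
      forall l s', answer x l -> loaded G s' -> holds s' 21 l ->
        wp B mid [::] (1000 * ne G) (fun s2 => loaded G s2 /\ exists l',
          [/\ holds s2 sr l', value s2 cnt = size l', fits B s2 cnt,
              size l' <= 100 * ne G & fits B s2 off /\
              (value s2 off + heavy G + 1 <= B /\
               reveals (value s2 off) (heavy G) l' d)]) s']) ->
  is_min_cycle_weight G d -> holds s 0 (code_graph G) ->
  good B 1 (nv G) (reduce_with fs mid sr cnt off P) (3000 * ne G + T)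
    (fun s' => s' 1 0 = code_value d) s.
Proof.
move=> [cl srv cv ov _] n1 nm rB nx sol H dG hs.
have [rn rnm] := room_ge G; have m0 : 0 < ne G by lia.
have hB : heavy G + 1000 * (nv G + ne G) <= 2 * B.
  have h : heavy G <= room G by rewrite /room leq_pmull // !muln_gt0; lia.
  lia.
have hB' : 3 * ne G + 4 + heavy G <= B.
  have h : 1000 * heavy G <= room G.
    by rewrite /room leq_mul2r -mulnA leq_pmulr ?orbT // muln_gt0; lia.
  lia.
have n0 : 0 < nv G by lia.
have B1 : 1 < B by lia.
suff : good B (0 + (0 + (1 + 0))) (nv G) (reduce_with fs mid sr cnt off P)
    ((6 + 3 * ne G) + (1000 * ne G + (T + (1000 * ne G + (5 + 100 * ne G * 5)))))
    (fun s' => s' 1 0 = code_value d) s.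
  move=> g; apply: good_weak g _ _ _ => //; lia.
apply: good_seq (good_wp _ (wp_setup n0 hB' hs)) _ => // s1 l1.
have [bE ft bt bs run] := H s1 l1.
apply: good_seq => //.
  by apply: good_wp; apply: wp_weak (wp_build B1 cl ft bs) bt (fun _ h => h).
move=> s2 [h20 hf]; have l2 : loaded G s2.
  by apply: loaded_eq l1 => a i; rewrite !inE => ha; rewrite hf // !inE; lia.
rewrite bE in h20.
apply: good_seq => //; first by apply: good_call sol h20 => //; lia.
move=> s3 [[l xl h21] hf3]; have l3 : loaded G s3.
  by apply: loaded_eq l2 => a i; rewrite !inE => ha; rewrite hf3 //; lia.
apply: good_wp; apply: wp_seq; apply: wp_weak (run l s3 xl l3 h21) _ _ => //.
move=> s4 [l4 [l' [hl' vl' fl' sl' [fo [oB rev]]]]].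
have := wp_readout srv cv ov l4 dG fo fl' hl' vl' _ oB rev.
move=> /(_ ltac:(lia)) w; apply: wp_weak w _ _ => //.
by rewrite leq_add2l leq_mul2r sl' orbT.
Qed.

Theorem has_sub_mn_reduction (R : realType) (Q : problem) fs mid sr cnt off :
  list_reduction Q fs mid sr cnt off ->
  has_sub_mn_algorithm R Q -> has_sub_mn_algorithm R min_wt_cycle.
Proof.
move=> red [P HP]; exists (reduce_with fs mid sr cnt off P) => c.
have [g [k [sub H]]] := HP (c + 19).
have [g' sub' G'] := sub_mn_blowup 3000 0 sub.
(* The words hold [room G] <= n^(c + 19) and also the (20 n)^k that the called program may demand,
   as 20 n <= n^6. *)
exists g', (c + 19 + 6 * k); split=> // G _ nm w; have n1 := one_lt_nv nm.
have rle := room_le n1 w; have /andP[n0 nm'] := nm.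
have [x [v /andP[/andP[xn xn'] /andP[xm xm']] xnm xw H']] := reduced red n1 nm'.
have pow (a b : nat) : a <= b -> nv G ^ a <= nv G ^ b.
  by move=> ab; rewrite leq_exp2l.
have xw' : all (fun e => e.2 <= nv (graph x) ^ (c + 19)) (edges (graph x)).
  apply: sub_all xw => e eX; apply: leq_trans eX (leq_trans rle _).
  by rewrite leq_exp2r // addnS.
have [|T Tg sol] := H x v _ xw'; first by rewrite xnm (leq_trans n0 xn).
exists (3000 * ne G + T).
  apply: G' Tg _ => //=; rewrite ?expn0 ?xn ?xm /=.
  - by apply: leq_trans xn' _; rewrite leq_mul2r; lia.
  - by apply: leq_trans xm' _; rewrite leq_mul2r; lia.
  - by rewrite muln1 mulnDr leq_add2l leq_pmull.
move=> B kB; apply: solves_in_cycle => s d dG hs.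
have rB : room G <= B.
  by apply: leq_trans rle (leq_trans (pow _ _ _) kB); exact: leq_addr.
apply: (reduce_good red n1 nm' rB xn) (dG) (hs) => //; last by move=> s' l'; exact: H'.
apply: sol; apply: leq_trans kB; apply: (@leq_trans (nv G ^ (6 * k))).
  rewrite expnM; case: (k) => // k'; rewrite leq_exp2r //.
  apply: leq_trans xn' _; rewrite expnSr leq_mul2r; apply/orP; right.
  by apply: (@leq_trans (2 ^ 5)) => //; rewrite leq_exp2r.
by apply: pow; exact: leq_addl.
Qed.

Lemma room_heavy G : 0 < nv G -> 1000 * (nv G * heavy G + heavy G) <= room G.
Proof.
move=> n0; have -> : nv G * heavy G + heavy G = (nv G + 1) * heavy G by lia.
rewrite /room -(mulnA 1000) -mulnA -(mulnA (nv G + 1)).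
by rewrite leq_mul // leq_mul // leq_pmull // addn_gt0 n0.
Qed.

Lemma collect_nedges G :
  collect [:: (ne G, fun i => (src G i, dst G i, cost G i))] = nedges G.
Proof.
rewrite /collect /= cats0 -size_nedges -[RHS](mkseq_nth (0, 0, 0)) /mkseq.
by apply: eq_map => i; rewrite /src /dst /cost -!surjective_pairing.
Qed.

Lemma loaded_arc G s i : loaded G s -> i < ne G ->
  [/\ s 0 (3 * i + 2) = src G i, s 0 (3 * i + 3) = dst G i &
      s 0 (3 * i + 4) = cost G i].
Proof.
move=> [_ _ _ h0]; have h0' : holds s 0 (code_graph G ++ [::]) by rewrite cats0.
exact: holds_arc h0'.
Qed.

Definition header (N M : expr) : emit_loop := (Const 1, [:: N; M]).

Lemma built_header s N M Ps Fs fs H N' M' : spells s Ps Fs ->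
  nedges H = collect Fs -> value (at_index s 0) N = N' -> value (at_index s 0) M = M' ->
  nv H = N' -> ne H = M' ->
  built s (header N M :: [seq arcs_loop P | P <- Ps] ++ fs) =
  code_graph H ++ built s fs.
Proof.
move=> PF HF vN vM HN HM.
have hE : built s [:: header N M] = [:: N'; M'].
  by rewrite /built /= /emitted /= vN vM.
by rewrite -cat1s !built_cat (built_arcs PF) hE code_graphE -HF HN HM.
Qed.

Lemma built_one s es : built s [:: (Const 1, es)] = [seq value (at_index s 0) e | e <- es].
Proof. by rewrite /built /= /emitted /= !cats0. Qed.

Lemma built_map s N e : built s [:: (N, [:: e])] =
  [seq value (at_index s i) e | i <- iota 0 (value s N)].
Proof.
by rewrite /built /= cats0 /emitted /=; elim: (iota _ _) => //= i l ->.
Qed.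

Lemma min_weight_le G : all (fun e => e.2 <= \sum_(f <- edges G) f.2) (edges G).
Proof.
apply/allP => e e_in; rewrite (bigD1_seq e) //= ?leq_addr //.
exact: map_uniq (edges_uniq G).
Qed.

Lemma cost_lt G i : i < ne G -> cost G i < heavy G.
Proof.
move=> im; have /edge_bound[un _ _] := ith_edge im.
have /edgeP[a [b [_ _ ab]]] := ith_edge im.
rewrite /heavy addn1 ltnS.
by apply: leq_trans (allP (min_weight_le G) _ ab) (leq_pmulr _ _); lia.
Qed.

Lemma all_weights G X : (forall u v w, (u, v, w) \in nedges G -> w <= X) ->
  all (fun e => e.2 <= X) (edges G).
Proof.
move=> H; apply/allP => -[[u v] w] uvw; apply: (H u v).
by apply/edgeP; exists u, v.
Qed.

Definition ansc_loops : seq emit_loop :=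
  header (var 2) (var 3) :: [seq arcs_loop P | P <- [:: (var 3, (esrc, edst, ecost))]] ++ [::].

Lemma ansc_reduction : list_reduction ansc ansc_loops Skip 21 (var 2) (Const 0).
Proof.
split=> // G n1 nm; have [rn rnm] := room_ge G.
have rQ := @room_heavy G (ltnW n1); exists G; split=> //.
- by rewrite !leqnn !leq_pmull.
- apply: sub_all (min_weight_le G) => e /leq_trans; apply.
  apply: (@leq_trans (heavy G)); first by rewrite /heavy addn1 ltnW // ltnS leq_pmulr; lia.
  by rewrite /room leq_pmull // !muln_gt0; lia.
move=> B d s rB sG dG; have [h2 h3 h6 h0] := sG.
have sp : spells s [:: (var 3, (esrc, edst, ecost))]
    [:: (ne G, fun i => (src G i, dst G i, cost G i))].
  split=> //; split=> // i im; rewrite /= /at_index /upd /=.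
  by have [-> -> ->] := loaded_arc sG im.
have bE : built s ansc_loops = code_graph G.
  rewrite /ansc_loops (built_header _ sp (esym (collect_nedges G)) _ _ (erefl _) (erefl _)).
  - by rewrite cats0.
  - exact: h2.
  - exact: h3.
have gN : 0 < ne G by lia.
split=> //.
- by rewrite bE cats0.
- rewrite /= /loop_fits /= /at_index /upd /= ?h2 ?h3 ?h6.
  by repeat split; try lia; move=> k kN; rewrite !andbT; lia.
- by rewrite /build_time /= /loop_time /= ?h3; lia.
- by rewrite bE size_code_graph; lia.
move=> l s' lA [h2' h3' h6' h0'] hl; apply: wp_skip; first by lia.
split=> //; exists l; split=> //; last first.
- by split=> //; split=> //=; [lia | exact: ansc_reveals].
- by case: lA => r _ ->; rewrite size_map size_enum_ord; lia.
by case: lA => r _ ->; rewrite /= h2' size_map size_enum_ord.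
Qed.

Definition times_n (k : nat) (e : expr) : expr := Add (Mul (Const k) (var 2)) e.
Local Notation idx := (var 4).
Local Notation idx_plus k := (Add (var 4) (Const k)).

Ltac spell_arcs H :=
  let i := fresh "i" in let hi := fresh "hi" in
  repeat (split; [split; [by rewrite /= ?H | move=> i hi] | ]); [.. | by []];
  rewrite /= /at_index /upd /= ?H.

Definition radius_arcs : seq arcs_cmd :=
  [:: (var 3, (esrc, edst, ecost));
      (var 3, (esrc, Add (var 2) edst, Add (var 6) ecost));
      (var 2, (times_n 2 idx, idx, Const 0));
      (var 2, (times_n 2 idx, times_n 3 idx, Const 0));
      (var 2, (times_n 2 idx, times_n 4 (idx_plus 2), Const 0));
      (var 2, (times_n 2 idx, times_n 5 (Const 2), Const 0));
      (var 2, (times_n 2 idx, times_n 5 (Const 3), var 6));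
      (var 2, (times_n 3 (idx_plus 1), times_n 3 idx, Const 0));
      (var 2, (times_n 3 (idx_plus 1), Add (var 2) idx, var 6));
      (var 2, (times_n 4 (idx_plus 1), times_n 4 (idx_plus 2), Const 0));
      (var 2, (times_n 4 (idx_plus 1), Add (var 2) idx, var 6));
      (var 2, (times_n 5 (Const 2), times_n 2 idx, var 6));
      (var 2, (times_n 5 (Const 2), idx, var 6));
      (Const 1, (times_n 5 (Const 2), times_n 4 (Const 0), var 6));
      (Const 1, (times_n 5 (Const 2), times_n 4 (Const 1), var 6))].

Definition radius_loops : seq emit_loop :=
  header (times_n 5 (Const 4)) (Add (Mul (Const 2) (var 3)) (times_n 11 (Const 2)))
  :: [seq arcs_loop P | P <- radius_arcs] ++ [::].

Lemma radius_spells G s : loaded G s -> spells s radius_arcs (radius_families G).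
Proof.
move=> sG; have [h2 h3 h6 _] := sG; rewrite /radius_arcs /radius_families.
spell_arcs (h2, h3, h6).
1-2: by have [-> -> ->] := loaded_arc sG hi.
all: by congr (_, _, _); lia.
Qed.

Lemma radius_loops_ok G B s : 1 < nv G -> nv G <= ne G -> room G <= B ->
  loaded G s -> loops_fit B s radius_loops /\ build_time s radius_loops <= 1000 * ne G.
Proof.
move=> n1 nm rB sG; have [h2 h3 h6 _] := sG; have [rn rnm] := room_ge G.
have rQ := @room_heavy G (ltnW n1); have wQ := @heavy_gt0 G; split; last first.
  by rewrite /build_time /= /loop_time /= ?h2 ?h3; lia.
rewrite /= /loop_fits /= /at_index /upd /= ?h2 ?h3 ?h6.
repeat split; try lia; move=> k kN; rewrite ?andbT; try lia.
have [_ -> ->] := loaded_arc sG kN.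
by have := dst_lt kN; have := cost_lt kN; lia.
Qed.

Lemma radius_weights G G' : 1 < nv G -> nedges G' = collect (radius_families G) ->
  all (fun e => e.2 <= room G) (edges G').
Proof.
move=> n1 HE; have rQ := @room_heavy G (ltnW n1); apply: all_weights => u v w.
rewrite HE => /collectP /= H; split_edges; case: H => _ _ ->; try lia.
  by have := cost_lt hi; lia.
by have := cost_lt hi; lia.
Qed.

(** Radius and eccentricities use the same graph and offset; only the length of the output
    differs. *)
Lemma radius_like (Q : problem) (inst : digraph -> instance Q) cnt :
  (forall G, graph (inst G) = G) -> (forall G, query (inst G) = [::]) ->
  (forall G, valid (inst G)) ->
  all (fun a => a \notin [:: 4; 7]) (reads cnt) ->
  (forall G G' d l, 0 < nv G -> nv G' = 5 * nv G + 4 ->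
     nedges G' = collect (radius_families G) -> is_min_cycle_weight G d ->
     answer (inst G') l -> reveals (heavy G) (heavy G) l d) ->
  (forall G G' B s l, 1 < nv G -> nv G <= ne G -> nv G' = 5 * nv G + 4 -> room G <= B ->
     loaded G s -> answer (inst G') l ->
     [/\ value s cnt = size l, fits B s cnt & size l <= 100 * ne G]) ->
  list_reduction Q radius_loops Skip 21 cnt (var 6).
Proof.
move=> gE qE vE cl rev cntE; split=> // G n1 nm; have [rn rnm] := room_ge G.
have rQ := @room_heavy G (ltnW n1); have n0 := ltnW n1.
have [G' [nvG' HE]] := radius_graph n0.
have neG' : ne G' = 2 * ne G + (11 * nv G + 2).
  by rewrite -size_nedges HE size_collect /=; lia.
exists (inst G'); rewrite gE qE; split=> //.
- by rewrite nvG' neG'; lia.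
- by rewrite nvG' neG'; lia.
- exact: radius_weights HE.
move=> B d s rB sG dG; have [ft bt] := radius_loops_ok n1 nm rB sG.
have [h2 h3 h6 _] := sG.
have bE : built s radius_loops = code_graph G'.
  rewrite /radius_loops (built_header _ (radius_spells sG) HE _ _ nvG' neG').
  - by rewrite cats0.
  - by rewrite /= /at_index /upd /= h2.
  - by rewrite /= /at_index /upd /= h2 h3.
split=> //.
- by rewrite bE cats0.
- by rewrite bE size_code_graph neG'; lia.
move=> l s' lA l' hl; apply: wp_skip; first by lia.
have [vc fc sl] := cntE _ _ _ _ _ n1 nm nvG' rB l' lA.
have [_ _ h6' _] := l'; split=> //; exists l; split=> //; split=> //=.
by rewrite h6'; split; [lia | exact: rev lA].
Qed.

Lemma radius_reduction : list_reduction radius radius_loops Skip 21 (Const 1) (var 6).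
Proof.
apply: (@radius_like radius id) => //.
- by move=> G G' d l n0 nvG' HE dG; exact: radius_reveals.
- move=> G G' B s l n1 nm _ rB _ [r _ ->]; have [rn _] := room_ge G.
  by split=> //=; lia.
Qed.

Lemma eccentricities_reduction :
  list_reduction eccentricities radius_loops Skip 21 (times_n 5 (Const 4)) (var 6).
Proof.
apply: (@radius_like eccentricities id) => //.
- by move=> G G' d l n0 nvG' HE dG; exact: eccentricities_reveals.
- move=> G G' B s l n1 nm nvG' rB [h2 _ _ _] [r _ ->]; have [_ rn] := room_ge G.
  by rewrite size_map size_enum_ord /= h2 nvG'; split=> //=; lia.
Qed.

(** * Weight of an output path *)

Section Successor.
Variable V : eqType.
Variable code : V -> nat.
Hypothesis code_inj : injective code.

(** At most one summand occurs on a simple path; the shift by 1 reserves 0 for vertices without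
    successor. *)
Definition successor (l : seq (V * V)) (u : nat) : nat :=
  \sum_(e <- l | code e.1 == u) (code e.2).+1.

Lemma successor_rcons l e u : code e.1 \notin [seq code f.1 | f <- l] ->
  successor (rcons l e) u = if code e.1 == u then (code e.2).+1 else successor l u.
Proof.
move=> el; rewrite /successor -cats1 big_cat big_cons big_nil /=.
case: eqP => [<-|_]; last by rewrite addn0.
rewrite addn0 big_seq_cond big1 ?add0n // => f /andP[f_l /eqP fe].
by case/mapP: el; exists f.
Qed.

Lemma successorP l u v : uniq [seq e.1 | e <- l] ->
  (successor l (code u) == (code v).+1) = ((u, v) \in l).
Proof.
elim/last_ind: l => [|l e IH]; first by rewrite /successor big_nil.
rewrite map_rcons rcons_uniq => /andP[el ul].
have el' : code e.1 \notin [seq code f.1 | f <- l].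
  by apply: contra el => /mapP[f f_l] /code_inj->; exact: map_f.
rewrite successor_rcons // mem_rcons inE (inj_eq code_inj).
case: (e.1 =P u) => [eu|eu].
  rewrite eqSS (inj_eq code_inj) -eu; case: e el {ul el' eu} => a c /= el.
  rewrite xpair_eqE eqxx eq_sym /=; case: eqP => //= _; apply/esym/negP => av_l.
  by case/mapP: el; exists (a, v).
by rewrite IH //; case: eqP => //= uve; case: eu; rewrite -uve.
Qed.

End Successor.

Section PathWeight.
Variable G : digraph.
Local Notation V := 'I_(nv G).

Lemma consecutive_rcons (x : V) p y :
  consecutive x (rcons p y) = rcons (consecutive x p) (last x p, y).
Proof. by rewrite -cats1 consecutive_cat cats1. Qed.

Lemma unzip1_consecutive (x : V) p :
  [seq e.1 | e <- consecutive x p] = belast x p.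
Proof. by elim: p x => //= a p IH x; rewrite -IH. Qed.

Lemma uniq_consecutive (x : V) p : uniq (x :: p) ->
  uniq [seq e.1 | e <- consecutive x p].
Proof.
rewrite unzip1_consecutive lastI rcons_uniq => /andP[_ ->] //.
Qed.

(** The weight of a single edge cannot be looked up quickly in an unsorted edge list. One pass over
    all edges, testing each against the successor array, keeps the cost linear. *)
Lemma weight_successor (x : V) p : uniq (x :: p) ->
  weight x p = \sum_(0 <= i < ne G)
    (if successor val (consecutive x p) (src G i) == (dst G i).+1 then cost G i else 0).
Proof.
move=> up; have uc := consecutive_uniq up.
have -> : weight x p =
    \sum_(f <- edges G) (if f.1 \in consecutive x p then f.2 else 0).
  rewrite /weight /wt (exchange_big_dep xpredT) //=; apply: eq_bigr => f _.
  rewrite (eq_bigl (fun e => e == f.1)) => [|e]; last by rewrite -surjective_pairing eq_sym.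
  case: ifP => [fc|/negbT fc].
    by rewrite big_mkcond (bigD1_seq f.1) //= eqxx big1 ?addn0 // => e /negPf->.
  by rewrite big_seq_cond big1 // => e /andP[ec /eqP ef]; rewrite -ef ec in fc.
transitivity (\sum_(f <- nedges G)
    (if successor val (consecutive x p) f.1.1 == f.1.2.+1 then f.2 else 0)).
  rewrite /nedges big_map; apply: eq_bigr => -[[u v] w] _ /=.
  by rewrite successorP ?uniq_consecutive //; exact: val_inj.
by rewrite (big_nth (0, 0, 0)) size_nedges.
Qed.

End PathWeight.

Section PathWeightProgram.
Variable B : nat.

Definition earc (k : nat) : expr := Fetch 20 (Add (Mul (Const 3) (var 4)) (Const k)).

(* Array 21 holds the code of an optional path from x, array 20 a graph.  Array 10
   is filled with the successors along the path. *)
Definition mark_path : cmd :=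
  for_ 4 (Fetch 21 (Const 1))
    (Seq (Store 10 (var 11) (Add (Fetch 21 (Add (var 4) (Const 2))) (Const 1)))
         (set_var 11 (Fetch 21 (Add (var 4) (Const 2))))).

(** With truncated subtraction, 1 - ((a - b) + (b - a)) is nonzero exactly if a = b. *)
Definition add_marked : cmd :=
  for_ 4 (Fetch 20 (Const 1))
    (If (Sub (Const 1) (Add (Sub (Fetch 10 (earc 2)) (Add (earc 3) (Const 1)))
                            (Sub (Add (earc 3) (Const 1)) (Fetch 10 (earc 2)))))
        (set_var 9 (Add (var 9) (earc 4))) Skip).

Definition path_weight (x : expr) : cmd :=
  Seq (for_ 4 (Fetch 20 (Const 0)) (Store 10 (var 4) (Const 0)))
 (Seq (set_var 11 x)
 (Seq mark_path
 (Seq (set_var 9 (Const 1)) add_marked))).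

Lemma wp_path_weight G (x : 'I_(nv G)) p l ex s :
  uniq (x :: p) -> holds s 20 (code_graph G ++ l) ->
  holds s 21 (1 :: code_vertices p) ->
  all (fun a => a \notin [:: 4; 10]) (reads ex) -> fits B s ex -> value s ex = x ->
  3 * ne G + nv G + 5 + \sum_(e <- edges G) e.2 <= B ->
  wp B (path_weight ex) [::] (10 + 8 * (nv G + ne G))
    (fun s' => s' 9 0 = (weight x p).+1 /\
       forall a i, a \notin [:: 4; 9; 10; 11] -> s' a i = s a i) s.
Proof.
move=> up h20 h21 /allP cx fx vx room.
set n := nv G in room *; set m := ne G in room *.
have np : size p < n.
  by have := max_card (mem (x :: p)); rewrite (card_uniqP up) card_ord.
have hn : s 20 0 = n.
  by rewrite h20 // size_cat size_code_graph; lia.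
have hm : s 20 1 = m.
  by rewrite h20 // size_cat size_code_graph; lia.
have hp : s 21 1 = size p by rewrite h21.
have hpk k : k < size p -> s 21 (k + 2) = nth 0 (map val p) k.
  by move=> kp; rewrite h21 addn2 //= size_map; lia.
apply: (@wp_weak B _ _ ((2 + n * (1 + 2)) +
    (1 + ((2 + size p * (2 + 2)) + (1 + (2 + m * (2 + 2))))))); last 2 first.
- by lia.
- by move=> s' h; exact: h.
apply: wp_seq.
pose I1 k s' := (forall u, u < k -> s' 10 u = 0) /\
  forall a i, a \notin [:: 4; 10] -> s' a i = s a i.
apply: wp_weak (@wp_for B 4 _ _ n I1 1 s _ _ _ _ _) (leqnn _) _.
- by lia.
- move=> s' v k [h1 h2]; split=> [u uk|a i].
    by rewrite /upd /= h1.
  by rewrite !inE negb_or => /andP[a4 a10]; rewrite upd_other // h2 // !inE negb_or a4.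
- by move=> s' k [_ h2]; split=> //=; rewrite h2.
- move=> s' k kn [h1 h2] ik; apply: wp_store => _ /=; rewrite ik; split=> //.
  split; last by rewrite /upd /=.
  split=> [u|a i]; first by rewrite ltnS leq_eqVlt /upd /=; case: eqP => //= _ /h1.
  by rewrite !inE negb_or => /andP[a4 a10]; rewrite upd_other // h2 // !inE negb_or a4.
- by split.
move=> s1 [h1 hf1].
have E1 a : a \in reads ex -> s1 a =1 s a by move=> /cx ha i; exact: hf1.
apply: wp_seq; apply: wp_set => _; rewrite (fits_eq _ E1) fx (value_eq E1) vx; split=> //.
set s2 := upd _ _ _ _.
have hf2 a i : a \notin [:: 4; 10; 11] -> s2 a i = s a i.
  rewrite !inE !negb_or => /and3P[a4 a10 a11].
  by rewrite /s2 upd_other // hf1 // !inE negb_or a4.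
apply: wp_seq.
pose I2 k s' := [/\ forall u, u < n -> s' 10 u = successor val (consecutive x (take k p)) u,
  s' 11 0 = last x (take k p) &
  forall a i, a \notin [:: 4; 10; 11] -> s' a i = s a i].
apply: wp_weak (@wp_for B 4 _ _ (size p) I2 2 s2 _ _ _ _ _) (leqnn _) _.
- by lia.
- move=> s' v k [h3 h4 h5]; split=> [u un||a i].
  + by rewrite /upd /= h3.
  + by rewrite /upd /= h4.
  + move=> ha; rewrite upd_other ?h5 //; move: ha; rewrite !inE !negb_or.
    by case/and3P.
- by move=> s' k [_ _ h5]; split=> /=; [lia | rewrite h5].
- move=> s' k kp [h3 h4 h5] ik.
  have hk : s' 21 (k + 2) = nth x p k.
    by rewrite h5 // hpk // (nth_map x).
  have xn := ltn_ord (last x (take k p)); have kn := ltn_ord (nth x p k).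
  apply: (@wp_seq B _ _ 1 1); apply: wp_store => _ /=; rewrite ik hk; split; try by lia.
  apply: wp_set => _ /=; rewrite /upd /= ik hk; split; first by lia.
  split; last by [].
  rewrite /I2 (take_nth x kp) last_rcons; split.
  + move=> u un; rewrite /= consecutive_rcons successor_rcons /=; last first.
      apply/mapP => -[e e_p /= le].
      have := take_uniq k.+2 up; rewrite /= (take_nth x kp) rcons_uniq.
      move=> /andP[xr /andP[_ ut]]; have : uniq (x :: take k p).
        by rewrite /= ut andbT; move: xr; rewrite mem_rcons inE negb_or => /andP[].
      rewrite lastI rcons_uniq => /andP[/negP[]]; rewrite -unzip1_consecutive.
      by apply/mapP; exists e => //; exact: val_inj.
    rewrite h4 eq_sym; case: eqP => // _; first by rewrite addn1.
    by rewrite h3.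
  + by [].
  + move=> a i; rewrite !inE !negb_or => /and3P[a4 a10 a11].
    by rewrite (negPf a11) (negPf a10) /= h5 // !inE !negb_or a4 a10.
- split=> [u un|//|//].
    by rewrite take0 /successor big_nil /s2 /upd /= h1.
  by rewrite take0.
move=> s3; rewrite /I2 take_size => -[h3 _ hf3]; apply: wp_seq.
apply: wp_set => _; split=> //=; first by lia.
set s4 := upd _ _ _ _.
pose w i := if successor val (consecutive x p) (src G i) == (dst G i).+1
  then cost G i else 0.
have wcost k : k <= m -> \sum_(0 <= i < k) w i <= \sum_(e <- edges G) e.2.
  move=> km; apply: leq_trans (sum_cost km); apply: leq_sum => i _.
  by rewrite /w; case: ifP.
pose I3 k s' := [/\ s' 9 0 = (\sum_(0 <= i < k) w i).+1,
  forall u, u < n -> s' 10 u = successor val (consecutive x p) u &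
  forall a i, a \notin [:: 4; 9; 10; 11] -> s' a i = s a i].
rewrite weight_successor // -/w.
apply: wp_weak (@wp_for B 4 _ _ m I3 2 s4 _ _ _ _ _) (leqnn _) _.
- by lia.
- move=> s' v k [h5 h6 h7]; split=> [|u un|a i].
  + by rewrite /upd /= h5.
  + by rewrite /upd /= h6.
  + move=> ha; rewrite upd_other ?h7 //; move: ha; rewrite !inE !negb_or.
    by case/and4P.
- by move=> s' k [_ _ h7]; split=> /=; [lia | rewrite h7].
- move=> s' k km [h5 h6 h7] ik.
  have h20' : holds s' 20 (code_graph G ++ l) by move=> i il; rewrite h7 // h20.
  have [ks kd kc] := holds_arc h20' km; have wk := wcost k.+1 km.
  rewrite big_nat_recr //= {2}/w in wk.
  have sn := src_lt km; have dn := dst_lt km.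
  apply: wp_if => bs /=; have := bs 10 (src G k).
  rewrite ik ks kd h6 // => aB; split; first by move: aB; set a := successor _ _ _; lia.
  rewrite /I3 big_nat_recr //= {2}/w.
  set a := successor _ _ _ in wk *.
  have -> : (1 - (a - (dst G k + 1) + (dst G k + 1 - a)) != 0) = (a == (dst G k).+1) by lia.
  case: (a == _) wk => /= wk; last by apply: wp_skip; rewrite ?addn0.
  apply: wp_set => _ /=. rewrite ik kc h5; split.
    move: wk room; move: (\sum_(0 <= i < k) w i) (\sum_(e <- edges G) e.2) => sm tot.
    by move=> wk room; lia.
  split; last by rewrite /upd /=.
  split=> [|u un|b i]; first by rewrite /upd /= addSn.
    by rewrite /upd /= h6.
  rewrite !inE !negb_or => /and4P[b4 b9 b10 b11].
  by rewrite upd_other // h7 // !inE !negb_or b4 b9 b10.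
- split=> [|u un|a i]; first by rewrite big_geq.
    by rewrite /s4 /upd /= h3.
  rewrite !inE !negb_or => /and4P[a4 a9 a10 a11].
  by rewrite /s4 upd_other // hf3 // !inE !negb_or a4 a10.
by move=> s5 [h5 _ hf5]; split.
Qed.

End PathWeightProgram.

Definition detour_arcs : seq arcs_cmd :=
  [:: (var 3, (esrc, edst, ecost));
      (var 3, (esrc, Add (var 2) edst, ecost));
      (var 2, (times_n 2 idx, times_n 2 (idx_plus 1), Const 0));
      (var 2, (times_n 2 idx, idx, Mul (Sub (var 2) idx) (var 6)));
      (var 2, (Add (var 2) idx, times_n 2 (idx_plus 1), Mul (idx_plus 1) (var 6)));
      (Const 1, (times_n 3 (Const 0), times_n 2 (Const 0), Const 0))].

Definition detour_loops (query : seq expr) : seq emit_loop :=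
  header (times_n 3 (Const 1)) (Add (Mul (Const 2) (var 3)) (times_n 3 (Const 1)))
  :: [seq arcs_loop P | P <- detour_arcs] ++
  [:: (Const 1, query); (var 2, [:: times_n 2 (idx_plus 1)])].

Definition path_query_cmd : seq expr :=
  [:: times_n 2 (Const 0); times_n 3 (Const 0); var 2].

Definition cycle_query_cmd : seq expr := [:: times_n 2 (Const 0); var 2].

Lemma detour_spells G s : loaded G s -> spells s detour_arcs (detour_families G).
Proof.
move=> sG; have [h2 h3 h6 _] := sG; rewrite /detour_arcs /detour_families.
spell_arcs (h2, h3, h6).
1-2: by have [-> -> ->] := loaded_arc sG hi.
all: by congr (_, _, _); lia.
Qed.

Definition is_detour_query (q : seq expr) : Prop :=
  q = path_query_cmd \/ q = cycle_query_cmd.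

Lemma detour_closed q : is_detour_query q -> all loop_closed (detour_loops q).
Proof. by case=> ->. Qed.

Lemma detour_loops_ok G B s q : 1 < nv G -> nv G <= ne G -> room G <= B ->
  loaded G s -> is_detour_query q ->
  loops_fit B s (detour_loops q) /\ build_time s (detour_loops q) <= 500 * ne G.
Proof.
move=> n1 nm rB sG hq; have [h2 h3 h6 _] := sG; have [rn rnm] := room_ge G.
have rQ := @room_heavy G (ltnW n1); have wQ := @heavy_gt0 G; split; last first.
  by case: hq => ->; rewrite /build_time /= /loop_time /= ?h2 ?h3; lia.
have mulB k : k <= nv G -> k * heavy G <= B.
  by move=> kn; have := leq_mul kn (leqnn (heavy G)); lia.
case: hq => ->; rewrite /= /loop_fits /= /at_index /upd /= ?h2 ?h3 ?h6.
all: repeat split; try lia; move=> k kN; rewrite ?andbT; try lia.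
all: try by have := mulB (nv G - k) (leq_subr _ _); lia.
all: try by have := mulB (k + 1); rewrite addn1 => /(_ kN); lia.
all: have [_ -> _] := loaded_arc sG kN.
all: by have := dst_lt kN; lia.
Qed.

Lemma detour_ne G G' : nedges G' = collect (detour_families G) ->
  ne G' = 2 * ne G + 3 * nv G + 1.
Proof. by move=> HE; rewrite -size_nedges HE size_collect /=; lia. Qed.

Lemma detour_weight_le G G' : nedges G' = collect (detour_families G) ->
  all (fun e => e.2 <= nv G * heavy G + heavy G) (edges G').
Proof.
move=> HE; apply: all_weights => u v w.
rewrite HE => /collectP /= H; split_edges; case: H => _ _ ->; try lia.
all: try by have := cost_lt hi; lia.
all: by rewrite -mulSnr leq_mul2r; apply/orP; right; lia.
Qed.

Lemma detour_weights G G' : 1 < nv G -> nedges G' = collect (detour_families G) ->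
  all (fun e => e.2 <= room G) (edges G').
Proof.
move=> n1 HE; have rQ := @room_heavy G (ltnW n1).
by apply: sub_all (detour_weight_le HE) => e; lia.
Qed.

Lemma detour_sum G G' : 1 < nv G -> nv G <= ne G ->
  nedges G' = collect (detour_families G) ->
  20 * \sum_(e <- edges G') e.2 <= room G.
Proof.
move=> n1 nm HE; have w := detour_weight_le HE; set W := _ + _ in w.
have sumW : \sum_(e <- edges G') e.2 <= ne G' * W.
  rewrite /ne; elim: (edges G') w => [|e E IH] /=; first by rewrite big_nil.
  by move=> /andP[eW /IH h]; rewrite big_cons mulSn leq_add.
apply: leq_trans (leq_mul (leqnn 20) sumW) _; rewrite (detour_ne HE) /W.
have -> : nv G * heavy G + heavy G = (nv G + 1) * heavy G by lia.
have -> : room G = 1000 * (nv G + ne G) * ((nv G + 1) * heavy G) by rewrite /room; lia.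
by rewrite mulnA leq_mul2r; apply/orP; right; lia.
Qed.

Lemma detour_built G G' s q : loaded G s -> nv G' = 3 * nv G + 1 ->
  nedges G' = collect (detour_families G) -> built s (detour_loops q) =
  code_graph G' ++ [seq value (at_index s 0) e | e <- q] ++
    [seq 2 * nv G + (i + 1) | i <- iota 0 (nv G)].
Proof.
move=> sG nvG' HE; have [h2 h3 h6 _] := sG.
rewrite /detour_loops (built_header _ (detour_spells sG) HE _ _ nvG' (detour_ne HE)).
- rewrite -cat1s built_cat built_one built_map; congr (_ ++ (_ ++ _)).
  by rewrite /= h2; apply: eq_map => i; rewrite /at_index /upd /= h2.
- by rewrite /= /at_index /upd /= h2.
- by rewrite /= /at_index /upd /= h2 h3; lia.
Qed.

Lemma val_ppath G G' (n0 : 0 < nv G) (nvG' : nv G' = 3 * nv G + 1) :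
  map val (ppath nvG') = [seq 2 * nv G + (i + 1) | i <- iota 0 (nv G)].
Proof.
rewrite /ppath -map_comp -[1]addn0 iotaDl -map_comp; apply/eq_in_map => i.
by rewrite mem_iota => iN; rewrite /= val_pvtx //; lia.
Qed.

Lemma size_ppath G G' (nvG' : nv G' = 3 * nv G + 1) : size (ppath nvG') = nv G.
Proof. by rewrite size_map size_iota. Qed.

Definition detour_off : expr := Mul (Add (var 2) (Const 1)) (var 6).

Lemma detour_off_ok G B s : 1 < nv G -> room G <= B -> loaded G s ->
  [/\ fits B s detour_off, value s detour_off = (nv G + 1) * heavy G &
      (nv G + 1) * heavy G + heavy G + 1 <= B].
Proof.
move=> n1 rB [h2 h3 h6 _]; have [rn rnm] := room_ge G.
have rQ := @room_heavy G (ltnW n1); have wQ := @heavy_gt0 G.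
by rewrite /= h2 h6 mulnDl mul1n; split; lia.
Qed.

(** 2-SiSP and 2-SiSC return a path and not its weight. The call may have destroyed the graph in
    array 20, so it is built again before the path in array 21 is weighed. *)
Definition path_to_weight (q : seq expr) : cmd :=
  If (Fetch 21 (Const 0))
     (Seq (build (detour_loops q)) (path_weight (times_n 2 (Const 0))))
     (set_var 9 (Const 0)).

Lemma wp_path_to_weight G G' B q s (nvG' : nv G' = 3 * nv G + 1) o :
  1 < nv G -> nv G <= ne G -> room G <= B -> is_detour_query q ->
  nedges G' = collect (detour_families G) -> loaded G s ->
  holds s 21 (code_opt_vertices o) ->
  (forall p, o = Some p -> uniq (pvtx nvG' 0 :: p)) ->
  wp B (path_to_weight q) [::] (1000 * ne G) (fun s' => loaded G s' /\
     s' 9 0 = code_value (omap (weight (pvtx nvG' 0)) o)) s.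
Proof.
move=> n1 nm rB hq HE sG h21 uo; have [rn rnm] := room_ge G.
have [ft bt] := detour_loops_ok n1 nm rB sG hq.
have bE := detour_built q sG nvG' HE; have gt0 : 0 < ne G by lia.
have -> : 1000 * ne G = (1000 * ne G - 1).+1 by lia.
apply: wp_if => _; split=> //=; case: o uo h21 => [p|] up h21; last first.
  have w : wp B (set_var 9 (Const 0)) [::] 1 (fun s' => loaded G s' /\ s' 9 0 = 0) s.
    by apply: wp_set => _; split=> //; split=> //.
  by rewrite h21 //=; apply: wp_weak w _ _ => //; lia.
rewrite h21 //=.
suff w : wp B (Seq (build (detour_loops q)) (path_weight (times_n 2 (Const 0)))) [::]
    (500 * ne G + (10 + 8 * (nv G' + ne G')))
    (fun s' => loaded G s' /\ s' 9 0 = (weight (pvtx nvG' 0) p).+1) s.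
  by apply: wp_weak w _ _ => //; rewrite nvG' (detour_ne HE); lia.
have B1 : 1 < B by lia.
apply: wp_seq; apply: wp_weak (wp_build B1 (detour_closed hq) ft _) bt _.
  rewrite bE !size_cat size_code_graph size_map size_map size_iota (detour_ne HE).
  by case: hq => -> /=; lia.
move=> s1 [h20 hf]; rewrite bE in h20.
have s1G : loaded G s1.
  by apply: loaded_eq sG => a i; rewrite !inE => ha; rewrite hf // !inE; lia.
have [h2 _ _ _] := s1G.
apply: wp_weak (wp_path_weight (x := pvtx nvG' 0) (p := p) _ h20 _ _ _ _ _) (leqnn _) _.
- exact: up.
- by move=> i il; rewrite hf // h21.
- by [].
- by rewrite /= h2; lia.
- by rewrite /= h2 -[nat_of_ord _]/(val _) val_pvtx //; lia.
- have := detour_sum n1 nm HE; have := detour_ne HE; have := nvG'.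
  by move: (\sum_(_ <- _) _) => S hS; lia.
move=> s2 [h9 hf2]; split; last by rewrite h9.
by apply: loaded_eq s1G => a i; rewrite !inE => ha; rewrite hf2 // !inE; lia.
Qed.

Lemma replacement_reduction : list_reduction replacement_paths
  (detour_loops path_query_cmd) Skip 21 (var 2) detour_off.
Proof.
split=> // G n1 nm; have [rn rnm] := room_ge G; have n0 := ltnW n1.
have [G' [nvG' HE]] := detour_graph n0; have neG' := detour_ne HE.
pose x := PathInstance (pvtx nvG' 0) (pvtx nvG' (nv G)) (ppath nvG').
exists x; rewrite [graph _]/=; split.
- exact: shortest_ppath.
- by rewrite nvG' neG'; lia.
- by rewrite nvG' neG'; lia.
- exact: detour_weights.
move=> B d s rB sG dG; have hq : is_detour_query path_query_cmd by left.
have [ft bt] := detour_loops_ok n1 nm rB sG hq; have [h2 _ _ _] := sG.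
have bE : built s (detour_loops path_query_cmd) =
    code_graph G' ++ query (p := replacement_paths) x.
  rewrite (detour_built _ sG nvG' HE) /= /path_query /code_vertices /= !val_pvtx //.
  rewrite size_ppath val_ppath // /at_index /upd /= h2.
  by have -> : 3 * nv G + 0 = 2 * nv G + nv G by lia.
split=> //.
- by apply: leq_trans bt _; lia.
- rewrite bE size_cat size_code_graph neG' /= /code_vertices /= size_map size_ppath.
  by lia.
move=> l s' [de deP ->] sG' hl; apply: wp_skip; first by lia.
split=> //; have [fo vo oB] := detour_off_ok n1 rB sG'; have [h2' _ _ _] := sG'.
exists [seq code_value (de e) | e <- consecutive (pvtx nvG' 0) (ppath nvG')].
rewrite vo; split=> //.
- by rewrite /= h2' size_map consecutive_ppath size_map size_iota.
- by rewrite size_map consecutive_ppath size_map size_iota; lia.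
split=> //; split=> //; exact: replacement_reveals.
Qed.

Lemma path_reduction (Q : problem)
    (inst : forall G (x : 'I_(nv G)), 'I_(nv G) -> seq 'I_(nv G) -> instance Q) q :
  is_detour_query q ->
  (forall G x y p, graph (@inst G x y p) = G) ->
  (forall G G' (nvG' : nv G' = 3 * nv G + 1), 0 < nv G ->
     nedges G' = collect (detour_families G) ->
     let x := @inst G' (pvtx nvG' 0) (pvtx nvG' (nv G)) (ppath nvG') in
     [/\ valid x, size (query x) <= nv G + 3,
         forall s, loaded G s ->
           query x = [seq value (at_index s 0) e | e <- q] ++ map val (ppath nvG') &
         forall l, answer x l -> exists2 o, l = code_opt_vertices o &
           optimal (second_path nvG') (weight (pvtx nvG' 0)) o]) ->
  list_reduction Q (detour_loops q) (path_to_weight q) 9 (Const 1) detour_off.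
Proof.
move=> hq gE instP; split=> //; first exact: detour_closed.
move=> G n1 nm; have [rn rnm] := room_ge G; have n0 := ltnW n1.
have [G' [nvG' HE]] := detour_graph n0; have neG' := detour_ne HE.
have [xv xq qE xA] := instP G G' nvG' n0 HE.
set x := inst _ _ _ _ in xv xq qE xA; exists x.
have gx : graph x = G' by exact: gE.
rewrite gx; split=> //.
- by rewrite nvG' neG'; lia.
- by rewrite nvG' neG'; lia.
- exact: detour_weights.
move=> B d s rB sG dG.
have [ft bt] := detour_loops_ok n1 nm rB sG hq.
have bE : built s (detour_loops q) = code_graph G' ++ query x.
  by rewrite (detour_built _ sG nvG' HE) (qE s sG) val_ppath.
split=> //.
- by apply: leq_trans bt _; lia.
- by rewrite bE size_cat size_code_graph neG'; lia.
move=> l s' /xA[o -> oP] sG' hl.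
have uo p : o = Some p -> uniq (pvtx nvG' 0 :: p).
  by move=> op; move: oP; rewrite op => -[[/and3P[]]].
apply: wp_weak (wp_path_to_weight n1 nm rB hq HE sG' hl uo) (leqnn _) _.
move=> s2 [sG2 h9]; split=> //; have [fo vo oB] := detour_off_ok n1 rB sG2.
exists [:: code_value (omap (weight (pvtx nvG' 0)) o)]; rewrite vo; split=> //=.
- by case.
- by lia.
- by lia.
by split=> //; split=> //; exact: second_reveals.
Qed.

Lemma two_sisp_reduction : list_reduction two_sisp
  (detour_loops path_query_cmd) (path_to_weight path_query_cmd) 9 (Const 1) detour_off.
Proof.
apply: (@path_reduction two_sisp PathInstance); [by left | by [] |].
move=> G G' nvG' n0 HE x; split.
- exact: shortest_ppath.
- by rewrite /= /path_query /= size_map size_ppath addn3.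
- move=> s [h2 _ _ _]; rewrite /= /path_query /code_vertices /= !val_pvtx // size_ppath.
  rewrite /at_index /upd /= h2.
  by have -> : 3 * nv G + 0 = 2 * nv G + nv G by lia.
by move=> l [o oP ->]; exists o.
Qed.

Lemma two_sisc_reduction : list_reduction two_sisc
  (detour_loops cycle_query_cmd) (path_to_weight cycle_query_cmd) 9 (Const 1) detour_off.
Proof.
apply: (@path_reduction two_sisc (fun G x _ p => CycleInstance x p)); [by right | by [] |].
move=> G G' nvG' n0 HE x; split.
- exact: shortest_cycle_ppath.
- by rewrite /= size_map size_ppath; lia.
- move=> s [h2 _ _ _]; rewrite /= /code_vertices /= !val_pvtx // size_ppath.
  by rewrite /at_index /upd /= h2.
by move=> l [o oP ->]; exists o => //; exact: second_cycle_reveals oP.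
Qed.

(** * Randomized binary search *)

Section Machine.
Variable B : nat.

Definition log_loop (cnt pw : nat) (e : expr) : cmd :=
  Seq (set_var pw (Const 1))
 (Seq (set_var cnt (Const 0))
      (While (Sub e (var pw)) (Seq (set_var pw (Mul (Const 2) (var pw))) (incr cnt)))).

Lemma wp_log_loop cnt pw e X s :
  cnt != pw -> all (fun a => a \notin [:: cnt; pw]) (reads e) ->
  fits B s e -> value s e = X -> 0 < X -> 2 * X < B ->
  wp B (log_loop cnt pw e) [::] (3 + 3 * up_log 2 X)
    (fun s' => [/\ s' cnt 0 = up_log 2 X, s' pw 0 = 2 ^ up_log 2 X &
       forall a i, a \notin [:: cnt; pw] -> s' a i = s a i]) s.
Proof.
move=> cp /allP ce fe ve X0 XB; set b := up_log 2 X.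
have pc : (pw == cnt) = false by rewrite eq_sym (negPf cp).
have loop d k s1 : k + d = b -> s1 cnt 0 = k -> s1 pw 0 = 2 ^ k ->
    (forall a i, a \notin [:: cnt; pw] -> s1 a i = s a i) ->
    wp B (While (Sub e (var pw)) (Seq (set_var pw (Mul (Const 2) (var pw))) (incr cnt)))
       [::] (1 + 3 * d)
       (fun s' => [/\ s' cnt 0 = b, s' pw 0 = 2 ^ b &
          forall a i, a \notin [:: cnt; pw] -> s' a i = s a i]) s1.
  { elim: d k s1 => [|d IH] k s1 kb hc hp hf bs.
  all: have E a : a \in reads e -> s1 a =1 s a by move=> /ce ha i; exact: hf.
  all: have fs : fits B s1 (Sub e (var pw)) by rewrite /= (fits_eq _ E) fe.
  all: have vs : value s1 (Sub e (var pw)) = X - 2 ^ k by rewrite /= (value_eq E) ve hp.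
    rewrite addn0 in kb; exists 1, s1; rewrite -kb; split=> // w; apply: exec_while_stop.
    rewrite (eval_value bs fs) vs; congr Some; apply/eqP; rewrite subn_eq0 kb.
    exact: up_logP.
  have kX : 2 ^ k < X.
    by rewrite ltnNge; apply/negP => /(up_log_min (ltnSn 1)); rewrite -/b; lia.
  have step : wp B (Seq (set_var pw (Mul (Const 2) (var pw))) (incr cnt)) [::] 2
      (fun s2 => [/\ s2 cnt 0 = k.+1, s2 pw 0 = 2 ^ k.+1 &
         forall a i, a \notin [:: cnt; pw] -> s2 a i = s a i]) s1.
    apply: (@wp_seq B _ _ 1 1); apply: wp_set => _ /=; rewrite hp; split; first by lia.
    have hc' : upd s1 pw 0 (2 * 2 ^ k) cnt 0 = k by rewrite upd_other.
    apply: wp_set => _ /=; rewrite hc'; split; first by have := ltn_expl k (ltnSn 1); lia.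
    split=> [||a i].
    - by rewrite /upd !eqxx addn1.
    - by rewrite upd_other ?pc // /upd !eqxx expnS.
    - rewrite !inE negb_or => /andP[ac ap].
      by rewrite !upd_other // hf // !inE negb_or ac.
  have [t [s2 [t2 [hc2 hp2 hf2] bs2 x]]] := step bs.
  have kd : k.+1 + d = b by rewrite addSnnS.
  have [t' [s3 [t3 post bs3 x']]] := IH k.+1 s2 kd hc2 hp2 hf2 bs2.
  exists (t + t').+1, s3; split=> //; first by lia.
  move=> w; apply: (@exec_while_loop _ _ _ _ _ (X - 2 ^ k).-1) (x w) (x' w).
  by rewrite (eval_value bs fs) vs; congr Some; lia. }
rewrite -[3 + _]/(1 + (1 + (1 + 3 * b))).
apply: wp_seq; apply: wp_set => _; split=> /=; first by lia.
apply: wp_seq; apply: wp_set => _; split=> //=; apply: (loop b 0) => //.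
- by rewrite /upd !eqxx.
- by rewrite /upd pc !eqxx.
- move=> a i; rewrite !inE negb_or => /andP[ac ap].
  by rewrite !upd_other.
Qed.

Definition random_bits : cmd :=
  for_ 8 (var 17) (Seq (Flip 9 (Const 0))
                       (set_var 7 (Add (Mul (Const 2) (var 7)) (var 9)))).

Lemma wp_random_bits blk s :
  2 * 2 ^ size blk + size blk < B -> s 7 0 = 0 -> s 17 0 = size blk ->
  wp B random_bits blk (2 + size blk * 4)
    (fun s' => s' 7 0 = bits blk /\
       forall a i, a \notin [:: 7; 8; 9] -> s' a i = s a i) s.
Proof.
move=> bB h7 h17.
have coins : flatten [seq [:: nth false blk j] | j <- iota 0 (size blk)] = blk.
  rewrite -[RHS](mkseq_nth false) /mkseq.
  by elim: (iota _ _) => //= j l ->.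
pose I k s' := s' 7 0 = bits (take k blk) /\
  forall a i, a \notin [:: 7; 8; 9] -> s' a i = s a i.
rewrite -{1}coins; apply: wp_weak (@wp_for_coins B 8 (var 17) _ _ I _ 2 s _ _ _ _ _) _ _ => //.
- by lia.
- move=> s' v k [h1 h2]; split=> [|a i ha]; first by rewrite /upd /= h1.
  by rewrite upd_other ?h2 //; move: ha; rewrite !inE !negb_or => /and3P[].
- by move=> s' k [_ h2]; split=> //=; rewrite h2.
- move=> s' k kb [h1 h2] ik; apply: (@wp_seq_coins B _ _ [:: nth false blk k] [::] 1 1).
  have bl := bits_lt (take k blk); rewrite size_takel ?(ltnW kb) // in bl.
  have p2 : 2 ^ k * 2 <= 2 ^ size blk by rewrite -expnSr leq_exp2l.
  apply: wp_flip; first by lia.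
  move=> _; split=> //; set c := nth false blk k.
  apply: wp_set => _ /=; rewrite (_ : upd s' 9 0 c 7 0 = bits (take k blk)) //.
  rewrite (_ : upd s' 9 0 c 9 0 = c) //; split; first by case: (c) => /=; lia.
  split; last by rewrite /upd /= ik.
  split; first by rewrite (take_nth false kb) /bits foldl_rcons.
  move=> a i; rewrite !inE !negb_or => /and3P[a7 a8 a9].
  by rewrite !upd_other // h2 // !inE !negb_or a7 a8.
- by split; rewrite ?take0.
- by rewrite /I take_size.
Qed.

End Machine.

Section NoisyCode.
Variable G : digraph.
Variables (b S : nat) (u : seq bool).
Local Notation H := (@noisy G b S u).

Lemma edge_rank_nth (x0 : 'I_(nv G) * 'I_(nv G) * nat) i : i < ne G ->
  edge_rank (nth x0 (edges G) i).1 = i.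
Proof.
move=> im; rewrite /edge_rank -(nth_map _ x0.1 (fun e => e.1)) //.
by rewrite index_uniq ?size_map // edges_uniq.
Qed.

Lemma ne_noisy : ne H = ne G. Proof. exact: ne_reweight. Qed.

Lemma nth_noisy i : i < ne G ->
  [/\ src H i = src G i, dst H i = dst G i &
      cost H i = cost G i * S + bits (block b i u)].
Proof.
move=> im; have iM : i < size (edges G) by [].
case E : (edges G) iM => [//|e0 E0] iM; rewrite -E in iM.
have HN : nth (0, 0, 0) (nedges H) i =
    (let e := nth e0 (edges G) i in
     (val e.1.1, val e.1.2, e.2 * S + bits (block b i u))).
  rewrite /nedges /= -map_comp (nth_map e0) //= /perturb /noise edge_rank_nth //.
have GN : nth (0, 0, 0) (nedges G) i =
    (let e := nth e0 (edges G) i in (val e.1.1, val e.1.2, e.2)).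
  by rewrite /nedges (nth_map e0).
by rewrite /src /dst /cost HN GN.
Qed.

End NoisyCode.

Section Randomize.
Variable B : nat.

(* Every weight w in array 20 becomes w S + r, where S is in 18 and r consists of
   as many random bits as 17 tells. *)
Definition randomize : cmd :=
  for_ 4 (Fetch 20 (Const 1))
    (Seq (set_var 7 (Const 0))
    (Seq random_bits
         (Store 20 (Add (Mul (Const 3) (var 4)) (Const 4))
                   (Add (Mul (earc 4) (var 18)) (var 7))))).

Lemma coins_blocks b M (u : seq bool) : size u = b * M ->
  flatten [seq block b i u | i <- iota 0 M] = u.
Proof.
elim: M u => [|M IH] u uM; first by apply/esym/size0nil; rewrite uM muln0.
rewrite -[in RHS](cat_take_drop b u) /= {1}/block muln0 drop0; congr (_ ++ _).
rewrite -[RHS](IH (drop b u)); last by rewrite size_drop uM mulnS addKn.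
rewrite -[1]addn0 iotaDl -map_comp; congr flatten; apply: eq_map => i /=.
by rewrite /block drop_drop mulnDr muln1 addnC.
Qed.

(** Exactly [u] is consumed, one block per edge in the order of the list, so the graph obtained is
    [noisy] for the very [u] counted by the isolation lemma. *)
Lemma wp_randomize G b S u l s :
  size u = b * ne G -> s 17 0 = b -> s 18 0 = S -> holds s 20 (code_graph G ++ l) ->
  2 * 2 ^ b + b < B -> 3 * ne G + 6 < B ->
  (forall i, i < ne G -> cost G i * S + 2 ^ b <= B) ->
  wp B randomize u (2 + ne G * (6 + 4 * b))
    (fun s' => holds s' 20 (code_graph (@noisy G b S u) ++ l) /\
       forall a i, a \notin [:: 4; 7; 8; 9; 20] -> s' a i = s a i) s.
Proof.
move=> uM h17 h18 h20 bB mB cB; set m := ne G in uM mB cB *; set H := @noisy G b S u.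
pose cell k i := if i < k then cost H i else cost G i.
pose I k s' := [/\ forall i, i < m -> s' 20 (3 * i + 4) = cell k i,
  forall j, (forall i, i < m -> j <> 3 * i + 4) -> s' 20 j = s 20 j &
  forall a i, a \notin [:: 4; 7; 8; 9; 20] -> s' a i = s a i].
have hm : s 20 1 = m by rewrite h20 // size_cat size_code_graph; lia.
rewrite -{1}(coins_blocks uM).
apply: wp_weak (@wp_for_coins B 4 _ _ m I (fun i => block b i u)
  (1 + ((2 + b * 4) + 1)) s _ _ _ _ _) _ _.
- by lia.
- move=> s' v k [h1 h2 h3]; split=> [i im|j hj|a i ha].
  + by rewrite upd_other // h1.
  + by rewrite upd_other // h2.
  + by rewrite upd_other ?h3 //; move: ha; rewrite !inE !negb_or => /and5P[].
- move=> s' k [h1 h2 _]; split=> /=; [lia | rewrite h2 // => i im; lia].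
- move=> s' k km [h1 h2 h3] ik.
  have sb := size_block uM km; have bl := bits_lt (block b k u); rewrite sb in bl.
  rewrite -[block b k u]/([::] ++ block b k u).
  apply: wp_seq_coins; apply: wp_set => _; split=> //=; set s1 := upd _ _ _ _.
  rewrite -[block b k u]cats0; apply: wp_seq_coins.
  apply: wp_weak (wp_random_bits (blk := block b k u) (s := s1) _ _ _) _ _.
  + by rewrite sb.
  + by rewrite /s1 /upd.
  + by rewrite /s1 upd_other // h3 // h17 sb.
  + by rewrite sb.
  move=> s2 [h7 hf]; have s2s a i : a \notin [:: 4; 7; 8; 9] -> s2 a i = s' a i.
    rewrite !inE !negb_or => /and4P[a4 a7 a8 a9].
    by rewrite hf ?inE ?negb_or ?a7 ?a8 // /s1 upd_other.
  have i2 : s2 4 0 = k by rewrite hf // /s1 upd_other.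
  have [_ _ cH] := @nth_noisy G b S u k km.
  have hk : s2 20 (3 * k + 4) = cost G k by rewrite s2s // h1 // /cell ltnn.
  have h18' : s2 18 0 = S by rewrite s2s // h3.
  have cBk := cB k km; apply: wp_store => _ /=; rewrite i2 hk h18' h7 -cH.
  split; [by lia | by lia |]; split; last by rewrite upd_other.
  split=> [i im|j hj|a i].
  + rewrite /upd /=; case: eqP => [ij|ij].
      have -> : i = k by lia.
      by rewrite /cell ltnSn.
    by rewrite s2s // h1 // /cell; have -> : (i < k.+1) = (i < k) by lia.
  + rewrite /upd /=; case: eqP => [jk|_]; first by case: (hj k km).
    by rewrite s2s // h2.
  + rewrite !inE !negb_or => /and5P[a4 a7 a8 a9 a20].
    by rewrite upd_other // s2s ?h3 // ?inE ?negb_or ?a4 ?a7 ?a8 ?a9.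
- by split=> // i im; have [_ _ ->] := holds_arc h20 im.
- by lia.
move=> s' [h1 h2 h3]; split=> // j; rewrite size_cat size_code_graph ne_noisy -/m => jl.
have [lt2|ge2] := ltnP j 2.
  rewrite h2; last by move=> i _; lia.
  rewrite h20; last by rewrite size_cat size_code_graph -/m.
  by rewrite !code_graphE ne_noisy; case: j lt2 {jl} => [|[|]].
have [big|small] := leqP (3 * m + 2) j.
  rewrite h2; last by move=> i im; lia.
  rewrite h20; last by rewrite size_cat size_code_graph -/m.
  by rewrite !nth_cat !size_code_graph ne_noisy -/m ltnNge big /=.
pose i := (j - 2) %/ 3; have im : i < m by rewrite /i; lia.
have [sH dH cH] := @nth_noisy G b S u i im.
have im' : i < ne H by rewrite ne_noisy.
have [n2 n3 n4] := nth_code_graph l im'; have [o2 o3 o4] := holds_arc h20 im.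
have [jE|[jE|jE]] : j = 3 * i + 2 \/ j = 3 * i + 3 \/ j = 3 * i + 4 by rewrite /i; lia.
- by rewrite jE n2 sH h2 // => i' _; lia.
- by rewrite jE n3 dH h2 // => i' _; lia.
- by rewrite jE n4 h1 // /cell im.
Qed.

End Randomize.

(* The variables 12 and 13 enclose the least cycle weight, 14 is the threshold that
   is tried, 15 bounds the number of rounds, 17 is the number of random bits per
   edge, 18 the factor by which weights are scaled to make room for them, and 19
   the number of vertices. *)
Definition padding : expr := Mul (Mul (Const 2) (var 15)) (var 2).

Definition between_arcs : seq arcs_cmd :=
  [:: (var 3, (esrc, edst, Mul (Const 2) ecost));
      (var 3, (esrc, Add (var 2) edst, Mul (Const 2) ecost));
      (var 2, (times_n 2 idx, idx, Const 0));
      (var 2, (times_n 2 idx, times_n 3 idx, Const 0));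
      (var 2, (times_n 2 idx, times_n 4 (idx_plus 2), Const 0));
      (var 2, (times_n 2 idx, times_n 5 (Const 2),
               Add (Mul (Const 2) (var 14)) (Const 1)));
      (var 2, (times_n 3 (idx_plus 1), times_n 3 idx, Const 0));
      (var 2, (times_n 3 (idx_plus 1), Add (var 2) idx, Const 0));
      (var 2, (times_n 4 (idx_plus 1), times_n 4 (idx_plus 2), Const 0));
      (var 2, (times_n 4 (idx_plus 1), Add (var 2) idx, Const 0));
      (var 2, (times_n 5 (Const 2), Add (var 2) idx, Const 0));
      (padding, (times_n 5 (idx_plus 3), times_n 5 (idx_plus 4), Const 0))].

Definition between_loops : seq emit_loop :=
  header (var 19) (Add (Mul (Const 2) (var 3)) (times_n 9 padding))
  :: [seq arcs_loop P | P <- between_arcs] ++ [:: (Const 1, [:: times_n 5 (Const 2)])].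

Definition search_step (P : cmd) : cmd :=
  Seq (set_var 14 (Div (Add (var 12) (var 13)) (Const 2)))
 (Seq (build between_loops)
 (Seq randomize
 (Seq (shift_cmd 20 P)
      (If (Sub (var 2) (Fetch 21 (Const 0)))
          (set_var 13 (var 14)) (set_var 12 (Add (var 14) (Const 1))))))).

Definition vertices_number5 : expr :=
  Mul (Mul (Mul (Mul (var 19) (var 19)) (var 19)) (var 19)) (var 19).

Definition search_init : cmd :=
  Seq (log_loop 15 16 (Add (var 6) (Const 1)))
 (Seq (set_var 19 (times_n 5 (Add (Const 4) padding)))
 (Seq (log_loop 17 16 vertices_number5)
 (Seq (set_var 18 (Mul (var 19) (var 16)))
 (Seq (set_var 12 (Const 0)) (set_var 13 (var 6)))))).

Definition search_end : cmd :=
  If (Sub (var 6) (var 12)) (set_var 1 (Add (var 12) (Const 1))) (set_var 1 (Const 0)).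

Definition search (P : cmd) : cmd :=
  Seq setup (Seq search_init
    (Seq (While (Sub (var 13) (var 12)) (search_step P)) search_end)).

(** * Correctness and error of the binary search *)

Section Search.
Variables (B : nat) (G : digraph).
Local Notation n := (nv G).
Local Notation m := (ne G).
Local Notation Q := (heavy G).
Hypothesis n_gt1 : 1 < n.
Hypothesis n_le_m : n <= m.

(** The search distinguishes the Q + 1 values 0..Q of [odflt Q d]. *)
Definition rounds : nat := up_log 2 (Q + 1).
(** With N vertices the whole search fails with probability at most 2 * rounds / N, which this
    choice brings below 1/n. *)
Definition pad_size : nat := 2 * rounds * n.
Definition vertices_number : nat := 5 * n + 4 + pad_size.
Definition arcs_number : nat := 2 * m + 9 * n + pad_size.
Definition noise_bits : nat := up_log 2 (vertices_number ^ 5).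
Definition scale : nat := vertices_number * 2 ^ noise_bits.

Lemma between_ne l G' : nedges G' = collect (between_families G l pad_size) ->
  ne G' = arcs_number.
Proof. by move=> HE; rewrite -size_nedges HE size_collect /= /arcs_number; lia. Qed.

Lemma arcs_le : arcs_number <= vertices_number ^ 2.
Proof.
have [G' [nvG' HE]] := @between_graph G (ltnW n_gt1) 0 pad_size.
by have := ne_le G'; rewrite (between_ne HE) nvG'.
Qed.

Lemma sizes : [/\ vertices_number ^ 5 <= 2 ^ noise_bits, 2 ^ noise_bits <= scale,
  vertices_number <= vertices_number ^ 5, arcs_number <= vertices_number ^ 5
  & rounds <= vertices_number].
Proof.
have N0 : 0 < vertices_number by rewrite /vertices_number; lia.
split.
- exact: up_logP.
- by rewrite /scale leq_pmull.
- by rewrite -{1}[vertices_number]expn1 leq_pexp2l.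
- by apply: leq_trans arcs_le _; rewrite leq_pexp2l.
- rewrite /vertices_number /pad_size.
  have : rounds * 1 <= rounds * n by rewrite leq_mul2l ltnW ?orbT.
  by rewrite -mulnA; lia.
Qed.

Lemma noise_bits_le : noise_bits <= 2 ^ noise_bits.
Proof. by rewrite ltnW // ltn_expl. Qed.

Hypothesis B_ge : (8 * Q + 100) * scale <= B.

Definition searching (lo hi : nat) (s : store) : Prop :=
  [/\ loaded G s, s 15 0 = rounds, s 17 0 = noise_bits,
      s 18 0 = scale /\ s 19 0 = vertices_number & s 12 0 = lo /\ s 13 0 = hi].

Lemma searching_eq lo hi s s' :
  (forall a i, a \in [:: 0; 2; 3; 6; 12; 13; 15; 17; 18; 19] -> s' a i = s a i) ->
  searching lo hi s -> searching lo hi s'.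
Proof.
move=> E [l h15 h17 [h18 h19] [h12 h13]]; rewrite /searching !E //; split=> //.
by apply: loaded_eq l => a i; rewrite !inE => ha; rewrite E // !inE; lia.
Qed.

Lemma between_spells s lo hi mid : searching lo hi s -> s 14 0 = mid ->
  spells s between_arcs (between_families G mid pad_size).
Proof.
move=> [sG h15 h17 _ _] h14; have [h2 h3 h6 _] := sG.
rewrite /between_arcs /between_families.
have pE : 2 * s 15 0 * s 2 0 = pad_size by rewrite h15 h2.
spell_arcs (pE, h2, h3, h6, h14).
1-2: by have [-> -> ->] := loaded_arc sG hi0.
all: by congr (_, _, _); lia.
Qed.

Lemma between_loops_ok s lo hi mid : searching lo hi s -> s 14 0 = mid -> mid <= Q ->
  loops_fit B s between_loops /\ build_time s between_loops <= 1000 * arcs_number.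
Proof.
move=> [sG h15 h17 [_ h19] _] h14 mQ; have [h2 h3 h6 _] := sG.
have pE : 2 * s 15 0 * s 2 0 = pad_size by rewrite h15 h2.
have pE' : 2 * rounds * n = pad_size by [].
have [s1 s2 s3 s4 s5] := sizes.
have SB : 100 * scale + 8 * Q <= B.
  have S0 : 0 < scale by apply: leq_trans s2; rewrite expn_gt0.
  have QS := leq_pmulr Q S0; apply: leq_trans B_ge; rewrite mulnDl -mulnA.
  by lia.
have aE : arcs_number = 2 * m + 9 * n + pad_size by [].
have oE : vertices_number = 5 * n + 4 + pad_size by [].
split; last first.
  by rewrite /build_time /= /loop_time /= pE ?h2 ?h3; lia.
rewrite /= /loop_fits /= /at_index /upd /= pE ?h2 ?h3 ?h6 ?h14 ?h15 ?h19 ?pE'.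
repeat split; try lia; move=> k kN; rewrite ?andbT; try lia.
all: have [_ dE cE] := loaded_arc sG kN; rewrite ?dE ?cE.
all: by have := cost_lt kN; have := dst_lt kN; lia.
Qed.

Lemma between_built s lo hi mid G' :
  searching lo hi s -> s 14 0 = mid -> nv G' = vertices_number ->
  nedges G' = collect (between_families G mid pad_size) ->
  built s between_loops = code_graph G' ++ [:: 5 * n + 2].
Proof.
move=> sG h14 nvG' HE; have [[h2 h3 h6 _] h15 h17 [_ h19] _] := sG.
have pE : 2 * s 15 0 * s 2 0 = pad_size by rewrite h15 h2.
rewrite /between_loops (built_header _ (between_spells sG h14) HE _ _ nvG' (between_ne HE)).
- by rewrite built_one /= /at_index /upd /= h2.
- by rewrite /= /at_index /upd /= h19.
- by rewrite /= /at_index /upd /= pE h2 h3 /arcs_number; lia.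
Qed.

Lemma between_weight_le mid G' : mid <= Q ->
  nedges G' = collect (between_families G mid pad_size) ->
  forall i, i < ne G' -> cost G' i <= 2 * Q + 1.
Proof.
move=> mQ HE i iM; have := ith_edge iM; rewrite /edge HE => /collectP /= H.
split_edges; case: H => _ _ ->; try lia.
all: by have := cost_lt hi; lia.
Qed.

Variable P : cmd.
Variables (T : nat) (d : option nat).
Hypothesis P_solves : forall x : instance betweenness_centrality,
  valid x -> nv (graph x) = vertices_number -> ne (graph x) = arcs_number ->
  all (fun e => e.2 <= (2 * Q + 2) * scale) (edges (graph x)) -> solves_in P B T x.
Hypothesis min_d : is_min_cycle_weight G d.

Definition step_time : nat :=
  1 + (1000 * arcs_number + ((2 + arcs_number * (6 + 4 * noise_bits)) + (T + 2))).

(** The error 2 is one tie among shortest paths plus one wrong answer of the call; building and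
    comparing are deterministic. *)
Lemma search_step_good lo hi s :
  lo < hi <= Q -> lo <= odflt Q d <= hi -> searching lo hi s ->
  good B 2 vertices_number (search_step P) step_time
    (fun s' => exists lo' hi', [/\ searching lo' hi' s', lo' <= odflt Q d <= hi',
       hi' <= Q & 2 * (hi' - lo') <= hi - lo]) s.
Proof.
move=> /andP[lh hQ] /andP[lD Dh] sG; pose mid := (lo + hi) %/ 2.
have [s1 s2 s3 s4 s5] := sizes; have n0 := ltnW n_gt1.
have S0 : 0 < scale by apply: leq_trans s2; rewrite expn_gt0.
have QS := leq_pmulr Q S0; have nbl := noise_bits_le.
have SB : 100 * scale + 8 * (Q * scale) <= B.
  by apply: leq_trans B_ge; rewrite mulnDl -mulnA; lia.
have mQ : mid <= Q by rewrite /mid; lia.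
have [G' [nvG' HE]] := @between_graph G n0 mid pad_size.
have neG' := between_ne HE; have nvo : nv G' = vertices_number by [].
have o0 : 1 < vertices_number by rewrite /vertices_number; lia.
pose hub := bvtx nvG' (5 * n + 2).
have vhub : val hub = 5 * n + 2 by rewrite val_bvtx //; lia.
have [h12 h13] : s 12 0 = lo /\ s 13 0 = hi by case: sG.
have B1 : 1 < B by lia.
pose R1 s' := searching lo hi s' /\ s' 14 0 = mid.
have R1_eq s1' s2' : (forall a i, a \in [:: 0; 2; 3; 6; 12; 13; 14; 15; 17; 18; 19] ->
    s2' a i = s1' a i) -> R1 s1' -> R1 s2'.
  move=> E [sG' h14]; split; last by rewrite E.
  by apply: searching_eq sG' => a i; rewrite !inE => ha; rewrite E // !inE; lia.
pose R2 s' := R1 s' /\ holds s' 20 (code_graph G' ++ [:: 5 * n + 2]).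
pose H u := @noisy G' noise_bits scale u.
pose R3 s' := R1 s' /\ exists u, unique_shortest_paths (H u) /\
  holds s' 20 (code_graph (H u) ++ [:: 5 * n + 2]).
pose R4 s' := R1 s' /\ exists k, s' 21 0 = k /\ (k < n <-> odflt Q d <= mid).
apply: (@good_weak B (0 + (0 + (1 + (1 + 0)))) _ _ _ step_time _ _ _ _ _ _ (leqnn _));
  [|by []|by move=> s' h; exact: h].
apply: (@good_seq _ _ _ _ _ _ _ _ R1); [by lia|by lia| |].
  apply: good_wp; apply: wp_set => _ /=; rewrite h12 h13; split; first by lia.
  split; last by rewrite /upd /=.
  apply: searching_eq sG => a i; rewrite !inE => ha; rewrite upd_other //; lia.
move=> {sG h12 h13}s1' R1s; have [sG h14] := R1s.
apply: (@good_seq _ _ _ _ _ _ _ _ R2); [by lia|by lia| |].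
  have [ft bt] := between_loops_ok sG h14 mQ; have bE := between_built sG h14 nvG' HE.
  apply: good_wp; apply: wp_weak (wp_build B1 _ ft _) bt _ => //.
    by rewrite bE size_cat size_code_graph neG' /=; lia.
  move=> s2' [h20 hf]; rewrite bE in h20; split=> //.
  by apply: R1_eq R1s => a i; rewrite !inE => ha; rewrite hf // !inE; lia.
move=> {s1' R1s sG h14}s2' [R1s h20]; have [sG h14] := R1s.
apply: (@good_seq _ _ _ _ _ _ _ _ R3); [by lia|by lia| |].
  have cE := between_weight_le mQ HE.
  apply: (@good_coins _ _ _ _ (noise_bits * arcs_number) _
            (fun u => unique_shortest_paths (H u))).
  - by rewrite mulnC; have := leq_mul (leqnn arcs_number) (leq_addl 5 noise_bits); lia.
  - by rewrite mul1n -neG' -nvo; apply: noisy_unique; rewrite nvo.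
  move=> u uL uu; rewrite -neG' in uL.
  have [_ _ h17 [h18 _] _] := sG.
  apply: wp_weak (wp_randomize uL h17 h18 h20 _ _ _) _ _; rewrite ?neG' //.
  - by lia.
  - by lia.
  - move=> i iM; have := cE i; rewrite neG' => /(_ iM) ci.
    have := leq_mul ci (leqnn scale); rewrite mulnDl mul1n -mulnA; lia.
  move=> s3' [h20' hf]; split; last by exists u.
  by apply: R1_eq R1s => a i; rewrite !inE => ha; rewrite hf // !inE; lia.
move=> {s2' R1s sG h14 h20}s3' [R1s [u [uu h20]]].
apply: (@good_seq _ _ _ _ _ _ _ _ R4); [by lia|by lia| |].
  pose x : instance betweenness_centrality :=
    existT (fun G : digraph => 'I_(nv G)) (H u) hub.
  have xsol : solves_in P B T x.
    apply: P_solves => //; first by rewrite /= ne_noisy.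
    apply: all_weights => a c w; rewrite [graph _]/=.
    move=> /edge_ith[i]; rewrite ne_noisy => iM [_ _ ->].
    have [_ _ ->] := nth_noisy noise_bits scale u iM.
    have ci := between_weight_le mQ HE iM.
    have bl : bits (block noise_bits i u) <= scale.
      apply: leq_trans s2; apply: leq_trans (ltnW (bits_lt _)) _.
      by rewrite leq_exp2l // size_take; case: ltnP.
    have := leq_mul ci (leqnn scale); rewrite !mulnDl; lia.
  have xn : 0 < vertices_number <= nv (graph x) by rewrite [nv _]nvo leqnn andbT; lia.
  have h20x : holds s3' 20 (code_graph (graph x) ++ query x).
    by rewrite /= -[nat_of_ord hub]/(val hub) vhub.
  apply: good_weak (good_call (ltnW B1) xn xsol h20x) (leqnn _) (leqnn _) _.
  move=> s4' [[l [k kB ->] h21] hf]; split.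
    by apply: R1_eq R1s => a i; rewrite !inE => ha; rewrite hf //; lia.
  exists k; split; first by rewrite h21.
  have NS : nv G' * 2 ^ noise_bits <= scale by rewrite nvo.
  have r_lt (e : 'I_(nv G') * 'I_(nv G')) : noise noise_bits u e < 2 ^ noise_bits.
    apply: leq_trans (bits_lt _) _.
    by rewrite leq_exp2l // size_take; case: ltnP.
  have := between_count n0 nvG' HE r_lt NS vhub kB.
  move=> kn; rewrite kn; split=> [[v [e [ve el]]]|Dmid].
    by apply: leq_trans (odflt_min_cycle min_d ve) el.
  (* Without a cycle the value would be Q, but mid < hi <= Q. *)
  have := is_min_cycle_weight_least min_d; case: (d) Dmid => [e|] /= eQ; last by lia.
  by move=> [[v ve] _]; exists v, e.
move=> {s3' R1s u uu h20}s4' [[sG h14] [k [h21 kn]]]; apply: good_wp.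
have [[h2 _ _ _] _ _ _ [h12 h13]] := sG.
apply: wp_if => _; rewrite /= h2 h21; split=> //.
have upd_ok c e : c \notin [:: 0; 2; 3; 6; 15; 17; 18; 19] -> 
    [/\ loaded G (upd s4' c 0 e), upd s4' c 0 e 15 0 = rounds,
        upd s4' c 0 e 17 0 = noise_bits &
        upd s4' c 0 e 18 0 = scale /\ upd s4' c 0 e 19 0 = vertices_number].
  case: sG => lG h15 h17 [h18 h19] _ hc.
  split; [|by rewrite upd_other //; move: hc; rewrite !inE; lia..|].
    by apply: loaded_eq lG => a i; rewrite !inE => ha; rewrite upd_other //;
      move: hc; rewrite !inE; lia.
  by split; rewrite upd_other //; move: hc; rewrite !inE; lia.
case: ifP => kn'.
  apply: wp_set => _ /=; rewrite h14; split=> //; exists lo, mid.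
  have [u1 u2 u3 u4] := @upd_ok 13 mid isT.
  have Dm : odflt Q d <= mid by apply/kn; lia.
  by split; [split|rewrite lD Dm|exact: mQ|rewrite /mid; lia].
apply: wp_set => _ /=; rewrite h14; split; first by lia.
exists (mid + 1), hi; have [u1 u2 u3 u4] := @upd_ok 12 (mid + 1) isT.
have Dm : mid < odflt Q d by rewrite ltnNge; apply/negP => /kn; lia.
by split; [split|rewrite addn1 Dm Dh|exact: hQ|rewrite /mid; lia].
Qed.

Lemma search_loop_good i lo hi s :
  hi - lo < 2 ^ i -> 2 * i <= vertices_number -> lo <= odflt Q d <= hi -> hi <= Q ->
  searching lo hi s ->
  good B (2 * i) vertices_number (While (Sub (var 13) (var 12)) (search_step P))
    (1 + i * (step_time + 1))
    (fun s' => loaded G s' /\ s' 12 0 = odflt Q d) s.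
Proof.
have o0 : 3 < vertices_number by rewrite /vertices_number; lia.
elim: i lo hi s => [|i IH] lo hi s lt2 io lDh hQ sG.
all: have [lG _ _ _ [h12 h13]] := sG.
all: have [eq|ne] := eqVneq hi lo.
all: try have stop : wp B (While (Sub (var 13) (var 12)) (search_step P)) [::] 1
    (fun s' => loaded G s' /\ s' 12 0 = odflt Q d) s
  by move=> bs; exists 1, s; split=> [//|||w];
     [split=> //; rewrite h12; lia | by [] |
      apply: exec_while_stop; rewrite (eval_value bs) //= h12 h13 eq subnn].
- by apply: good_weak (good_wp _ stop) _ _ _.
- by move: lt2; rewrite expn0; lia.
- apply: good_weak (good_wp _ stop) _ _ _ => //; lia.
have -> : 2 * i.+1 = 2 + 2 * i by lia.
have -> : 1 + i.+1 * (step_time + 1) = 1 + (step_time + (1 + i * (step_time + 1))).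
  by rewrite mulSn -addnA.
apply: good_loop; [lia|lia|by []|by rewrite /= h12 h13; lia| |].
  by apply: search_step_good (lDh) sG; lia.
move=> s1 [lo' [hi' [sG' lDh' hQ' half]]]; apply: IH sG' => //; last by lia.
by move: lt2; rewrite expnS; lia.
Qed.

Definition init_time : nat := 10 + 3 * rounds + 3 * noise_bits.

Lemma wp_search_init s : loaded G s ->
  wp B search_init [::] init_time (searching 0 Q) s.
Proof.
move=> lG; have [h2 h3 h6 _] := lG.
have [s1 s2 s3 s4 s5] := sizes; have n0 := ltnW n_gt1.
have S0 : 0 < scale by apply: leq_trans s2; rewrite expn_gt0.
have QS := leq_pmulr Q S0; have nbl := noise_bits_le.
have SB : 100 * scale + 8 * (Q * scale) <= B.
  by apply: leq_trans B_ge; rewrite mulnDl -mulnA; lia.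
have pow k : k <= 5 -> vertices_number ^ k <= scale.
  move=> k5; apply: leq_trans (leq_trans s1 s2); rewrite leq_pexp2l // /vertices_number; lia.
have -> : init_time = (3 + 3 * rounds) + (1 + ((3 + 3 * noise_bits) + (1 + (1 + 1)))).
  by rewrite /init_time; lia.
apply: wp_seq; apply: wp_weak (wp_log_loop (X := Q + 1) _ _ _ _ _ _) (leqnn _) _ => //.
- by rewrite /= h6; lia.
- by rewrite /= h6.
- by lia.
- by lia.
move=> s3' [h15 h16 hf3]; have hf3' a i : a \notin [:: 15; 16] -> s3' a i = s a i := hf3 a i.
have E1 : 2 * s3' 15 0 * s3' 2 0 = pad_size by rewrite h15 hf3 // h2.
have oE : vertices_number = 5 * n + 4 + pad_size by [].
have pE : pad_size = 2 * rounds * n by [].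
apply: wp_seq; apply: wp_set => _; rewrite /= E1 hf3 // h2.
have p1 := pow 1 isT; rewrite expn1 in p1; rewrite -/rounds in h15.
split; first by rewrite h15; lia.
have -> : 5 * n + (4 + pad_size) = vertices_number by lia.
set s4' := upd _ _ _ _.
have h19 : s4' 19 0 = vertices_number by rewrite /s4' /upd.
have [p2 p3 p4 p5] := And4 (pow 2 isT) (pow 3 isT) (pow 4 isT) (pow 5 isT).
have E5 : vertices_number * vertices_number * vertices_number *
    vertices_number * vertices_number =
    vertices_number ^ 5.
  by rewrite !expnS expn0; lia.
have E4 : vertices_number * vertices_number * vertices_number *
    vertices_number =
    vertices_number ^ 4.
  by rewrite !expnS expn0; lia.
have E3 : vertices_number * vertices_number * vertices_number = vertices_number ^ 3.
  by rewrite !expnS expn0; lia.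
have E2 : vertices_number * vertices_number = vertices_number ^ 2.
  by rewrite !expnS expn0; lia.
apply: wp_seq.
apply: wp_weak (wp_log_loop (X := vertices_number ^ 5) _ _ _ _ _ _) (leqnn _) _ => //.
- by rewrite /= h19 E5 E4 E3 E2; lia.
- by rewrite expn_gt0 /vertices_number; lia.
- by lia.
move=> s5' [h17 h16' hf5]; apply: wp_seq; apply: wp_set => _.
rewrite /= h16' hf5 // h19 -/noise_bits -/scale; split; first by lia.
apply: wp_seq; apply: wp_set => _; split=> //=.
apply: wp_set => _; split=> //=; set s6 := upd _ _ _ _.
have other a i : a \in [:: 0; 2; 3; 6] -> s6 a i = s a i.
  rewrite !inE => ha; rewrite /s6 !upd_other; try lia.
  by rewrite hf5 ?inE; [rewrite /s4' upd_other ?hf3 ?inE|]; lia.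
split.
- exact: loaded_eq other lG.
- by rewrite /s6 /upd /= hf5 // /s4' /upd /= h15.
- by rewrite /s6 /upd /= h17.
- by rewrite /s6 /upd /= hf5 // h19.
by rewrite /s6 /upd /= hf5 // /s4' /upd /= hf3.
Qed.

Lemma wp_search_end s : loaded G s -> s 12 0 = odflt Q d ->
  wp B search_end [::] 2 (fun s' => s' 1 0 = code_value d) s.
Proof.
move=> [_ _ h6 _] h12; have dcap k : d = Some k -> k < Q.
  by move=> dk; apply: min_cycle_heavy; rewrite -dk; exact: is_min_cycle_weight_least.
apply: wp_if => bs; rewrite /= h6 h12; split=> //.
have QB : Q <= B by rewrite -h6.
case: d dcap h12 => [k|] /= dcap h12; last first.
  by rewrite subnn /=; apply: wp_set.
have kQ := dcap k erefl; rewrite ifT; last by lia.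
by apply: wp_set => _ /=; rewrite h12 /upd /= addn1; split=> //; lia.
Qed.

Definition search_time : nat :=
  (6 + 3 * m) + (init_time + ((1 + rounds * (step_time + 1)) + 2)).

Lemma search_good s : holds s 0 (code_graph G) ->
  good B 1 n (search P) search_time (fun s' => s' 1 0 = code_value d) s.
Proof.
move=> hs; have [s1 s2 s3 s4 s5] := sizes; have n0 := ltnW n_gt1.
have S0 : 0 < scale by apply: leq_trans s2; rewrite expn_gt0.
have QS := leq_pmulr Q S0; have nbl := noise_bits_le.
have SB : 100 * scale + 8 * (Q * scale) <= B.
  by apply: leq_trans B_ge; rewrite mulnDl -mulnA; lia.
have rn : 2 * rounds <= pad_size by rewrite /pad_size leq_pmulr.
have oE : vertices_number = 5 * n + 4 + pad_size by [].
have aE : arcs_number = 2 * m + 9 * n + pad_size by [].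
have : good B (0 + (0 + (2 * rounds + 0))) vertices_number (search P) search_time
    (fun s' => s' 1 0 = code_value d) s.
  apply: (@good_seq _ _ _ _ _ _ _ _ (loaded G)); [by lia|by lia| |].
    by apply: good_wp; apply: wp_setup hs => //; lia.
  move=> {hs}s1' lG; apply: (@good_seq _ _ _ _ _ _ _ _ (searching 0 Q)); [by lia|by lia| |].
    exact: good_wp (wp_search_init lG).
  move=> {lG}s2' sG.
  apply: (@good_seq _ _ _ _ _ _ _ _ (fun s' => loaded G s' /\ s' 12 0 = odflt Q d));
    [by lia|by lia| |].
    apply: search_loop_good sG => //; last first.
    - by rewrite leq0n /=; exact: odflt_min_le.
    - by lia.
    rewrite subn0; have := up_logP (Q + 1) (ltnSn 1); rewrite -/rounds; lia.
  by move=> s3' [lG h12]; apply: good_wp; exact: wp_search_end.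
move=> g bs; have {g} := g bs; rewrite addn0 !add0n subn1.
set c := cnt _ _; set t := 2 ^ _ => H.
(* Passing from 1 - 2 * rounds / N to 1 - 1/n uses that n * (2 * rounds) is the padding, hence at
   most N. *)
have H2 : vertices_number * (n.-1 * t) <= vertices_number * (n * c).
  rewrite [leqRHS]mulnCA; apply: leq_trans (leq_mul (leqnn n) H).
  rewrite !mulnA leq_mul2r; apply/orP; right.
  have : n * (2 * rounds) <= vertices_number by rewrite oE /pad_size mulnC; lia.
  rewrite mulnBr mulnC; case: (n) n0 => // n' _ /=; rewrite mulSn; lia.
by move: H2; rewrite leq_pmul2l //; lia.
Qed.

End Search.

(** * The lower bounds *)

(** A failure probability of at most 1/n < 1 leaves some good noise. It provides the valid instance
    from which [uniform_time] draws its time bound. *)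
Lemma ex_unique_noise (G : digraph) b S :
  1 < nv G -> nv G ^ 5 <= 2 ^ b -> exists u, unique_shortest_paths (@noisy G b S u).
Proof.
move=> n1 bN; apply: contrapT => no; have := noisy_unique S bN.
rewrite cntT => [|u _ uu]; last by apply: no; exists u.
by rewrite leqNgt ltn_Pmull // expn_gt0.
Qed.

Lemma up_log_pow X : 0 < X -> 2 ^ up_log 2 X <= 2 * X.
Proof.
case: X => [//|[_|X _]]; first by rewrite up_log1.
have := up_log_gtn (ltnSn 1) (isT : 1 < X.+2).
case: (up_log 2 X.+2) => [|k] /=; first by rewrite expn0; lia.
by rewrite expnS; lia.
Qed.

(** * Growth of the padded graph, of the words and of the time *)

Section Sizes.
Variables (G : digraph) (c : nat).
Local Notation n := (nv G).
Local Notation m := (ne G).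
Hypothesis n_gt1 : 1 < n.
Hypothesis n_le_m : n <= m.
Hypothesis weights : all (fun e => e.2 <= n ^ c) (edges G).
Local Notation L := (trunc_log 2 n).+1.
Local Notation a := ((2 * c + 21) * L).

Lemma n_lt_L : n < 2 ^ L. Proof. exact: trunc_log_ltn. Qed.

Lemma L_le_n : L <= n.
Proof.
by have := trunc_logP (ltnSn 1) (ltnW n_gt1); apply: leq_trans; exact: ltn_expl.
Qed.

Lemma rounds_le : rounds G <= (c + 5) * L.
Proof.
apply: up_log_min => //; have := heavy_le n_gt1 weights => Qn.
apply: (@leq_trans (n ^ (c + 5))).
  rewrite (_ : c + 5 = (c + 4).+1); last by lia.
  rewrite expnS; have : 0 < n ^ (c + 4) by rewrite expn_gt0; lia.
  have h : 2 * n ^ (c + 4) <= n * n ^ (c + 4) by rewrite leq_mul2r n_gt1 orbT.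
  by lia.
rewrite mulnC expnM leq_exp2r; last by rewrite addn_gt0 orbT.
exact: ltnW n_lt_L.
Qed.

Lemma pad_le : 9 * n + pad_size G <= a * n.
Proof.
rewrite /pad_size -mulnDl leq_mul2r; apply/orP; right.
by have := rounds_le; rewrite !mulnDl; lia.
Qed.

Lemma vertices_number_le : vertices_number G <= a * n.
Proof. by have := pad_le; rewrite /vertices_number; lia. Qed.

(** The constant 21 is 11 + 2 * 5: 2m + 9n is at most 11m, and the padding contributes 2 * rounds <=
    2(c + 5)L. *)
Lemma arcs_number_le : arcs_number G <= a * m.
Proof.
have h : pad_size G <= 2 * rounds G * m by rewrite /pad_size leq_mul2l n_le_m orbT.
have r := rounds_le; rewrite /arcs_number; apply: (@leq_trans ((11 + 2 * rounds G) * m)).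
  by rewrite mulnDl; lia.
by rewrite leq_mul2r; apply/orP; right; move: r; rewrite !mulnDl; lia.
Qed.

Lemma noise_bits_bound : noise_bits G <= 10 * a.
Proof.
apply: up_log_min => //; rewrite (_ : 10 * a = 2 * a * 5); last by lia.
rewrite expnM leq_exp2r //; apply: leq_trans vertices_number_le _.
apply: (@leq_trans (2 ^ (2 * c + 21) * 2 ^ L * 2 ^ L)).
  apply: leq_mul (ltnW n_lt_L); apply: leq_mul; exact: ltnW (ltn_expl _ _).
rewrite -!expnD leq_exp2l //.
have : 2 * c + 21 <= a by rewrite leq_pmulr.
have : 2 * L <= a by rewrite leq_mul2r; lia.
lia.
Qed.

Lemma vertices_number_pow : vertices_number G <= n ^ (2 * c + 23).
Proof.
apply: leq_trans vertices_number_le _; rewrite (_ : 2 * c + 23 = (2 * c + 21) + 1 + 1); last by lia.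
rewrite 2!(expnD _ _ 1) expn1 leq_mul // leq_mul ?L_le_n //.
apply: (@leq_trans (2 ^ (2 * c + 21))); first by rewrite ltnW // ltn_expl.
by rewrite leq_exp2r // addn_gt0 orbT.
Qed.

Lemma heavy_le_pow : heavy G <= vertices_number G ^ (c + 4).
Proof.
apply: leq_trans (heavy_le n_gt1 weights) _; rewrite leq_exp2r ?addn_gt0 ?orbT //.
by rewrite /vertices_number; lia.
Qed.

Lemma scale_le : scale G <= vertices_number G ^ 7.
Proof.
have o14 : 14 <= vertices_number G by rewrite /vertices_number; lia.
rewrite /scale expnS leq_mul2l; apply/orP; right.
apply: leq_trans (up_log_pow _) _; first by rewrite expn_gt0; lia.
by rewrite expnS leq_mul2r; lia.
Qed.

Lemma search_room : (8 * heavy G + 100) * scale G <= vertices_number G ^ (c + 14).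
Proof.
have o14 : 14 <= vertices_number G by rewrite /vertices_number; lia.
have wQ := heavy_gt0 G; rewrite (_ : c + 14 = 3 + (c + 4) + 7); last by lia.
rewrite expnD leq_mul ?scale_le // expnD.
apply: (@leq_trans (108 * heavy G)); first by lia.
rewrite leq_mul ?heavy_le_pow //; apply: (@leq_trans (14 ^ 3)) => //.
by rewrite leq_exp2r.
Qed.

(** The three logarithms are the number of rounds, the growth of the number of edges and the random
    bits per edge. *)
Lemma search_time_le T : search_time G T <= 3000 * (2 * c + 21) ^ 3 * L ^ 3 * (m + T).
Proof.
have r : rounds G <= a.
  by apply: leq_trans rounds_le _; rewrite leq_mul2r; apply/orP; right; lia.
have A := arcs_number_le; have b := noise_bits_bound.
rewrite -(mulnA 3000) -expnMn.
have a0 : 0 < a by rewrite muln_gt0; lia.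
rewrite /search_time /init_time /step_time.
move: (rounds G) (arcs_number G) (noise_bits G) r A b a0 n_le_m n_gt1 => r M b.
move: n m a => n' m' a' ra MA ba a0 nm n1.
have MB : M * (1006 + 4 * b) <= a' * m' * (1046 * a').
  by apply: leq_mul => //; lia.
have step : 1 + (1000 * M + (2 + M * (6 + 4 * b) + (T + 2))) + 1 <=
    1046 * (a' * a' * m') + T + 6.
  have -> : 1046 * (a' * a' * m') = a' * m' * (1046 * a') by lia.
  move: MB; rewrite (_ : 1006 + 4 * b = 1000 + (6 + 4 * b)) // (mulnDr M 1000).
  move: (M * (6 + 4 * b)) (a' * m' * (1046 * a')) => x y; lia.
have rs := leq_mul ra step.
have h1 : a' * m' <= a' ^ 3 * m'.
  by rewrite leq_mul2r -{1}[a']expn1 leq_pexp2l ?orbT.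
have h2 : a' * T <= a' ^ 3 * T.
  by rewrite leq_mul2r -{1}[a']expn1 leq_pexp2l ?orbT.
have h3 : a' <= a' * m' by rewrite leq_pmulr; lia.
have h4 : m' <= a' * m' by rewrite leq_pmull.
have h5 : a' * (1046 * (a' * a' * m') + T + 6) = 1046 * (a' ^ 3 * m') + a' * T + 6 * a'.
  by rewrite !expnS expn0; lia.
rewrite h5 in rs; rewrite [X in _ <= X]mulnDr -!(mulnA 3000).
move: rs h1 h2 h3 h4; move: (r * _) (a' ^ 3 * m') (a' ^ 3 * T) (a' * m') (a' * T).
by move=> *; lia.
Qed.

End Sizes.

Theorem betweenness_reduction (R : realType) :
  has_sub_mn_algorithm R betweenness_centrality -> has_sub_mn_algorithm R min_wt_cycle.
Proof.
move=> [P HP]; exists (search P) => c; have [g [k [sub H]]] := HP (c + 14).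
pose w := 2 * c + 21.
have [g' sub' G'] := sub_mn_blowup (3000 * w ^ 3) 3 sub.
exists g', ((2 * c + 23) * (c + 14 + k)); split=> //= G _ nm ws; have n1 := one_lt_nv nm.
have /andP[n0 nm'] : 0 < nv G <= ne G := nm.
have N1 : 1 < vertices_number G by rewrite /vertices_number; lia.
have NM : 0 < vertices_number G <= arcs_number G.
  by rewrite /vertices_number /arcs_number; lia.
have s1 : vertices_number G ^ 5 <= 2 ^ noise_bits G by exact: up_logP.
have weight_ok (x : instance betweenness_centrality) :
    nv (graph x) = vertices_number G ->
    all (fun e => e.2 <= (2 * heavy G + 2) * scale G) (edges (graph x)) ->
    all (fun e => e.2 <= vertices_number G ^ (c + 14)) (edges (graph x)).
  move=> _; apply: sub_all => e eX; apply: leq_trans eX _.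
  apply: leq_trans (search_room n1 nm' ws); rewrite leq_mul2r; apply/orP; right; lia.
have [|T Tg sol] := uniform_time (N := vertices_number G) (M := arcs_number G) H.
  (* A sample instance of the right size: threshold 0 and scale 0 suffice, since isolation does not
     depend on the scale and the weights are then pure noise. *)
  have [G0 [nvG0 HE]] := @between_graph G n0 0 (pad_size G).
  have nvo : nv G0 = vertices_number G by [].
  have [||u uu] := @ex_unique_noise G0 (noise_bits G) 0; rewrite ?nvo //.
  exists (existT (fun G : digraph => 'I_(nv G)) (noisy G0 (noise_bits G) 0 u)
    (bvtx nvG0 0)).
  split=> //; first by rewrite /= ne_noisy (between_ne n1 nm' HE).
  apply: all_weights => a e v; rewrite [graph _]/=.
  move=> /edge_ith[i]; rewrite ne_noisy => iM [_ _ ->].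
  have [_ _ ->] := nth_noisy (noise_bits G) 0 u iM; rewrite muln0 add0n.
  apply: leq_trans (ltnW (bits_lt _)) _.
  apply: (@leq_trans (2 ^ noise_bits G)).
    by rewrite leq_exp2l // size_take; case: ltnP.
  apply: leq_trans (search_room n1 nm' ws); apply: (@leq_trans (1 * scale G)).
    by rewrite mul1n /scale leq_pmull; lia.
  by rewrite leq_mul2r; apply/orP; right; lia.
exists (search_time G T).
  have a_le x : w * (trunc_log 2 (nv G)).+1 * x <=
      3000 * w ^ 3 * (trunc_log 2 (nv G)).+1 * x.
    rewrite !leq_mul2r; apply/orP; right; apply/orP; right.
    by rewrite -{1}[w]expn1; apply: leq_trans (leq_pmull _ _); rewrite // leq_pexp2l // /w; lia.
  apply: G' (Tg) _ => //.
  - by rewrite (leq_trans (vertices_number_le n1 nm' ws)) ?a_le ?andbT // /vertices_number; lia.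
  - rewrite (leq_trans (arcs_number_le n1 nm' ws)) ?a_le ?andbT // /arcs_number; lia.
  - by case/andP: NM.
  - exact: search_time_le n1 nm' ws _.
move=> B kB; have oB : vertices_number G ^ (c + 14 + k) <= B.
  apply: leq_trans kB; rewrite expnM leq_exp2r ?addn_gt0 ?orbT //.
  exact: vertices_number_pow n1 nm' ws.
have oB1 : vertices_number G ^ (c + 14) <= B.
  by apply: leq_trans oB; rewrite leq_exp2l // leq_addr.
apply: solves_in_cycle => s d dG hs; apply: search_good hs => //.
- exact: leq_trans (search_room n1 nm' ws) oB1.
move=> x xv xn xm xw; apply: sol => //; first exact: weight_ok.
by apply: leq_trans oB; rewrite leq_exp2l // leq_addl.
Qed.

Theorem theorem4 (R : realType) :
  MWCC R ->
  ~ has_sub_mn_algorithm R two_sisp /\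
  ~ has_sub_mn_algorithm R two_sisc /\
  ~ has_sub_mn_algorithm R replacement_paths /\
  ~ has_sub_mn_algorithm R ansc /\
  ~ has_sub_mn_algorithm R radius /\
  ~ has_sub_mn_algorithm R betweenness_centrality /\
  ~ has_sub_mn_algorithm R eccentricities.
Proof.
move=> mwcc; do !split; move=> fast; apply: mwcc; move: fast.
- exact: has_sub_mn_reduction two_sisp_reduction.
- exact: has_sub_mn_reduction two_sisc_reduction.
- exact: has_sub_mn_reduction replacement_reduction.
- exact: has_sub_mn_reduction ansc_reduction.
- exact: has_sub_mn_reduction radius_reduction.
- exact: betweenness_reduction.
- exact: has_sub_mn_reduction eccentricities_reduction.
Qed.
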